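(* Let $0<\alpha<1$, $\lambda>0$, $T>0$. Let $f$ be a continuous bounded function on $[0,\infty)$ and let $g$ be a continuous function on $[0,T)$. Then the function $$c(x,t)=\int_{0}^{\infty}\frac{1}{2\lambda t^{\alpha/2}}\left[M_{\alpha/2}\left(\frac{|x-\xi|}{\lambda t^{\alpha/2}}\right)-M_{\alpha/2}\left(\frac{|x+\xi|}{\lambda t^{\alpha/2}}\right)\right]f(\xi)\,d\xi+\int_0^t M_{\alpha/2}\left(\frac{x}{\lambda (t-\tau)^{\alpha/2}}\right)\frac{\alpha x}{2\lambda (t-\tau)^{\alpha/2+1}}\,g(\tau)\,d\tau$$ is a solution to the problem $$\begin{cases} {}_0D^{\alpha}_t c(x,t)=\lambda^2\dfrac{\partial^2 c}{\partial x^2}(x,t), & 0<x<\infty,\ 0<t<T,\\ c(x,0)=f(x), & 0<x<\infty,\\ c(0,t)=g(t), & 0<t<T.\end{cases}$$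
   Context: For $0<\alpha<1$ the Caputo derivative in $t$ is ${}_0D^{\alpha}_t u(x,t)=\frac{1}{\Gamma(1-\alpha)}\int_0^t (t-\tau)^{-\alpha}\frac{\partial u}{\partial \tau}(x,\tau)\,d\tau$. For $0<\nu<1$ the Mainardi function is $M_{\nu}(z)=\sum_{k=0}^{\infty}\frac{(-z)^k}{k!\,\Gamma(-\nu k+1-\nu)}$, with the convention $1/\Gamma=0$ at the poles of $\Gamma$. Initial and boundary values are understood as limits: $c(x,0)=\lim_{t\searrow 0}c(x,t)$ for each $x>0$ and $c(0,t)=\lim_{x\searrow 0}c(x,t)$ for each $t\in(0,T)$. *)

(* Defs.v *)
From HB Require Import structures.
From mathcomp Require Import all_boot all_order all_algebra.
From mathcomp Require Import all_classical all_reals all_analysis.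
Set Implicit Arguments.
Unset Strict Implicit.
Unset Printing Implicit Defensive.
Import Order.TTheory GRing.Theory Num.Theory.
Import numFieldNormedType.Exports.
Local Open Scope classical_set_scope.
Local Open Scope ring_scope.

Definition euler_gamma (R : realType) (z : R) : R :=
  \int[@lebesgue_measure R]_(s in `]0, +oo[) (s `^ (z - 1) * expR (- s)).

(* For z <= 0, Gamma is continued by the functional equation
   Gamma z = Gamma (z + n) / (z (z + 1) ... (z + n - 1)), with an n > |z|.
   At the poles the denominator is 0, hence Gamma z = 0 and (Gamma z)^-1 = 0,
   which is the convention 1/Gamma = 0 at the poles of Gamma. *)
Definition Gamma (R : realType) (z : R) : R :=
  if 0 < z then euler_gamma z
  else let n := (Num.truncn `|z|).+1 in
       euler_gamma (z + n%:R) / \prod_(i < n) (z + i%:R).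

Lemma Gamma_pole (R : realType) (n : nat) : (Gamma (- n%:R : R))^-1 = 0.
Proof.
rewrite /Gamma oppr_gt0 ltrn0 normrN normr_nat Num.Theory.natrK.
by rewrite (bigD1 ord_max) //= addNr mul0r invr0 mulr0 invr0.
Qed.

Definition mainardi (R : realType) (nu z : R) : R :=
  limn (pseries (fun k => (k`!%:R * Gamma (- nu * k%:R + 1 - nu))^-1) (- z)).

Section Caputo.
Variables (R : realType) (alpha : R) (u : R -> R) (t : R).

Definition caputo_integrand (tau : R) : R := (t - tau) `^ (- alpha) * (u^`())%classic tau.

Definition caputo_truncated (eps : R) : R :=
  (Gamma (1 - alpha))^-1 *
  \int[@lebesgue_measure R]_(tau in `]eps, t[) caputo_integrand tau.

(* The integral over ]0, t[ is improper at 0: if u is only continuous at 0, its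
   derivative need not be absolutely integrable there. The value agrees with
   the Lebesgue integral over ]0, t[ whenever the latter exists. *)
Definition caputo : R := lim (caputo_truncated eps @[eps --> 0^'+]).

Definition caputo_exists : Prop :=
  [/\ forall tau, 0 < tau < t -> derivable u tau 1,
      forall eps, 0 < eps < t ->
        (@lebesgue_measure R).-integrable `]eps, t[ (EFin \o caputo_integrand) &
      cvg (caputo_truncated eps @[eps --> 0^'+])].

End Caputo.

Section Solution.
Variables (R : realType) (alpha lambda : R).

Definition initial_kernel (x t xi : R) : R :=
  (2 * lambda * t `^ (alpha / 2))^-1 *
  (mainardi (alpha / 2) (`|x - xi| / (lambda * t `^ (alpha / 2))) -
   mainardi (alpha / 2) (`|x + xi| / (lambda * t `^ (alpha / 2)))).

Definition boundary_kernel (x t tau : R) : R :=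
  mainardi (alpha / 2) (x / (lambda * (t - tau) `^ (alpha / 2))) *
  (alpha * x / (2 * lambda * (t - tau) `^ (alpha / 2 + 1))).

Definition initial_integrand (f : R -> R) (x t xi : R) : R :=
  initial_kernel x t xi * f xi.

Definition boundary_integrand (g : R -> R) (x t tau : R) : R :=
  boundary_kernel x t tau * g tau.

Definition candidate (f g : R -> R) (x t : R) : R :=
  \int[@lebesgue_measure R]_(xi in `]0, +oo[) initial_integrand f x t xi +
  \int[@lebesgue_measure R]_(tau in `]0, t[) boundary_integrand g x t tau.

Definition is_solution (T : R) (f g : R -> R) (c : R -> R -> R) : Prop :=
  [/\ forall x t, 0 < x -> 0 < t < T ->
        [/\ caputo_exists alpha (c x) t,
            derivable (c ^~ t) x 1,
            derivable ((c ^~ t)^`())%classic x 1 &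
            caputo alpha (c x) t = lambda ^+ 2 * ((c ^~ t)^`(2))%classic x],
      forall x, 0 < x -> c x t @[t --> 0^'+] --> f x &
      forall t, 0 < t < T -> c x t @[x --> 0^'+] --> g t].

End Solution.

(* Main.v *)
From HB Require Import structures.
Require Import Defs.
From mathcomp Require Import all_boot all_order all_algebra.
From mathcomp Require Import all_classical all_reals all_analysis.
From mathcomp Require Import measurable_realfun.
From mathcomp Require Import zify ring lra.
Set Implicit Arguments.
Unset Strict Implicit.
Unset Printing Implicit Defensive.
Import Order.TTheory GRing.Theory Num.Theory.
Import numFieldNormedType.Exports.
Local Open Scope classical_set_scope.
Local Open Scope ring_scope.

(** The half-index nu = alpha / 2 lies in ]0, 1/2[. The functions to which
    everything is reduced are the inverse Laplace transforms of
    p^(-b) exp(- x p^nu): integrals of the imaginary part of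
    z^(-b) exp(s z - x z^nu) dz along a ray from 0, which is either vertical
    ([rayV]) or the negative axis ([rayL]). Up to the factor 1/pi,
    [rayL (1 - nu) y s] is s^(-nu) M_nu(y s^(-nu)), the kernel of the initial
    term, and [rayV 0 y s] is the kernel of the boundary term.

    All the analysis is a calculus of the index b. A derivative in x lowers b
    by nu and changes the sign, a derivative in s lowers it by 1
    ([is_derive_rayL_x], [is_derive_rayL_s]), and a fractional integral of
    order g in s raises it by g ([frac_rayV]). A Caputo derivative of order
    2 nu, which is a derivative followed by a fractional integral of order
    1 - 2 nu, therefore lowers it by 2 nu, exactly as two derivatives in x
    do: this is the equation. The rest is to make the formal computation
    legitimate and to keep track of the singularities at time 0 and on the
    diagonal.

    The ray may be turned as long as the exponential decays, which replaces
    contour integration by a derivative in the angle ([ray_rotation]). It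
    gives causality (the vertical ray integral vanishes for s <= 0,
    [rayV_neg]), the agreement of the two rays for s >= 0 ([rayL_V]), and,
    from the pole at b = 1, the masses of the kernels. Scaling then shows that
    the kernels concentrate: the boundary one as y tends to 0
    ([rayV_approx_identity]) and the initial one as time tends to 0
    ([heat_cvg0]); these are the boundary and initial conditions. The same
    concentration yields the reflection formula of the Gamma function
    ([euler_reflection]), from which the Mainardi series is recognised as the
    Taylor series of a ray integral ([mainardi_ray]).

    In the boundary term ([signal]) the kernel is smooth and vanishes for
    negative times, so that all operations pass under the integral. The
    initial term needs two precautions. In time ([heat]), its derivative is
    singular at 0, and the Caputo integral over ]e, t[ is obtained from the one
    over ]0, t[ by an integration by parts over ]0, e[; as e tends to 0 the
    boundary term leaves - t^(-2 nu) f(x) / Gamma(1 - 2 nu)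
    ([truncated_heat_cvg]). In space, the kernel has a kink on the diagonal and
    f is only continuous: the derivative is moved to the kernel with the help
    of a primitive of f ([is_derive_smear]), and the kink leaves in the second
    derivative the value of f at x, with a coefficient which is the same one
    ([rayL_zero_time]). *)

(** * Integration on the real line *)

Section RealIntegrals.
Context {R : realType}.
Local Notation mu := (@lebesgue_measure R).
Local Notation Rp := (`]0%R, +oo[%classic : set R).
Implicit Types (f g F b : R -> R) (D : set R).

Lemma bound_integrable D f g : measurable D -> measurable_fun D f ->
  (forall x, D x -> `|f x| <= g x) -> mu.-integrable D (EFin \o g) ->
  mu.-integrable D (EFin \o f).
Proof.
move=> mD mf fg ig; apply: le_integrable ig => //; first exact/measurable_EFinP.
move=> x Dx /=; rewrite lee_fin; apply: le_trans (fg _ Dx) _.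
exact: ler_norm.
Qed.

Lemma integrableD_EFin D f g : measurable D -> mu.-integrable D (EFin \o f) ->
  mu.-integrable D (EFin \o g) ->
  mu.-integrable D (EFin \o (fun x => f x + g x)).
Proof.
move=> mD fi gi.
have -> : EFin \o (fun x => f x + g x) = ((EFin \o f) \+ (EFin \o g))%E.
  by apply/funext => x /=; rewrite EFinD.
exact: integrableD.
Qed.

Lemma integrableB_EFin D f g : measurable D -> mu.-integrable D (EFin \o f) ->
  mu.-integrable D (EFin \o g) ->
  mu.-integrable D (EFin \o (fun x => f x - g x)).
Proof.
move=> mD fi gi.
have -> : EFin \o (fun x => f x - g x) = ((EFin \o f) \- (EFin \o g))%E.
  by apply/funext => x /=; rewrite EFinB.
exact: integrableB.
Qed.

Lemma integrableZ_EFin D (c : R) f : measurable D -> mu.-integrable D (EFin \o f) ->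
  mu.-integrable D (EFin \o (fun x => c * f x)).
Proof.
move=> mD fi.
have -> : EFin \o (fun x => c * f x) = (fun x => c%:E * (EFin \o f) x)%E.
  by apply/funext => x /=; rewrite EFinM.
exact: integrableZl.
Qed.

(** The filters to which dominated convergence, a theorem on sequences,
    extends. *)
Definition sequential (G : set_system R) := forall (h : R -> R) (l : R),
  (forall u : R^nat, u n @[n --> \oo] --> G -> h (u n) @[n --> \oo] --> l) ->
  h x @[x --> G] --> l.

Lemma sequential_dnbhs (x : R) : sequential (x^').
Proof.
move=> h l H; apply/cvgr_dnbhsP => u [ux ul]; apply: H.
move=> A xA; have : \forall n \near \oo, u n != x -> A (u n) := ul _ xA.
by apply: filterS => n /=; apply; exact: ux.
Qed.

Lemma sequential_at_right (x : R) : sequential (x^'+).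
Proof.
move=> h l H; apply/cvg_at_rightP => u [ux ul]; apply: H.
move=> A xA; have : \forall n \near \oo, x < u n -> A (u n) := ul _ xA.
by apply: filterS => n /=; apply; exact: ux.
Qed.

Lemma sequential_at_left (x : R) : sequential (x^'-).
Proof.
move=> h l H; apply/cvg_at_leftP => u [ux ul]; apply: H.
move=> A xA; have : \forall n \near \oo, u n < x -> A (u n) := ul _ xA.
by apply: filterS => n /=; apply; exact: ux.
Qed.

Lemma sequential_nbhs (x : R) : sequential (nbhs x).
Proof. by move=> h l H; apply/(@cvg_nbhsP _ R^o) => u; exact: H. Qed.

Lemma dominated_cvg_seq D (f_ : nat -> R -> R) f g : measurable D ->
  (forall n, measurable_fun D (f_ n)) ->
  (forall n x, D x -> `|f_ n x| <= g x) -> mu.-integrable D (EFin \o g) ->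
  (forall x, D x -> f_ n x @[n --> \oo] --> f x) ->
  mu.-integrable D (EFin \o f) /\
  (\int[mu]_(x in D) f_ n x)%R @[n --> \oo] --> (\int[mu]_(x in D) f x)%R.
Proof.
move=> mD mf fg ig ff.
have mlim : measurable_fun D (EFin \o f).
  apply: (emeasurable_fun_cvg (fun n => EFin \o f_ n)).
    by move=> n; exact/measurable_EFinP.
  by move=> x Dx; apply: cvg_EFin; [exact: nearW|exact: ff].
have mE n : measurable_fun D (EFin \o f_ n) by exact/measurable_EFinP.
have cE : {ae mu, forall x, D x ->
    (fun n => EFin \o f_ n) ^~ x @ \oo --> (EFin \o f) x}.
  by apply: aeW => x Dx; apply: cvg_EFin; [exact: nearW|exact: ff].
have dE : {ae mu, forall x n, D x -> (`|(EFin \o f_ n) x| <= (EFin \o g) x)%E}.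
  by apply: aeW => x n Dx; rewrite /= lee_fin; exact: fg.
have [intf _ cf] := @dominated_convergence _ _ _ mu _ mD
  (fun n => EFin \o f_ n) (EFin \o f) (EFin \o g) mE mlim cE ig dE.
split => //; rewrite /Rintegral.
apply: fine_cvg; rewrite fineK; last exact: integrable_fin_num.
exact: cf.
Qed.

Lemma dominated_cvg_filter (G : set_system R) {FG : Filter G} D
    (f_ : R -> R -> R) f g : sequential G ->
  measurable D ->
  (\forall t \near G, measurable_fun D (f_ t)) ->
  (\forall t \near G, forall x, D x -> `|f_ t x| <= g x) ->
  mu.-integrable D (EFin \o g) ->
  (forall x, D x -> f_ t x @[t --> G] --> f x) ->
  (\int[mu]_(x in D) f_ t x)%R @[t --> G] --> (\int[mu]_(x in D) f x)%R.
Proof.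
move=> seqG mD mf fg ig ff; apply: seqG => u uG.
have [N _ HN] : \forall n \near \oo, measurable_fun D (f_ (u n)) /\
    forall x, D x -> `|f_ (u n) x| <= g x.
  exact: (uG (fun t => measurable_fun D (f_ t) /\
    forall x, D x -> `|f_ t x| <= g x) (filterI mf fg)).
rewrite -(cvg_shiftn N)/=.
apply: (@dominated_cvg_seq D (fun n => f_ (u (n + N)%N)) f g _ _ _ _ _).2 => //.
- by move=> n; exact: (HN _ (leq_addl _ _)).1.
- by move=> n; exact: (HN _ (leq_addl _ _)).2.
- move=> x Dx; rewrite (cvg_shiftn N (fun n => f_ (u n) x)).
  exact: cvg_trans (cvg_app (f_ ^~ x) uG) (ff _ Dx).
Qed.

Lemma is_derive1_cvgP F (x d : R) : is_derive x 1 F d <->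
  h^-1 * (F (h + x) - F x) @[h --> 0^'] --> d.
Proof.
have E : (fun h => h^-1 *: (F (h *: 1 + x) - F x)) =
         (fun h => h^-1 * (F (h + x) - F x)).
  by apply/funext => h; rewrite -[h *: 1]/(h * 1) mulr1.
split => [[dF DF]|H].
  by rewrite -DF /derive -E; exact: dF.
apply: DeriveDef; first by apply/cvg_ex; exists d; rewrite E.
by rewrite /derive; apply/cvg_lim => //; rewrite E.
Qed.

Lemma is_derive1_continuous F (x d : R) : is_derive x 1 F d ->
  {for x, continuous F}.
Proof. by move=> [dF _]; exact/differentiable_continuous/derivable1_diffP. Qed.

(** Domination is asked of the increments rather than of the derivative, so
    that only differentiability at [x0] itself is required. *)
Lemma is_derive_under_integral D (k : R -> R -> R) (x0 e : R) dk b :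
  measurable D -> 0 < e ->
  (forall x, `|x - x0| < e -> mu.-integrable D (EFin \o k x)) ->
  (forall x y, `|x - x0| < e -> D y ->
     `|k x y - k x0 y| <= `|x - x0| * b y) ->
  mu.-integrable D (EFin \o b) ->
  (forall y, D y -> is_derive x0 1 (k ^~ y) (dk y)) ->
  is_derive x0 1 (fun x => \int[mu]_(y in D) k x y)%R
    (\int[mu]_(y in D) dk y)%R.
Proof.
move=> mD e0 ik kb ib kd; apply/is_derive1_cvgP.
have ik0 : mu.-integrable D (EFin \o k x0) by apply: ik; rewrite subrr normr0.
have nh : \forall h \near (0 : R)^', h != 0 /\ `|h + x0 - x0| < e.
  near=> h; split; first by near: h; exact: nbhs_dnbhs_neq.
  rewrite addrK; near: h; apply: dnbhs0_lt; exact: e0.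
suff H : (\int[mu]_(y in D) (h^-1 * (k (h + x0) y - k x0 y)))%R @[h --> (0:R)^'] -->
    (\int[mu]_(y in D) dk y)%R.
  apply: cvg_trans H; apply: near_eq_cvg; near=> h.
  have [hn0 he] : h != 0 /\ `|h + x0 - x0| < e by near: h; exact: nh.
  rewrite RintegralZl//; last first.
    by apply: integrableB_EFin => //; exact: ik.
  by rewrite RintegralB//; exact: ik.
apply: (@dominated_cvg_filter _ _ D _ dk b (@sequential_dnbhs 0)) => //.
- near=> h; have [hn0 he] : h != 0 /\ `|h + x0 - x0| < e by near: h; exact: nh.
  apply: measurable_funM => //; apply: measurable_funB.
    by have /integrableP[/measurable_EFinP] := ik _ he.
  by have /integrableP[/measurable_EFinP] := ik0.
- near=> h => y Dy; have [hn0 he] : h != 0 /\ `|h + x0 - x0| < e by near: h; exact: nh.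
  rewrite normrM normfV mulrC ler_pdivrMr ?normr_gt0// mulrC.
  by have := kb _ _ he Dy; rewrite addrK.
- by move=> y Dy; have /is_derive1_cvgP := kd _ Dy.
Unshelve. all: by end_near. Qed.

(** Both sides are the integral of [f] against a measure; the two measures
    agree on the half-open intervals, hence everywhere. *)
Lemma integral_affine_ge0 (f : R -> \bar R) (a c : R) : a != 0 ->
  measurable_fun setT f -> (forall x, 0 <= f x)%E ->
  (\int[mu]_x f x = `|a|%:E * \int[mu]_x f (a * x + c)%R)%E.
Proof.
move=> a0 mf f0.
pose phi : R -> measurableTypeR R := fun x => a * x + c.
have mphi : measurable_fun setT phi.
  by apply: measurable_funD => //; apply: measurable_funM.
suff mE A : measurable A -> (mu A = `|a|%:E * mu (phi @^-1` A))%E.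
  pose k : {nonneg R} := NngNum (normr_ge0 a).
  rewrite (eq_measure_integral (mscale k (pushforward mu phi)))//=.
    by rewrite ge0_integral_mscale//= ge0_integral_pushforward//=.
  by move=> A mA _; exact: mE.
pose k : {nonneg R} := NngNum (normr_ge0 a).
have [m mE] : exists m : {measure set (measurableTypeR R) -> \bar R},
    forall A, m A = mu (phi @^-1` A).
  by unshelve eexists (pushforward mu phi).
move=> mA; rewrite -mE -[RHS]/(mscale k m A).
apply: lebesgue_measure_unique => // _ [[u v]] _ <- /=.
rewrite /mscale/= mE.
have [agt|alt] : a > 0 \/ a < 0.
    by move: a0; rewrite neq_lt => /orP[]; [right|left].
  - have -> : phi @^-1` `]u, v] = `](u - c) / a, (v - c) / a]%classic.
      apply/seteqP; split => x /=; rewrite !in_itv/= /phi.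
        by rewrite ltr_pdivrMr// ler_pdivlMr// ltrBlDr lerBrDr mulrC.
      by rewrite ltr_pdivrMr// ler_pdivlMr// ltrBlDr lerBrDr mulrC.
    rewrite !lebesgue_measure_itv/= !lte_fin ltr_pM2r ?invr_gt0// ltrD2r.
    case: ifPn => [uv|_]; last by rewrite mule0.
    rewrite -EFinM; congr EFin; rewrite gtr0_norm//.
    by field.
  - have -> : phi @^-1` `]u, v] = `[(v - c) / a, (u - c) / a[%classic.
      apply/seteqP; split => x /=; rewrite !in_itv/= /phi.
        by rewrite ltr_ndivlMr// ler_ndivrMr// ltrBlDr lerBrDr mulrC andbC.
      by rewrite ltr_ndivlMr// ler_ndivrMr// ltrBlDr lerBrDr mulrC andbC.
    rewrite !lebesgue_measure_itv/= !lte_fin ltr_nM2r ?invr_lt0// ltrD2r.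
    case: ifPn => [uv|_]; last by rewrite mule0.
    rewrite -EFinM; congr EFin; rewrite ltr0_norm//.
    by field.
Qed.

Lemma measurable_affine (a c : R) : measurable_fun setT (fun x : R => a * x + c).
Proof. by apply: measurable_funD => //; apply: measurable_funM. Qed.

Lemma integrable_affine f (a c : R) : a != 0 ->
  mu.-integrable setT (EFin \o f) ->
  mu.-integrable setT (EFin \o (fun x => f (a * x + c))).
Proof.
move=> a0 /integrableP[mf fi]; apply/integrableP; split.
  apply: (measurableT_comp mf); exact: measurable_affine.
move: fi; rewrite (@integral_affine_ge0 _ a c)//=; last first.
  exact: (measurableT_comp (@abse_measurable _ _) mf).
apply: contraTT; rewrite -!leNgt !leye_eq => /eqP ->.
by rewrite gt0_muley// lte_fin normr_gt0.
Qed.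

Lemma Rintegral_affine f (a c : R) : a != 0 ->
  mu.-integrable setT (EFin \o f) ->
  (\int[mu]_x f x = `|a| * \int[mu]_x f (a * x + c)%R)%R.
Proof.
move=> a0 fi; have fi' := integrable_affine c a0 fi.
have mf : measurable_fun setT (EFin \o f) by case/integrableP : fi.
set g := fun x => f (a * x + c) in fi' *.
have ip := integrable_funepos measurableT fi'.
have iq := integrable_funeneg measurableT fi'.
have pf := integrable_fin_num measurableT ip.
have qf := integrable_fin_num measurableT iq.
rewrite /Rintegral integralE [in RHS]integralE.
rewrite (@integral_affine_ge0 _ a c)//; last exact: measurable_funepos.
rewrite (@integral_affine_ge0 ((EFin \o f)^\-)%E a c)//; last exact: measurable_funeneg.
transitivity (fine (`|a|%:E * \int[mu]_x (EFin \o g)^\+ x -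
    `|a|%:E * \int[mu]_x (EFin \o g)^\- x))%E.
  by congr (fine (_ * _ - _ * _)%E); apply: eq_integral => x _;
    rewrite ?funeposE ?funenegE.
by rewrite -(fineK pf) -(fineK qf) -!EFinM -!EFinB /= mulrBr.
Qed.

(** The open interval is the form in which the integrals below occur. *)
Lemma FTC2_oo F f (a c : R) : a < c ->
  (forall x, a <= x <= c -> is_derive x 1 F (f x)) ->
  (forall x, a <= x <= c -> {for x, continuous f}) ->
  mu.-integrable `]a, c[ (EFin \o f) /\
  (\int[mu]_(x in `]a, c[) f x = F c - F a)%R.
Proof.
move=> ac dF cf.
have cfw : {within `[a, c], continuous f}.
  by apply: continuous_in_subspaceT => x /set_mem/=; rewrite in_itv/=; exact: cf.
have ifc : mu.-integrable `[a, c] (EFin \o f).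
  exact: continuous_compact_integrable (@segment_compact _ _ _) cfw.
have ifo : mu.-integrable `]a, c[ (EFin \o f).
  by apply: integrableS ifc => //; exact: subset_itv_oo_cc.
have ico : mu.-integrable `[a, c[ (EFin \o f).
  by apply: integrableS ifc => //; apply: subset_itvl; rewrite bnd_simp.
split => //.
rewrite Rintegral_itv_obnd_cbnd// Rintegral_itv_bndo_bndc//.
have dFx x : a <= x <= c -> {for x, continuous F}.
  by move=> xac; exact: is_derive1_continuous (dF _ xac).
rewrite /Rintegral (@continuous_FTC2 _ f F)//.
- split.
  + by move=> x; rewrite in_itv/= => /andP[ax xc]; have [] : is_derive x 1 F (f x)
      by apply: dF; rewrite !ltW.
  + by apply: cvg_at_right_filter; apply: dFx; rewrite lexx ltW.
  + by apply: cvg_at_left_filter; apply: dFx; rewrite lexx ltW.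
- move=> x; rewrite in_itv/= => /andP[ax xc]; rewrite derive1E.
  have xac : a <= x <= c by rewrite !ltW.
  by have [_ ->] := dF _ xac.
Qed.

(** Exhaust the half-line by the intervals ]1/(n+1), n+2[: the increments of
    [F] converge to [l1 - l0] and, by dominated convergence, to the integral. *)
Lemma FTC_halfline F f (l0 l1 : R) :
  (forall x : R, 0 < x -> is_derive x 1 F (f x)) ->
  (forall x : R, 0 < x -> {for x, continuous f}) ->
  mu.-integrable Rp (EFin \o f) ->
  F x @[x --> (0:R)^'+] --> l0 -> F x @[x --> +oo%R] --> l1 ->
  (\int[mu]_(x in Rp) f x = l1 - l0)%R.
Proof.
move=> dF cf fi F0 F1.
pose an n : R := n.+1%:R^-1; pose bn n : R := n.+2%:R.
have an0 n : 0 < an n by rewrite invr_gt0.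
have abn n : an n < bn n.
  rewrite /an /bn (@le_lt_trans _ _ 1)//; first by rewrite invf_le1// ler1n.
  by rewrite ltr1n.
have an_cvg : an n @[n --> \oo] --> 0 by exact: cvg_harmonic.
have bn_cvg : bn n @[n --> \oo] --> +oo%R.
  apply/cvgryPge => A; near=> n; rewrite /bn.
  apply: (@le_trans _ _ n%:R); last by rewrite ler_nat; lia.
  by near: n; exact: nbhs_infty_ger.
have mf : measurable_fun Rp f by case/integrableP : fi => /measurable_EFinP.
have ifn n : (\int[mu]_(x in `]an n, bn n[) f x = F (bn n) - F (an n))%R.
  apply: (@FTC2_oo F f _ _ (abn n) _ _).2 => x /andP[ax _].
    by apply: dF; exact: lt_le_trans ax.
  by apply: cf; exact: lt_le_trans ax.
have H1 : F (bn n) - F (an n) @[n --> \oo] --> l1 - l0.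
  apply: cvgB; first exact: (cvg_comp _ _ bn_cvg F1).
  by move/cvg_at_rightP : F0; apply; split.
have H2 : F (bn n) - F (an n) @[n --> \oo] --> (\int[mu]_(x in Rp) f x)%R.
  rewrite (_ : (fun n => _) = (fun n => \int[mu]_(x in Rp) (f \_ `]an n, bn n[) x)%R); last first.
    apply/funext => n; rewrite -ifn -Rintegral_mkcondr; congr (Rintegral _ _ _).
    apply/esym/setIidr => x /=; rewrite !in_itv/= andbT => /andP[+ _].
    exact: lt_trans.
  apply: (@dominated_cvg_seq _ _ _ (fun x => `|f x|) _ _ _ _ _).2 => //.
  - move=> n; apply/measurable_restrict => //.
    by apply: measurable_funS mf => //; exact: subIsetl.
  - by move=> n x _; rewrite patchE; case: ifP => // _; rewrite normr0.
  - exact: integrable_norm.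
  - move=> x; rewrite /= in_itv/= andbT => x0.
    apply: cvg_near_cst; near=> n; rewrite patchE mem_set//= in_itv/=.
    apply/andP; split; near: n.
    + exact: (cvgr_lt _ an_cvg).
    + by move/cvgryPgt : bn_cvg; exact.
have E := cvg_lim (@Rhausdorff R) H2.
by rewrite -E (cvg_lim (@Rhausdorff R) H1).
Unshelve. all: by end_near. Qed.

(** A nonnegative derivative has over every compact interval an integral at
    most twice the bound of its primitive. *)
Lemma integrable_bounded_primitive F f (C : R) :
  (forall x : R, 0 < x -> is_derive x 1 F (f x)) ->
  (forall x : R, 0 < x -> {for x, continuous f}) ->
  (forall x : R, 0 < x -> 0 <= f x) -> (forall x : R, 0 < x -> `|F x| <= C) ->
  mu.-integrable Rp (EFin \o f).
Proof.
move=> dF cf f0 FC.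
pose an n : R := n.+1%:R^-1; pose bn n : R := n.+2%:R.
have an0 n : 0 < an n by rewrite invr_gt0.
have abn n : an n < bn n.
  rewrite /an /bn (@le_lt_trans _ _ 1)//; first by rewrite invf_le1// ler1n.
  by rewrite ltr1n.
have pos x n : an n < x < bn n -> 0 < x by move=> /andP[/(lt_trans (an0 n))].
have E : \bigcup_n `]an n, bn n[%classic = Rp.
  apply/seteqP; split => x /=.
    by move=> [n _]/=; rewrite !in_itv/= andbT; exact: pos.
  rewrite in_itv/= andbT => x0.
  have an_cvg : an n @[n --> \oo] --> 0 by exact: cvg_harmonic.
  near \oo => n; exists n => //=; rewrite in_itv/=; apply/andP; split.
    by near: n; exact: (cvgr_lt _ an_cvg).
  apply: (@lt_trans _ _ n%:R); first by near: n; exact: nbhs_infty_gtr.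
  by rewrite ltr_nat; lia.
have mf : measurable_fun Rp f.
  apply: open_continuous_measurable_fun => //.
  by move=> x; rewrite inE/= in_itv/= andbT; exact: cf.
have mfn n : measurable_fun `]an n, bn n[ (EFin \o f).
  apply/measurable_EFinP; apply: measurable_funS mf => //; rewrite -E.
  exact: (bigcup_sup (i := n)).
apply/integrableP; split; first exact/measurable_EFinP.
rewrite (_ : (\int[mu]_(x in Rp) _ = \int[mu]_(x in \bigcup_n `]an n, bn n[%classic) (EFin \o f) x)%E); last first.
  rewrite E; apply: eq_integral => x; rewrite inE/= in_itv/= andbT => x0.
  by rewrite ger0_norm// f0.
have nd : nondecreasing_seq (fun n => `]an n, bn n[%classic : set R).
  apply/nondecreasing_seqP => n; apply/subsetPset; apply: subset_itv.
    by rewrite bnd_simp lef_pV2 ?posrE// ler_nat.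
  by rewrite bnd_simp ler_nat.
have H : (\int[mu]_(x in `]an n, bn n[) (EFin \o f) x)%E @[n --> \oo] -->
    (\int[mu]_(x in \bigcup_n `]an n, bn n[%classic) (EFin \o f) x)%E.
  apply: ge0_nondecreasing_set_cvg_integral => // i x /=.
  by rewrite in_itv/= lee_fin => /pos /f0.
apply: (@le_lt_trans _ _ (C + C)%:E); last by rewrite ltry.
rewrite -(cvg_lim _ H)//; apply: lime_le; first exact: cvgP H.
near=> n.
have [fi fE] : mu.-integrable `]an n, bn n[ (EFin \o f) /\
    (\int[mu]_(x in `]an n, bn n[) f x = F (bn n) - F (an n))%R.
  apply: FTC2_oo => // x /andP[ax _]; [apply: dF|apply: cf];
  exact: lt_le_trans ax.
have := integrable_fin_num _ fi; move=> /(_ (measurable_itv _)) fn.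
rewrite -(fineK fn) -[fine _]/(\int[mu]_(x in `]an n, bn n[) f x)%R fE lee_fin.
apply: (le_trans (ler_norm _)); apply: (le_trans (ler_normB _ _)).
by apply: lerD; apply: FC => //; exact: (lt_trans (an0 n)).
Unshelve. all: by end_near. Qed.

End RealIntegrals.

(** * Powers against exponentials *)

Section PowersAndExponentials.
Context {R : realType}.
Local Notation mu := (@lebesgue_measure R).
Local Notation Rp := (`]0%R, +oo[%classic : set R).
Implicit Types (f g F a b : R -> R) (D : set R).

(** An exponential beats every power: bound it by the k-th power of its
    argument, with k large enough to absorb the exponent [p]. *)
Lemma powR_expR_bound (p m q : R) : 0 < m -> 0 < q ->
  exists C : R, 0 <= C /\
    forall r : R, 0 < r -> (1 + r) `^ p * expR (- (m * r `^ q)) <= C.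
Proof.
move=> m0 q0.
(* k q >= |p|, so that the power of r left over is negative. *)
pose k := (Num.truncn (`|p| / q)).+1.
have kq : `|p| <= k%:R * q.
  by rewrite -ler_pdivrMr// ltW// truncnS_gt.
exists (2 `^ `|p| * (1 + (k%:R / m) ^+ k)); split.
  by rewrite mulr_ge0 ?powR_ge0// addr_ge0// exprn_ge0// divr_ge0// ltW.
move=> r r0.
have r1 : 1 <= 1 + r by rewrite lerDl ltW.
have e1 : expR (- (m * r `^ q)) <= 1.
  by rewrite expR_le1 oppr_le0 mulr_ge0 ?powR_ge0// ltW.
apply: (@le_trans _ _ ((1 + r) `^ `|p| * expR (- (m * r `^ q)))).
  by apply: ler_wpM2r; [exact: expR_ge0|apply: ler_powR => //; exact: ler_norm].
have [rle1|rgt1] := leP r 1.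
  apply: ler_pM; rewrite ?powR_ge0 ?expR_ge0//.
    by apply: ge0_ler_powR; rewrite ?nnegrE//; lra.
  by rewrite (le_trans e1)// lerDl exprn_ge0// divr_ge0// ltW.
have rq0 : 0 < r `^ q by rewrite powR_gt0.
have kn0 : (k%:R : R) != 0 by rewrite pnatr_eq0.
have ek : expR (- (m * r `^ q)) <= (k%:R / m) ^+ k * r `^ (- (k%:R * q)).
  have h : (m * r `^ q) / k%:R <= expR ((m * r `^ q) / k%:R).
    by apply: le_trans (expR_ge1Dx _); rewrite lerDr.
  have h2 : ((m * r `^ q) / k%:R) ^+ k <= expR (m * r `^ q).
    rewrite -[X in _ <= expR X](@mulfVK _ k%:R)// expRM_natr.
    by apply: lerXn2r; rewrite ?nnegrE ?expR_ge0// divr_ge0// mulr_ge0 ?ltW.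
  rewrite expRN -[leLHS]mul1r ler_pdivrMr ?expR_gt0//.
  rewrite [leLHS](_ : 1 = (k%:R / m) ^+ k * r `^ (- (k%:R * q)) * (m * r `^ q / k%:R) ^+ k); last first.
    rewrite powRN (mulrC k%:R q) powRrM powR_mulrn ?powR_ge0// -exprVn -!exprMn.
    rewrite -[LHS](expr1n _ k); congr (_ ^+ _); field.
    by rewrite kn0 !gt_eqF.
  apply: ler_wpM2l; last exact: h2.
  by rewrite mulr_ge0 ?powR_ge0// exprn_ge0// divr_ge0// ltW.
have rp : (1 + r) `^ `|p| <= 2 `^ `|p| * r `^ (k%:R * q).
  apply: (@le_trans _ _ ((2 * r) `^ `|p|)).
    by apply: ge0_ler_powR; rewrite ?nnegrE//; lra.
  rewrite powRM//; last exact: ltW.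
  by apply: ler_wpM2l; [exact: powR_ge0|apply: ler_powR => //; exact: ltW].
apply: (le_trans (ler_pM (powR_ge0 _ _) (expR_ge0 _) rp ek)).
rewrite -mulrA; apply: ler_wpM2l; first exact: powR_ge0.
rewrite mulrCA -powRD; last by rewrite (gt_eqF r0) implybT.
by rewrite subrr powRr0 mulr1 lerDr.
Qed.

(** It is, up to a factor, the derivative of the bounded function (r / (1 +
    r))^(a+1). It has the size r^a near 0 and r^(-2) at infinity, and so it
    dominates the integrands met below. *)
Lemma integrable_powR_rational (a : R) : -1 < a ->
  mu.-integrable Rp (EFin \o (fun r => (r / (1 + r)) `^ a * (1 + r) ^- 2)).
Proof.
move=> a1; have a0 : 0 < a + 1 by lra.
have rp (r : R) : 0 < r -> 0 < r / (1 + r) by move=> r0; rewrite divr_gt0//; lra.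
have dq (r : R) : 0 < r -> is_derive r 1 (fun r : R => r / (1 + r)) ((1 + r) ^- 2).
  move=> r0; have rn : 1 + r != 0 by rewrite gt_eqF//; lra.
  have d1 : is_derive r 1 (fun r : R => 1 + r) 1.
    by apply: is_derive_eq; rewrite add0r mulr1.
  have := is_deriveM (is_derive_id r 1) (is_deriveV rn d1).
  move=> H; apply: (is_derive_eq H).
  rewrite -[_ *: _]/(r * (- (1 + r) ^- 2 * 1)) -[_ *: 1]/((1 + r)^-1 * 1).
  by field.
have dp c (r : R) : 0 < r -> is_derive r 1 (fun r : R => (r / (1 + r)) `^ c)
    (c * (r / (1 + r)) `^ (c - 1) * (1 + r) ^- 2).
  move=> r0; have d1 := is_derive1_powR c (rp _ r0); have d2 := dq _ r0.
  exact: (@is_derive1_comp R (fun y : R => y `^ c) (fun r : R => r / (1 + r)) r _ _ d1 d2).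
pose F (r : R) := (a + 1)^-1 * (r / (1 + r)) `^ (a + 1).
apply: (@integrable_bounded_primitive R F _ ((a + 1)^-1)).
- move=> r r0; have d3 := dp (a + 1) _ r0.
  apply: is_derive_eq; rewrite addrK -[_ *: _]/(_ * _) -mulrA.
  by rewrite mulKf// gt_eqF.
- move=> r r0; apply: continuousM; first exact: is_derive1_continuous (dp a _ r0).
  apply: continuousV; first by rewrite expf_neq0// gt_eqF//; lra.
  have c1 : {for r, continuous (fun r : R => 1 + r)}.
    by apply: continuousD; [exact: cvg_cst|exact: cvg_id].
  exact: (continuousM c1 c1).
- by move=> r r0; rewrite mulr_ge0 ?powR_ge0// invr_ge0 exprn_ge0//; lra.
- move=> r r0; rewrite ger0_norm; last by rewrite mulr_ge0 ?powR_ge0// invr_ge0 ltW.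
  apply: ler_piMr; first by rewrite invr_ge0 ltW.
  rewrite [leRHS](_ : 1 = 1 `^ (a + 1)); last by rewrite powR1.
  apply: ge0_ler_powR; rewrite ?nnegrE ?(ltW (rp _ r0)) ?(ltW a0)//.
  by rewrite ler_pdivrMr; lra.
Qed.

Lemma integrable_powR_expR (c m q : R) : -1 < c -> 0 < m -> 0 < q ->
  mu.-integrable Rp (EFin \o (fun r => r `^ c * expR (- (m * r `^ q)))).
Proof.
move=> c1 m0 q0; have [C [C0 CE]] := powR_expR_bound (c + 2) m0 q0.
apply: (bound_integrable (g := fun r => C * ((r / (1 + r)) `^ c * (1 + r) ^- 2))) => //.
- apply: measurable_funTS; apply: measurable_funM => //.
  apply: measurableT_comp => //; apply: measurableT_comp => //.
  exact: measurable_funM.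
- move=> r; rewrite /= in_itv/= andbT => r0; have r1 : 0 < 1 + r by lra.
  rewrite ger0_norm ?mulr_ge0 ?powR_ge0 ?expR_ge0//.
  rewrite (_ : r `^ c * _ = (r / (1 + r)) `^ c * (1 + r) ^- 2 *
     ((1 + r) `^ (c + 2) * expR (- (m * r `^ q)))).
    rewrite [leRHS]mulrC; apply: ler_wpM2l; last exact: CE.
    by rewrite mulr_ge0 ?powR_ge0// invr_ge0 exprn_ge0// ltW.
  have -> : (r / (1 + r)) `^ c = r `^ c * (1 + r) `^ (- c).
    rewrite powRM; [|exact: ltW|by rewrite invr_ge0 ltW].
    by rewrite -(powR_inv1 (ltW r1)) -powRrM mulN1r.
  have -> : (1 + r) `^ (c + 2) = (1 + r) `^ c * (1 + r) ^+ 2.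
    by rewrite powRD ?(gt_eqF r1) ?implybT// powR_mulrn// ltW.
  rewrite powRN; field; rewrite !gt_eqF// powR_gt0//.
- by apply: integrableZ_EFin => //; exact: integrable_powR_rational.
Qed.

End PowersAndExponentials.

Section FubiniAndBounds.
Context {R : realType}.
Local Notation mu := (@lebesgue_measure R).
Local Notation Rp := (`]0%R, +oo[%classic : set R).
Implicit Types (f g F a b : R -> R) (D : set R).

Lemma integrable_restrictT D f : measurable D ->
  mu.-integrable D (EFin \o f) -> mu.-integrable setT (EFin \o (f \_ D)).
Proof.
move=> mD fi; rewrite -restrict_EFin.
exact: (@integrable_mkcond _ _ _ mu _ (EFin \o f) mD).1.
Qed.

(** A bound by a product of integrable functions gives the integrability on
    the product that Fubini requires. *)
Lemma Rfubini (D1 D2 : set R) (k : R -> R -> R) a b :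
  measurable D1 -> measurable D2 ->
  measurable_fun (D1 `*` D2) (fun z : R * R => k z.1 z.2) ->
  (forall x y, D1 x -> D2 y -> `|k x y| <= a x * b y) ->
  mu.-integrable D1 (EFin \o a) -> mu.-integrable D2 (EFin \o b) ->
  (\int[mu]_(x in D1) \int[mu]_(y in D2) k x y =
   \int[mu]_(y in D2) \int[mu]_(x in D1) k x y)%R.
Proof.
move=> mD1 mD2 mk kab ia ib.
pose D := D1 `*` D2; have mD : measurable D by exact: measurableX.
pose K : measurableTypeR R * measurableTypeR R -> R := (fun z => k z.1 z.2) \_ D.
have KE x y : K (x, y) = if (x \in D1) && (y \in D2) then k x y else 0.
  by rewrite /K patchE /D in_setX.
have mK : measurable_fun setT (EFin \o K).
  by apply/measurable_EFinP; apply/(measurable_restrictT _ _).1.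
have an0 x : 0 <= (Num.norm \o (a \_ D1)) x by rewrite /=.
have bn0 x : 0 <= (Num.norm \o (b \_ D2)) x by rewrite /=.
have ia' : mu.-integrable setT (EFin \o (Num.norm \o (a \_ D1))).
  apply: integrable_norm; exact: integrable_restrictT.
have ib' : mu.-integrable setT (EFin \o (Num.norm \o (b \_ D2))).
  apply: integrable_norm; exact: integrable_restrictT.
have Kab x y : `|K (x, y)| <= (Num.norm \o (a \_ D1)) x * (Num.norm \o (b \_ D2)) y.
  rewrite KE /= !patchE; case: ifPn => [/andP[xD yD]|_]; last first.
    by rewrite normr0 mulr_ge0.
  rewrite xD yD -normrM (le_trans _ (ler_norm _))//.
  by apply: kab; exact: set_mem.
have iK : (mu \x mu)%E.-integrable setT (EFin \o K).
  apply/integrable12ltyP => //.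
  apply: (@le_lt_trans _ _ (\int[mu]_x \int[mu]_y
     (((Num.norm \o (a \_ D1)) x)%:E * (EFin \o (Num.norm \o (b \_ D2))) y))%E).
    apply: ge0_le_integral => //.
    - by move=> x _; exact: integral_ge0.
    - exact: (measurable_fun_fubini_tonelli_F (fun z => `|(EFin \o K) z|%E)
        (measurableT_comp (@abse_measurable _ _) mK)).
    - rewrite (_ : (fun x => _) = fun x => ((EFin \o (Num.norm \o (a \_ D1))) x *
          \int[mu]_y (EFin \o (Num.norm \o (b \_ D2))) y)%E); last first.
        by apply/funext => x; rewrite integralZl.
      apply: emeasurable_funM => //; first by have /integrableP[] := ia'.
    - move=> x _; apply: ge0_le_integral => //.
      + apply: (measurableT_comp (@abse_measurable _ _)).
        exact: (measurableT_comp mK (pair1_measurable x)).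
      + by apply: emeasurable_funM => //; have /integrableP[] := ib'.
      + by move=> y _; rewrite /= lee_fin.
  under eq_integral do rewrite integralZl//.
  have fb := integrable_fin_num measurableT ib'.
  rewrite -(fineK fb) integralZr// -(fineK (integrable_fin_num measurableT ia')).
  by rewrite -EFinM ltry.
have /= := Fubini iK.
have inner1 x : (\int[mu]_y (K (x, y))%:E = ((fun x => \int[mu]_(y in D2) k x y) \_ D1 x)%:E)%E.
  rewrite patchE; have [xD|xD] := boolP (x \in D1); last first.
    by rewrite integral0_eq// => y _; rewrite KE (negbTE xD).
  rewrite /Rintegral fineK.
    rewrite [in RHS]integral_mkcond; apply: eq_integral => y _.
    by rewrite KE xD/= restrict_EFin/= patchE; case: ifP.
  apply: integrable_fin_num => //.
  apply: (bound_integrable (g := fun y => a x * b y)) => //.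
  - apply: (measurable_comp (F := D) (f := fun z => k z.1 z.2) (g := pair x)) => //.
      by move=> _ [y /= Dy <-]; split => //=; exact: set_mem.
    exact: measurable_funTS (pair1_measurable x).
  - by move=> y Dy; apply: kab => //; exact: set_mem.
  - exact: integrableZ_EFin.
have inner2 y : (\int[mu]_x (K (x, y))%:E = ((fun y => \int[mu]_(x in D1) k x y) \_ D2 y)%:E)%E.
  rewrite patchE; have [yD|yD] := boolP (y \in D2); last first.
    by rewrite integral0_eq// => x _; rewrite KE (negbTE yD) andbF.
  rewrite /Rintegral fineK.
    rewrite [in RHS]integral_mkcond; apply: eq_integral => x _.
    by rewrite KE yD andbT restrict_EFin/= patchE; case: ifP.
  apply: integrable_fin_num => //.
  apply: (bound_integrable (g := fun x => b y * a x)) => //.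
  - apply: (measurable_comp (F := D) (f := fun z => k z.1 z.2) (g := pair^~ y)) => //.
      by move=> _ [x /= Dx <-]; split => //=; exact: set_mem.
    exact: measurable_funTS (pair2_measurable y).
  - by move=> x Dx; rewrite mulrC; apply: kab => //; exact: set_mem.
  - exact: integrableZ_EFin.
under eq_integral do rewrite inner1.
under [in X in _ = X -> _]eq_integral do rewrite inner2.
by move=> E; rewrite [LHS]Rintegral_mkcond [RHS]Rintegral_mkcond; exact: (congr1 fine E).
Qed.

Lemma bounded_integrable (u v M : R) f : measurable_fun `]u, v[ f ->
  (forall x, u < x < v -> `|f x| <= M) ->
  mu.-integrable `]u, v[ (EFin \o f).
Proof.
move=> mf fM; apply: (bound_integrable (g := cst M)) => //.
apply: measurable_bounded_integrable => //.
  rewrite /= lebesgue_measure_itv/= lte_fin; case: ifPn => _; last exact: ltry.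
  by rewrite -EFinB ltry.
exact: bounded_cst.
Qed.

Lemma Rintegral_setD1 (D : set R) f (p : R) : measurable D ->
  mu.-integrable D (EFin \o f) ->
  (\int[mu]_(x in D) f x = \int[mu]_(x in D `\ p) f x)%R.
Proof.
move=> mD fi; rewrite /Rintegral; congr fine.
by apply: negligible_integral => //; exact: lebesgue_measure_set1.
Qed.

Lemma integrable_powR_itv (c T : R) : -1 < c -> 0 <= T ->
  mu.-integrable `]0, T[ (EFin \o (fun r : R => r `^ c)).
Proof.
move=> c1 T0.
apply: (bound_integrable (g := fun r => expR T * (r `^ c * expR (- (1 * r `^ 1))))) => //.
- by apply: measurable_funTS; exact: measurable_powR.
- move=> r; rewrite /= in_itv/= => /andP[r0 rT].
  rewrite ger0_norm ?powR_ge0// mulrCA ler_peMr ?powR_ge0//.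
  by rewrite -expRD -[leLHS]expR0 ler_expR mul1r powRr1 ?subr_ge0 ltW.
- apply: integrableZ_EFin => //.
  apply: integrableS (integrable_powR_expR c1 (@ltr01 R) (@ltr01 R)) => //.
  by apply: subset_itvl; rewrite bnd_simp.
Qed.

Lemma continuous_invsqr : continuous (fun w : R => (1 + w ^+ 2)^-1).
Proof.
move=> x; apply: cvgV; first by rewrite gt_eqF// ltr_pwDl// sqr_ge0.
by apply: cvgD; [exact: cvg_cst|exact: exprn_continuous].
Qed.

Lemma integrable_invsqr : mu.-integrable Rp (EFin \o (fun w : R => (1 + w ^+ 2)^-1)).
Proof.
have m1 : measurable_fun Rp (fun w : R => (1 + w ^+ 2)^-1).
  by apply: measurable_funTS; exact: continuous_measurable_fun continuous_invsqr.
apply: (bound_integrable (g := fun r => 2 * ((r / (1 + r)) `^ 0 * (1 + r) ^- 2))) => //.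
- move=> w; rewrite /= in_itv/= andbT => w0; rewrite powRr0 mul1r.
  rewrite ger0_norm; last by rewrite invr_ge0 addr_ge0// sqr_ge0.
  have h1 : 0 < 1 + w ^+ 2 by rewrite ltr_pwDl// sqr_ge0.
  have h2 : 0 < (1 + w) ^+ 2 by rewrite exprn_gt0//; lra.
  rewrite -[leLHS]mul1r ler_pdivrMr// mulrAC ler_pdivlMr// mul1r.
  by have := sqr_ge0 (1 - w); nra.
- by apply: integrableZ_EFin => //; apply: integrable_powR_rational; lra.
Qed.

Lemma integrable_invsqrT : mu.-integrable setT (EFin \o (fun w : R => (1 + w ^+ 2)^-1)).
Proof.
pose h := fun w : R => (1 + w ^+ 2)^-1.
have ih : mu.-integrable setT (EFin \o (h \_ Rp)).
  by apply: integrable_restrictT => //; exact: integrable_invsqr.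
have N1 : (-1 : R) != 0 by rewrite oppr_eq0 oner_eq0.
have ih' := integrable_affine 0 N1 ih.
have i1 : mu.-integrable setT (EFin \o ((cst 1 : R -> R) \_ `](-1), 1[)).
  apply: integrable_restrictT => //.
  by apply: (@bounded_integrable _ _ 1) => // x _; rewrite normr1.
have h0 w : 0 <= h w by rewrite invr_ge0 addr_ge0// sqr_ge0.
have := integrableD_EFin measurableT (integrableD_EFin measurableT ih ih') i1.
apply: bound_integrable => //.
  exact: continuous_measurable_fun continuous_invsqr.
move=> w _; rewrite ger0_norm ?h0// !patchE addr0 mulN1r.
have [w0|w0|w0] := ltgtP w 0.
- rewrite (_ : (w \in Rp) = false); last first.
    by apply/negP; rewrite inE/= in_itv/= andbT => /(lt_trans w0); rewrite ltxx.
  rewrite (_ : (- w \in Rp) = true); last first.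
    by apply/idP; rewrite inE/= in_itv/= andbT oppr_gt0.
  rewrite add0r /h sqrrN lerDl; case: ifP => //.
- rewrite (_ : (w \in Rp) = true); last first.
    by apply/idP; rewrite inE/= in_itv/= andbT.
  rewrite -/(h w) -addrA lerDl addr_ge0//; case: ifP => //.
- rewrite w0 (_ : ((0:R) \in `](-1), 1[%classic) = true); last first.
    by apply/idP; rewrite inE/= in_itv/=; apply/andP; split; lra.
  rewrite expr0n/= addr0 invr1 lerDr addr_ge0//; case: ifP => //.
Qed.

End FubiniAndBounds.

Section BoundedDerivatives.
Context {R : realType}.
Local Notation mu := (@lebesgue_measure R).
Local Notation Rp := (`]0%R, +oo[%classic : set R).
Implicit Types (f g F a b : R -> R) (D : set R).

Lemma derive_bound_lipschitz F (df : R -> R) (x0 e M : R) :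
  (forall x, `|x - x0| < e -> is_derive x 1 F (df x)) ->
  (forall x, `|x - x0| < e -> `|df x| <= M) ->
  forall x, `|x - x0| < e -> `|F x - F x0| <= `|x - x0| * M.
Proof.
move=> dF dM x xe.
have [xx0|xx0|->] := ltgtP x x0; last by rewrite !subrr normr0 mul0r.
- have inI y : x <= y <= x0 -> `|y - x0| < e.
    move=> /andP[xy yx0]; apply: le_lt_trans xe.
    by rewrite !ler0_norm ?subr_le0// ?(ltW xx0)// !opprB lerB.
  have [||y yI E] := @MVT R F df x x0 xx0.
  + by move=> y; rewrite in_itv/= => /andP[? ?]; apply: dF; apply: inI; rewrite !ltW.
  + by apply: derivable_within_continuous => y; rewrite in_itv/= => /inI /dF [].
  + rewrite distrC E normrM distrC mulrC ler_wpM2l// dM// inI//.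
    by move: yI; rewrite in_itv/= => /andP[? ?]; rewrite !ltW.
- have inI y : x0 <= y <= x -> `|y - x0| < e.
    move=> /andP[xy yx0]; apply: le_lt_trans xe.
    by rewrite !ger0_norm ?subr_ge0// ?(ltW xx0)// lerB.
  have [||y yI ->] := @MVT R F df x0 x xx0.
  + by move=> y; rewrite in_itv/= => /andP[? ?]; apply: dF; apply: inI; rewrite !ltW.
  + by apply: derivable_within_continuous => y; rewrite in_itv/= => /inI /dF [].
  + rewrite normrM mulrC ler_wpM2l// dM// inI//.
    by move: yI; rewrite in_itv/= => /andP[? ?]; rewrite !ltW.
Qed.

Lemma is_derive_under_integral_bound D (k dk : R -> R -> R) (x0 e : R) b :
  measurable D -> 0 < e ->
  (forall x, `|x - x0| < e -> measurable_fun D (k x)) ->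
  mu.-integrable D (EFin \o k x0) ->
  (forall x y, `|x - x0| < e -> D y -> is_derive x 1 (k ^~ y) (dk x y)) ->
  (forall x y, `|x - x0| < e -> D y -> `|dk x y| <= b y) ->
  mu.-integrable D (EFin \o b) ->
  is_derive x0 1 (fun x => \int[mu]_(y in D) k x y)%R
    (\int[mu]_(y in D) dk x0 y)%R.
Proof.
move=> mD e0 mk ik kd kb ib.
have lip x y : `|x - x0| < e -> D y -> `|k x y - k x0 y| <= `|x - x0| * b y.
  move=> xe Dy; apply: (@derive_bound_lipschitz (k ^~ y) (dk ^~ y) x0 e) => // z ze.
    exact: kd.
  exact: kb.
apply: (is_derive_under_integral mD e0 _ lip ib) => [x xe|y Dy]; last first.
  by apply: kd => //; rewrite subrr normr0.
apply: (bound_integrable (g := fun y => `|k x0 y| + `|x - x0| * b y)) => //; first exact: mk.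
  move=> y Dy; have -> : k x y = k x0 y + (k x y - k x0 y) by rewrite addrC subrK.
  by rewrite (le_trans (ler_normD _ _))// lerD2l; exact: lip.
apply: integrableD_EFin => //; first exact: integrable_norm.
exact: integrableZ_EFin.
Qed.

End BoundedDerivatives.

(** * Ray integrals *)

Module Ray.
Section RayIntegrals.
Context {R : realType} (nu : R) (nu_gt0 : 0 < nu) (nu_lt : nu < 2^-1).
Local Notation mu := (@lebesgue_measure R).
Local Notation Rp := (`]0%R, +oo[%classic : set R).
Implicit Types (b psi th x s r C m q : R).

Definition ray_expo th x s r := s * r * cos th - x * r `^ nu * cos (nu * th).

Definition ray_phase b psi th x s r :=
  s * r * sin th - x * r `^ nu * sin (nu * th) + (1 - b) * th + psi.

(** On the ray z = r e^(i th) this is the imaginary part of e^(i psi) z^(-b)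
    exp(s z - x z^nu) dz, written with real functions: [ray_expo] and
    [ray_phase] are the real and imaginary parts of the exponent, the angle of
    z^(-b) dz included. *)
Definition ray_fun b psi th x s r :=
  r `^ (- b) * (expR (ray_expo th x s r) * sin (ray_phase b psi th x s r)).

Definition ray b psi th x s := (\int[mu]_(r in Rp) ray_fun b psi th x s r)%R.

(** Decay of the exponential at infinity along the ray, uniform enough to
    serve as a domination in every parameter. *)
Definition decaying C m q th x s := [/\ 0 < m, 0 < q &
  forall r, 0 < r -> ray_expo th x s r <= C - m * r `^ q].

Lemma measurable_ray_fun b psi th x s : measurable_fun setT (ray_fun b psi th x s).
Proof.
have mp c : measurable_fun setT (fun r : R => r `^ c) by exact: measurable_powR.
have ms : measurable_fun setT (@sin R).
  exact: continuous_measurable_fun (@continuous_sin R).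
apply: measurable_funM => //; apply: measurable_funM.
  apply: measurableT_comp => //; apply: measurable_funB.
    by apply: measurable_funM => //; apply: measurable_funM.
  by apply: measurable_funM => //; apply: measurable_funM.
apply: (measurableT_comp ms); apply: measurable_funD => //.
apply: measurable_funD => //; apply: measurable_funB.
  by apply: measurable_funM => //; apply: measurable_funM.
by apply: measurable_funM => //; apply: measurable_funM.
Qed.

Lemma integrable_powR_decay (C m q c : R) : 0 < m -> 0 < q -> -1 < c ->
  mu.-integrable Rp (EFin \o (fun r => r `^ c * expR (C - m * r `^ q))).
Proof.
move=> m0 q0 c1.
have -> : (fun r => r `^ c * expR (C - m * r `^ q)) =
    (fun r => expR C * (r `^ c * expR (- (m * r `^ q)))).
  by apply/funext => r; rewrite expRD mulrCA.
by apply: integrableZ_EFin => //; exact: integrable_powR_expR.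
Qed.

Lemma ray_fun_le b psi th x s C m q r : decaying C m q th x s -> 0 < r ->
  `|ray_fun b psi th x s r| <= r `^ (- b) * expR (C - m * r `^ q).
Proof.
move=> [_ _ D] r0; rewrite /ray_fun !normrM ger0_norm ?powR_ge0//.
rewrite ler_wpM2l ?powR_ge0// ger0_norm ?expR_ge0//.
rewrite -[leRHS]mulr1 ler_pM ?expR_ge0// ?sin_max//.
by rewrite ler_expR; exact: D.
Qed.

Lemma integrable_ray b psi th x s C m q : b < 1 -> decaying C m q th x s ->
  mu.-integrable Rp (EFin \o ray_fun b psi th x s).
Proof.
move=> b1 D; have [m0 q0 _] := D.
apply: (bound_integrable (g := fun r => r `^ (- b) * expR (C - m * r `^ q))) => //.
- exact: measurable_funTS (measurable_ray_fun _ _ _ _ _).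
- by move=> r; rewrite /= in_itv/= andbT => r0; exact: ray_fun_le.
- by apply: integrable_powR_decay => //; lra.
Qed.

Lemma abs_sin_le (y : R) : `|sin y| <= `|y|.
Proof.
have := @derive_bound_lipschitz R sin cos 0 (`|y| + 1) 1.
move=> /(_ (fun x _ => is_derive_sin x) (fun x _ => cos_max x) y).
by rewrite sin0 !subr0 mulr1; apply; rewrite ltrDl.
Qed.

(** For b = 1 and psi = 0 the constant part of the phase is 0, and the phase
    is small at the origin. This compensates the singularity 1/r of the
    integrand. *)
Lemma ray_phase_le th x s r : 0 < r ->
  `|ray_phase 1 0 th x s r| <= `|s| * r + `|x| * r `^ nu.
Proof.
move=> r0; rewrite /ray_phase subrr mul0r !addr0 (le_trans (ler_normB _ _))//.
rewrite !normrM (gtr0_norm r0) (ger0_norm (powR_ge0 _ _)) lerD//.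
  by rewrite ler_piMr ?sin_max// mulr_ge0// ltW.
by rewrite ler_piMr ?sin_max// mulr_ge0// powR_ge0.
Qed.

Lemma ray_fun1_le th x s C m q r : decaying C m q th x s -> 0 < r ->
  `|ray_fun 1 0 th x s r| <=
  `|s| * (r `^ 0 * expR (C - m * r `^ q)) +
  `|x| * (r `^ (nu - 1) * expR (C - m * r `^ q)).
Proof.
move=> [_ _ D] r0; rewrite /ray_fun !normrM ger0_norm ?powR_ge0//.
rewrite (ger0_norm (expR_ge0 _)).
rewrite [leRHS](_ : _ = r `^ (-1) * (expR (C - m * r `^ q) * (`|s| * r + `|x| * r `^ nu))).
  rewrite ler_wpM2l ?powR_ge0// ler_pM ?expR_ge0//; first by rewrite ler_expR; exact: D.
  exact: le_trans (abs_sin_le _) (ray_phase_le _ _ _ r0).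
rewrite powRr0 powRB ?(gt_eqF r0) ?implybT// powRr1 ?ltW// powR_inv1 ?ltW//.
by field; rewrite gt_eqF.
Qed.

Lemma integrable_ray1 th x s C m q : decaying C m q th x s ->
  mu.-integrable Rp (EFin \o ray_fun 1 0 th x s).
Proof.
move=> D; have [m0 q0 _] := D.
apply: (bound_integrable (g := fun r => `|s| * (r `^ 0 * expR (C - m * r `^ q)) +
  `|x| * (r `^ (nu - 1) * expR (C - m * r `^ q)))) => //.
- exact: measurable_funTS (measurable_ray_fun _ _ _ _ _).
- by move=> r; rewrite /= in_itv/= andbT => r0; exact: ray_fun1_le.
- apply: integrableD_EFin => //; apply: integrableZ_EFin => //.
    by apply: integrable_powR_decay.
  apply: integrable_powR_decay => //. have := nu_gt0; lra.
Qed.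

(** Below b = 1 the integrand is integrable at the origin by its size, at b =
    1 only because the sine vanishes there. *)
Definition admissible b psi := b < 1 \/ (b = 1 /\ psi = 0).

Lemma integrable_adm b psi th x s C m q : admissible b psi -> decaying C m q th x s ->
  mu.-integrable Rp (EFin \o ray_fun b psi th x s).
Proof.
by move=> [b1|[-> ->]]; [exact: integrable_ray|exact: integrable_ray1].
Qed.

Lemma scale_realE (y z : R) : y *: z = y * z. Proof. by []. Qed.

(** The derivative multiplies the complex integrand by - z^nu, which lowers
    [b] by [nu]. *)
Lemma is_derive_ray_fun_x b psi th x s r : 0 < r ->
  is_derive x 1 (fun x => ray_fun b psi th x s r) (- ray_fun (b - nu) psi th x s r).
Proof.
move=> r0; rewrite /ray_fun /ray_expo /ray_phase.
rewrite (_ : _ + (1 - (b - nu)) * th + psi = s * r * sin th -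
  x * r `^ nu * sin (nu * th) + (1 - b) * th + psi + nu * th); last by ring.
have -> : r `^ (- (b - nu)) = r `^ (- b) * r `^ nu.
  by rewrite opprB addrC powRD// (gt_eqF r0) implybT.
by apply: is_derive_eq; rewrite !scale_realE (sinD _ (nu * th)); ring.
Qed.

(** The derivative multiplies the complex integrand by z, which lowers [b] by
    1. *)
Lemma is_derive_ray_fun_s b psi th x s r : 0 < r ->
  is_derive s 1 (fun s => ray_fun b psi th x s r) (ray_fun (b - 1) psi th x s r).
Proof.
move=> r0; rewrite /ray_fun /ray_expo /ray_phase.
rewrite (_ : _ + (1 - (b - 1)) * th + psi = s * r * sin th -
  x * r `^ nu * sin (nu * th) + (1 - b) * th + psi + th); last by ring.
have -> : r `^ (- (b - 1)) = r `^ (- b) * r.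
  by rewrite opprB addrC powRD ?(gt_eqF r0) ?implybT// powRr1// ltW.
by apply: is_derive_eq; rewrite !scale_realE (sinD _ th); ring.
Qed.

(** The derivative of the integrand in the angle is the derivative in the
    radius of [ray_flux]: for a holomorphic phi, both are the imaginary part
    of i times the radial derivative of z phi(z). This is Cauchy-Riemann, and
    the reason why the ray can be turned. *)
Definition ray_dtheta b psi th x s r :=
  r `^ (- b) * (expR (ray_expo th x s r) *
   ((x * nu * r `^ nu * sin (nu * th) - s * r * sin th) * sin (ray_phase b psi th x s r) +
    (s * r * cos th - x * nu * r `^ nu * cos (nu * th) + (1 - b)) *
      cos (ray_phase b psi th x s r))).

Definition ray_flux b psi th x s r :=
  r `^ (1 - b) * (expR (ray_expo th x s r) * cos (ray_phase b psi th x s r)).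

Lemma is_derive_ray_fun_th b psi th x s r :
  is_derive th 1 (fun th => ray_fun b psi th x s r) (ray_dtheta b psi th x s r).
Proof.
rewrite /ray_fun /ray_dtheta /ray_expo /ray_phase.
by apply: is_derive_eq; rewrite !scale_realE; ring.
Qed.

Lemma is_derive_ray_flux b psi th x s r : 0 < r ->
  is_derive r 1 (ray_flux b psi th x s) (ray_dtheta b psi th x s r).
Proof.
move=> r0; rewrite /ray_flux /ray_dtheta /ray_expo /ray_phase.
have d1 := is_derive1_powR (1 - b) r0; have d2 := is_derive1_powR nu r0.
apply: is_derive_eq; rewrite !scale_realE.
have -> : r `^ (1 - b) = r * r `^ (- b).
  by rewrite powRD ?(gt_eqF r0) ?implybT// powRr1// ltW.
have -> : r `^ (1 - b - 1) = r `^ (- b) by congr (_ `^ _); ring.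
have -> : r `^ nu = r * r `^ (nu - 1) by rewrite mulr_powRB1// ltW.
by ring.
Qed.

(** An exact radial derivative whose integral vanishes: the source of the
    Euler relation between the indices b, b - 1 and b - nu. *)
Lemma is_derive_ray_euler b psi th x s r : 0 < r ->
  is_derive r 1 (fun r => r * ray_fun b psi th x s r)
   ((1 - b) * ray_fun b psi th x s r + s * ray_fun (b - 1) psi th x s r
    - x * nu * ray_fun (b - nu) psi th x s r).
Proof.
move=> r0; rewrite /ray_fun /ray_expo /ray_phase.
rewrite (_ : _ + (1 - (b - nu)) * th + psi = s * r * sin th -
  x * r `^ nu * sin (nu * th) + (1 - b) * th + psi + nu * th); last by ring.
rewrite (_ : _ + (1 - (b - 1)) * th + psi = s * r * sin th -
  x * r `^ nu * sin (nu * th) + (1 - b) * th + psi + th); last by ring.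
have d1 := is_derive1_powR (- b) r0; have d2 := is_derive1_powR nu r0.
apply: is_derive_eq; rewrite !scale_realE.
have -> : r `^ (- (b - nu)) = r `^ (- b) * r `^ nu.
  by rewrite opprB addrC powRD// (gt_eqF r0) implybT.
have -> : r `^ (- (b - 1)) = r `^ (- b) * r.
  by rewrite opprB addrC powRD ?(gt_eqF r0) ?implybT// powRr1// ltW.
have -> : r `^ nu = r * r `^ (nu - 1) by rewrite mulr_powRB1// ltW.
have -> : r `^ (- b) = r * r `^ (- b - 1).
  by rewrite addrC powRD ?(gt_eqF r0) ?implybT// powR_inv1 ?mulVKf ?gt_eqF// ltW.
by rewrite (sinD _ th) (sinD _ (nu * th)); ring.
Qed.

End RayIntegrals.
End Ray.
Import Ray.

(** * Turning the ray *)

Section Rotation.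
Context {R : realType} (nu : R) (nu_gt0 : 0 < nu) (nu_lt : nu < 2^-1).
Local Notation mu := (@lebesgue_measure R).
Local Notation Rp := (`]0%R, +oo[%classic : set R).
Implicit Types (b psi th x s r C m q : R).
Local Notation ray_expo := (ray_expo nu).
Local Notation ray_phase := (ray_phase nu).
Local Notation ray_fun := (ray_fun nu).
Local Notation ray := (ray nu).
Local Notation ray_flux := (ray_flux nu).
Local Notation ray_dtheta := (ray_dtheta nu).
Local Notation decaying := (decaying nu).

Lemma powR_decay_cvgy C m q b : 0 < m -> 0 < q ->
  r `^ b * expR (C - m * r `^ q) @[r --> +oo%R] --> (0 : R).
Proof.
move=> m0 q0; have [K [K0 KE]] := powR_expR_bound (`|b| + 1) m0 q0.
apply: (squeeze_cvgr (f := cst 0) (h := fun r => K * expR C * r^-1)).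
- near=> r; have r1 : 1 <= r by near: r; exact: nbhs_pinfty_ge.
  have r0 : 0 < r by lra.
  rewrite mulr_ge0 ?powR_ge0 ?expR_ge0//=.
  rewrite expRD mulrCA [K * _]mulrC -mulrA ler_wpM2l ?expR_ge0// ler_pdivlMr//.
  apply: le_trans (KE _ r0).
  rewrite mulrAC ler_wpM2r ?expR_ge0//.
  have r1n : (1 + r == 0) = false by apply: gt_eqF; lra.
  have h2 : r <= (1 + r) `^ 1 by rewrite powRr1; lra.
  have h1 : r `^ b <= (1 + r) `^ `|b|.
    apply: (@le_trans _ _ (r `^ `|b|)); first by apply: ler_powR; rewrite ?ler_norm.
    by apply: ge0_ler_powR; rewrite ?nnegrE//; lra.
  rewrite powRD ?r1n ?implybT//.
  exact: (ler_pM (powR_ge0 _ _) (ltW r0) h1 h2).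
- exact: cvg_cst.
- rewrite -(mulr0 (K * expR C)); apply: cvgM; first exact: cvg_cst.
  apply/cvgrPdist_lt => e e0; near=> r.
  have re : e^-1 < r by near: r; apply: nbhs_pinfty_gt; exact: num_real.
  have r0 : 0 < r by apply: lt_trans re; rewrite invr_gt0.
  by rewrite sub0r normrN gtr0_norm ?invr_gt0// invf_plt ?posrE.
Unshelve. all: by end_near. Qed.

Lemma powR_decay_cvg0 C m q b : 0 < m -> 0 < q -> 0 < b ->
  r `^ b * expR (C - m * r `^ q) @[r --> 0^'+] --> (0 : R).
Proof.
move=> m0 q0 b0; apply: (squeeze_cvgr (f := cst 0) (h := fun r => r `^ b * expR C)).
- near=> r; rewrite mulr_ge0 ?powR_ge0 ?expR_ge0//= ler_wpM2l ?powR_ge0//.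
  by rewrite ler_expR gerBl mulr_ge0 ?powR_ge0// ltW.
- exact: cvg_cst.
- rewrite -[X in _ --> X](mul0r (expR C)); apply: cvgM; last exact: cvg_cst.
  exact: powR_cvg0.
Unshelve. all: by end_near. Qed.

Lemma cvg_norm_le (T : Type) (G : set_system T) {FG : Filter G} (h k : T -> R) :
  (\forall r \near G, `|h r| <= k r) -> k r @[r --> G] --> 0 -> h r @[r --> G] --> 0.
Proof.
move=> hk k0; apply: norm_cvg0; apply: (squeeze_cvgr (f := cst 0) (h := k)) => //.
  by apply: filterS hk => r ->; rewrite normr_ge0.
exact: cvg_cst.
Qed.

Lemma ray_flux_le b psi th x s C m q r : decaying C m q th x s -> 0 < r ->
  `|ray_flux b psi th x s r| <= r `^ (1 - b) * expR (C - m * r `^ q).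
Proof.
move=> [_ _ D] r0; rewrite /Ray.ray_flux !normrM ger0_norm ?powR_ge0//.
rewrite ler_wpM2l ?powR_ge0// ger0_norm ?expR_ge0//.
rewrite -[leRHS]mulr1 ler_pM ?expR_ge0// ?cos_max//.
by rewrite ler_expR; exact: D.
Qed.

Definition dtheta_bound b x s C m q r :=
  2 * `|s| * (r `^ (1 - b) * expR (C - m * r `^ q)) +
  (2 * `|x| * (r `^ (nu - b) * expR (C - m * r `^ q)) +
  (1 - b) * (r `^ (- b) * expR (C - m * r `^ q))).

Lemma ray_dtheta_le b psi th x s C m q r : b <= 1 -> decaying C m q th x s -> 0 < r ->
  `|ray_dtheta b psi th x s r| <= dtheta_bound b x s C m q r.
Proof.
move=> b1 [_ _ D] r0; rewrite /Ray.ray_dtheta !normrM ger0_norm ?powR_ge0//.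
rewrite (ger0_norm (expR_ge0 _)) mulrA.
have E : expR (ray_expo th x s r) <= expR (C - m * r `^ q) by rewrite ler_expR D.
rewrite /dtheta_bound.
have -> : r `^ (1 - b) = r * r `^ (- b).
  by rewrite powRD ?(gt_eqF r0) ?implybT// powRr1// ltW.
have -> : r `^ (nu - b) = r `^ nu * r `^ (- b) by rewrite powRD// (gt_eqF r0) implybT.
rewrite [leRHS](_ : _ = r `^ (- b) * expR (C - m * r `^ q) *
   (2 * `|s| * r + 2 * `|x| * r `^ nu + (1 - b))); last by ring.
apply: ler_pM; rewrite ?mulr_ge0 ?powR_ge0 ?expR_ge0//.
  by rewrite ler_wpM2l ?powR_ge0.
have h1 (y z : R) : `|z| <= 1 -> `|y * z| <= `|y|.
  by move=> z1; rewrite normrM ler_piMr.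
have hn : `|x * nu * r `^ nu| <= `|x| * r `^ nu.
  rewrite -mulrA normrM ler_wpM2l// ger0_norm; last first.
    by rewrite mulr_ge0 ?powR_ge0// ltW.
  by rewrite ler_piMl ?powR_ge0//; have := nu_lt; lra.
have hs : `|s * r| = `|s| * r by rewrite normrM (gtr0_norm r0).
apply: (@le_trans _ _ ((`|x| * r `^ nu + `|s| * r) + (`|s| * r + `|x| * r `^ nu + (1 - b)))); last lra.
apply: (le_trans (ler_normD _ _)); apply: lerD.
  apply: (le_trans (h1 _ _ (sin_max _))); apply: (le_trans (ler_normB _ _)).
  apply: lerD; first exact: le_trans (h1 _ _ (sin_max _)) hn.
  by rewrite -hs; exact: h1 (sin_max _).
apply: (le_trans (h1 _ _ (cos_max _))); apply: (le_trans (ler_normD _ _)).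
apply: lerD; last by rewrite ger0_norm// subr_ge0.
apply: (le_trans (ler_normB _ _)); apply: lerD.
  by rewrite -hs; exact: h1 (cos_max _).
exact: le_trans (h1 _ _ (cos_max _)) hn.
Qed.

Lemma admissible_le1 b psi : admissible b psi -> b <= 1.
Proof. by move=> [/ltW|[-> _]]. Qed.

Lemma integrable_dtheta_bound b psi x s C m q : admissible b psi -> 0 < m -> 0 < q ->
  mu.-integrable Rp (EFin \o dtheta_bound b x s C m q).
Proof.
move=> ab m0 q0; have b1 := admissible_le1 ab; have n0 := nu_gt0.
apply: integrableD_EFin => //.
  by apply: integrableZ_EFin => //; apply: integrable_powR_decay => //; lra.
apply: integrableD_EFin => //.
  by apply: integrableZ_EFin => //; apply: integrable_powR_decay => //; lra.
case: ab => [blt|[-> _]].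
  by apply: integrableZ_EFin => //; apply: integrable_powR_decay => //; lra.
rewrite (_ : (fun r => _) = cst 0); last by apply/funext => r; rewrite subrr mul0r.
exact: integrable0.
Qed.

Lemma continuous_ray_fun b psi th x s r : 0 < r ->
  {for r, continuous (ray_fun b psi th x s)}.
Proof.
move=> r0; apply/differentiable_continuous/derivable1_diffP.
rewrite /Ray.ray_fun /Ray.ray_expo /Ray.ray_phase.
have d1 := is_derive1_powR (- b) r0; have d2 := is_derive1_powR nu r0.
exact: ex_derive.
Qed.

Lemma continuous_ray_dtheta b psi th x s r : 0 < r ->
  {for r, continuous (ray_dtheta b psi th x s)}.
Proof.
move=> r0; apply/differentiable_continuous/derivable1_diffP.
rewrite /Ray.ray_dtheta /Ray.ray_expo /Ray.ray_phase.
have d1 := is_derive1_powR (- b) r0; have d2 := is_derive1_powR nu r0.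
exact: ex_derive.
Qed.

Lemma ray_dtheta_integral b psi th x s C m q w0 : admissible b psi ->
  decaying C m q th x s -> ray_flux b psi th x s r @[r --> 0^'+] --> w0 ->
  (\int[mu]_(r in Rp) ray_dtheta b psi th x s r = - w0)%R.
Proof.
move=> ab D F0; have [m0 q0 _] := D.
rewrite -[RHS]add0r; apply: (@FTC_halfline R (ray_flux b psi th x s)) => //.
- by move=> r r0; exact: is_derive_ray_flux.
- by move=> r r0; exact: continuous_ray_dtheta.
- apply: (bound_integrable (g := dtheta_bound b x s C m q)) => //.
  + apply: open_continuous_measurable_fun => // r; rewrite inE/= in_itv/= andbT => r0.
    exact: continuous_ray_dtheta.
  + move=> r; rewrite /= in_itv/= andbT => r0; apply: ray_dtheta_le => //.
    exact: admissible_le1 ab.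
  + exact: integrable_dtheta_bound ab m0 q0.
- apply: cvg_norm_le (powR_decay_cvgy C (1 - b) m0 q0).
  by near=> r; apply: ray_flux_le => //; near: r; exact: nbhs_pinfty_gt.
Unshelve. all: by end_near. Qed.

Lemma ray_fun_dominated b psi s x C m q : admissible b psi -> 0 < m -> 0 < q ->
  exists g : R -> R, mu.-integrable Rp (EFin \o g) /\
    forall th r, decaying C m q th x s -> 0 < r -> `|ray_fun b psi th x s r| <= g r.
Proof.
move=> ab m0 q0; have n0 := nu_gt0; case: ab => [b1|[-> ->]].
  exists (fun r => r `^ (- b) * expR (C - m * r `^ q)); split.
    by apply: integrable_powR_decay => //; lra.
  by move=> th r D r0; exact: ray_fun_le.
exists (fun r => `|s| * (r `^ 0 * expR (C - m * r `^ q)) +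
  `|x| * (r `^ (nu - 1) * expR (C - m * r `^ q))); split; last first.
  by move=> th r D r0; exact: ray_fun1_le.
by apply: integrableD_EFin => //; apply: integrableZ_EFin => //;
  apply: integrable_powR_decay => //; lra.
Qed.

(** Cauchy theorem for a sector: the derivative of the integral in the angle
    is the integral of an exact derivative in the radius, that is, minus the
    limit [w0] of the flux at the origin. For b < 1 this limit is 0 and the
    integral does not depend on the angle; for b = 1 it is 1, the trace of the
    pole at 0. *)
Lemma ray_rotation b psi th1 th2 x s C m q w0 : th1 < th2 -> admissible b psi ->
  (forall th, th1 <= th <= th2 -> decaying C m q th x s) ->
  (forall th, th1 < th < th2 -> ray_flux b psi th x s r @[r --> 0^'+] --> w0) ->
  ray b psi th2 x s - ray b psi th1 x s = - w0 * (th2 - th1).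
Proof.
move=> th12 ab D F0.
have [m0 q0 _] : decaying C m q th1 x s by apply: D; rewrite lexx ltW.
have dray th : th1 < th < th2 -> is_derive th 1 (fun th => ray b psi th x s) (- w0).
  move=> /andP[t1 t2]; pose e := Num.min (th - th1) (th2 - th).
  have e0 : 0 < e by rewrite lt_min !subr_gt0 t1.
  have eD t : `|t - th| < e -> th1 <= t <= th2.
    by rewrite lt_min => /andP[]; rewrite !ltr_norml; lra.
  have tl : th1 <= th <= th2 by rewrite !ltW.
  have tt : th1 < th < th2 by rewrite t1.
  rewrite -(ray_dtheta_integral ab (D th tl) (F0 th tt)).
  apply: (is_derive_under_integral_bound _ e0 (k := fun th => ray_fun b psi th x s)
    (dk := fun th => ray_dtheta b psi th x s) (b := dtheta_bound b x s C m q)) => //.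
  - by move=> t _; exact: measurable_funTS (measurable_ray_fun _ _ _ _ _ _).
  - exact: (integrable_adm nu_gt0 ab (D _ tl)).
  - by move=> t r _ _; exact: is_derive_ray_fun_th.
  - move=> t r te; rewrite /= in_itv/= andbT => r0.
    exact: ray_dtheta_le (admissible_le1 ab) (D _ (eD _ te)) r0.
  - exact: integrable_dtheta_bound ab m0 q0.
(* The interior derivative is constant; continuity up to the two extreme
   angles remains for the mean value theorem. *)
have [g [ig gE]] := ray_fun_dominated s x C ab m0 q0.
have cth (G : set_system R) (FG : Filter G) th : sequential G -> G --> th ->
    (\forall t \near G, th1 <= t <= th2) ->
    ray b psi t x s @[t --> G] --> ray b psi th x s.
  move=> sG Gth Gb; apply: (@dominated_cvg_filter R G FG Rp _ _ g) => //.
  - by apply: nearW => t; exact: measurable_funTS (measurable_ray_fun _ _ _ _ _ _).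
  - apply: filterS Gb => t t12 r; rewrite /= in_itv/= andbT => r0.
    exact: gE (D _ t12) r0.
  - move=> r _; apply: cvg_trans (cvg_app _ Gth) _.
    exact: is_derive1_continuous (is_derive_ray_fun_th nu b psi th x s r).
suff cr : {within `[th1, th2], continuous (fun th => ray b psi th x s)}.
  have dr t : t \in `]th1, th2[ -> is_derive t 1 (fun th => ray b psi th x s) (- w0).
    by rewrite in_itv; exact: dray.
  by have [c _ ->] := MVT th12 dr cr.
apply/continuous_within_itvP => //; split.
- move=> t; rewrite in_itv/= => t12; exact: is_derive1_continuous (dray _ t12).
- apply: cth; [exact: sequential_at_right|exact: cvg_at_right_filter|].
  near=> t; apply/andP; split; first by near: t; exact: nbhs_right_ge.
  by near: t; exact: nbhs_right_le.
- apply: cth; [exact: sequential_at_left|exact: cvg_at_left_filter|].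
  near=> t; apply/andP; split; last by near: t; exact: nbhs_left_le.
  by near: t; exact: nbhs_left_ge.
Unshelve. all: by end_near. Qed.

End Rotation.

(** * Derivatives, Euler relation and scaling *)

Section Calculus.
Context {R : realType} (nu : R) (nu_gt0 : 0 < nu) (nu_lt : nu < 2^-1).
Local Notation mu := (@lebesgue_measure R).
Local Notation Rp := (`]0%R, +oo[%classic : set R).
Implicit Types (b psi th x s r C m q e : R).
Local Notation ray_expo := (ray_expo nu).
Local Notation ray_phase := (ray_phase nu).
Local Notation ray_fun := (ray_fun nu).
Local Notation ray := (ray nu).
Local Notation ray_flux := (ray_flux nu).
Local Notation decaying := (decaying nu).

Lemma RintegralN (D : set R) (f : R -> R) : measurable D ->
  mu.-integrable D (EFin \o f) ->
  (\int[mu]_(x in D) - f x = - \int[mu]_(x in D) f x)%R.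
Proof.
move=> mD fi; rewrite -[RHS]mulN1r -RintegralZl//.
by apply: eq_Rintegral => x _; rewrite mulN1r.
Qed.

Lemma is_derive_ray_x b psi th x s C m q e : admissible b psi -> 0 < e ->
  (forall x', `|x' - x| < e -> decaying C m q th x' s) ->
  is_derive x 1 (fun x => ray b psi th x s) (- ray (b - nu) psi th x s).
Proof.
move=> ab e0 D; have n0 := nu_gt0; have b1 := admissible_le1 ab.
have Dx : decaying C m q th x s by apply: D; rewrite subrr normr0.
have [m0 q0 _] := Dx.
rewrite -RintegralN//; last by apply: (integrable_ray _ _ Dx); lra.
apply: (is_derive_under_integral_bound _ e0 (k := fun x => ray_fun b psi th x s)
    (dk := fun x r => - ray_fun (b - nu) psi th x s r)
    (b := fun r => r `^ (- (b - nu)) * expR (C - m * r `^ q))) => //.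
- by move=> t _; exact: measurable_funTS (measurable_ray_fun _ _ _ _ _ _).
- exact: (integrable_adm nu_gt0 ab Dx).
- by move=> t r _; rewrite /= in_itv/= andbT; exact: is_derive_ray_fun_x.
- move=> t r te; rewrite /= in_itv/= andbT => r0; rewrite normrN.
  exact: ray_fun_le (D _ te) r0.
- by apply: integrable_powR_decay => //; lra.
Qed.

Lemma is_derive_ray_s b psi th x s C m q e : admissible b psi -> 0 < e ->
  (forall s', `|s' - s| < e -> decaying C m q th x s') ->
  is_derive s 1 (fun s => ray b psi th x s) (ray (b - 1) psi th x s).
Proof.
move=> ab e0 D; have b1 := admissible_le1 ab.
have Dx : decaying C m q th x s by apply: D; rewrite subrr normr0.
have [m0 q0 _] := Dx.
apply: (is_derive_under_integral_bound _ e0 (k := fun s => ray_fun b psi th x s)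
    (dk := fun s => ray_fun (b - 1) psi th x s)
    (b := fun r => r `^ (- (b - 1)) * expR (C - m * r `^ q))) => //.
- by move=> t _; exact: measurable_funTS (measurable_ray_fun _ _ _ _ _ _).
- exact: (integrable_adm nu_gt0 ab Dx).
- by move=> t r _; rewrite /= in_itv/= andbT; exact: is_derive_ray_fun_s.
- move=> t r te; rewrite /= in_itv/= andbT => r0.
  exact: ray_fun_le (D _ te) r0.
- by apply: integrable_powR_decay => //; lra.
Qed.

Lemma cvg_lin0 (G : set_system R) {FG : Filter G} (h k : R -> R) (c d : R) :
  h r @[r --> G] --> 0 -> k r @[r --> G] --> 0 ->
  c * h r + d * k r @[r --> G] --> 0.
Proof.
move=> h0 k0; rewrite [X in _ --> X](_ : 0 = c * 0 + d * 0); last by rewrite !mulr0 addr0.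
by apply: cvgD; (apply: cvgM; [exact: cvg_cst|]).
Qed.

Lemma ray_fun_ends b psi th x s C m q : admissible b psi -> decaying C m q th x s ->
  r * ray_fun b psi th x s r @[r --> 0^'+] --> 0 /\
  r * ray_fun b psi th x s r @[r --> +oo%R] --> 0.
Proof.
move=> ab D; have n0 := nu_gt0; have [m0 q0 _] := D.
have H b' : b' < 1 -> (fun r => r * (r `^ (- b') * expR (C - m * r `^ q))) r @[r --> 0^'+] --> 0 /\
    (fun r => r * (r `^ (- b') * expR (C - m * r `^ q))) r @[r --> +oo%R] --> 0.
  move=> b1; split.
    apply: cvg_trans (powR_decay_cvg0 C (b := 1 - b') m0 q0 _); last lra.
    apply: near_eq_cvg; near=> r; have r0 : 0 < r by near: r; exact: nbhs_right_gt.
    by rewrite mulrA powRD ?(gt_eqF r0) ?implybT// powRr1// ltW.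
  apply: cvg_trans (powR_decay_cvgy C (1 - b') m0 q0).
  apply: near_eq_cvg; near=> r; have r0 : 0 < r by near: r; exact: nbhs_pinfty_gt.
  by rewrite mulrA powRD ?(gt_eqF r0) ?implybT// powRr1// ltW.
case: ab => [b1|[-> ->]].
  have [h0 h1] := H _ b1.
  split; [apply: cvg_norm_le h0|apply: cvg_norm_le h1]; near=> r.
    have r0 : 0 < r by near: r; exact: nbhs_right_gt.
    by rewrite normrM (gtr0_norm r0) ler_wpM2l ?(ltW r0)//; exact: ray_fun_le D r0.
  have r0 : 0 < r by near: r; exact: nbhs_pinfty_gt.
  by rewrite normrM (gtr0_norm r0) ler_wpM2l ?(ltW r0)//; exact: ray_fun_le D r0.
have [|h0 h1] := H 0; first lra.
have [|k0 k1] := H (1 - nu); first lra.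
pose G r := `|s| * (r * (r `^ (- 0) * expR (C - m * r `^ q))) +
            `|x| * (r * (r `^ (- (1 - nu)) * expR (C - m * r `^ q))).
have GE r : 0 < r -> `|r * ray_fun 1 0 th x s r| <= G r.
  move=> r0; rewrite normrM (gtr0_norm r0) /G.
  have -> : - (1 - nu) = nu - 1 by ring.
  rewrite oppr0 mulrCA (mulrCA `|x|) -mulrDr ler_wpM2l ?(ltW r0)//.
  exact: ray_fun1_le D r0.
split; apply: (cvg_norm_le (k := G)).
- by near=> r; apply: GE; near: r; exact: nbhs_right_gt.
- exact: cvg_lin0.
- by near=> r; apply: GE; near: r; exact: nbhs_pinfty_gt.
- exact: cvg_lin0.
Unshelve. all: by end_near. Qed.

Lemma ray_euler b psi th x s C m q : admissible b psi -> decaying C m q th x s ->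
  (1 - b) * ray b psi th x s + s * ray (b - 1) psi th x s =
  x * nu * ray (b - nu) psi th x s.
Proof.
move=> ab D; have n0 := nu_gt0; have b1 := admissible_le1 ab.
have i0 := integrable_adm nu_gt0 ab D.
have i1 : mu.-integrable Rp (EFin \o ray_fun (b - 1) psi th x s).
  by apply: (integrable_ray _ _ D); lra.
have i2 : mu.-integrable Rp (EFin \o ray_fun (b - nu) psi th x s).
  by apply: (integrable_ray _ _ D); lra.
have [e0 e1] := ray_fun_ends ab D.
pose f r := (1 - b) * ray_fun b psi th x s r + s * ray_fun (b - 1) psi th x s r
    - x * nu * ray_fun (b - nu) psi th x s r.
have i01 : mu.-integrable Rp (EFin \o (fun r => (1 - b) * ray_fun b psi th x s r +
    s * ray_fun (b - 1) psi th x s r)).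
  by apply: integrableD_EFin => //; exact: integrableZ_EFin.
have ixn := integrableZ_EFin (x * nu) (measurable_itv _) i2.
have fE : (\int[mu]_(r in Rp) f r)%R = 0 - 0.
  apply: (@FTC_halfline R (fun r => r * ray_fun b psi th x s r)) => //.
  - by move=> r r0; exact: is_derive_ray_euler.
  - move=> r r0; apply: continuousB; last first.
      by apply: continuousM; [exact: cvg_cst|exact: continuous_ray_fun].
    by apply: continuousD; apply: continuousM;
      by [exact: cvg_cst|exact: continuous_ray_fun].
  - exact: integrableB_EFin.
move: fE; rewrite /f RintegralB// RintegralD//; try exact: integrableZ_EFin.
rewrite !RintegralZl//.
by rewrite subrr => /eqP; rewrite subr_eq0 => /eqP.
Qed.

Lemma Rintegral_scale (f : R -> R) (a : R) : 0 < a ->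
  mu.-integrable Rp (EFin \o f) ->
  (\int[mu]_(r in Rp) f r = a * \int[mu]_(r in Rp) f (a * r))%R.
Proof.
move=> a0 fi; rewrite Rintegral_mkcond.
rewrite (Rintegral_affine 0 (lt0r_neq0 a0)); last exact: integrable_restrictT.
rewrite gtr0_norm// [in RHS]Rintegral_mkcond; congr (_ * _).
apply: eq_Rintegral => r _; rewrite addr0 !patchE; congr (if _ then _ else _).
by apply/idP/idP; rewrite !inE/= !in_itv/= !andbT pmulr_rgt0.
Qed.

Lemma powR_div s r (c : R) : 0 < s -> 0 < r -> (s^-1 * r) `^ c = s `^ (- c) * r `^ c.
Proof.
move=> s0 r0; have si : 0 < s^-1 by rewrite invr_gt0.
by rewrite powRM ?(ltW r0) ?(ltW si)// -powR_inv1 ?(ltW s0)// -powRrM mulN1r.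
Qed.

Lemma decaying_scale th x s C m q : 0 < s -> decaying C m q th x s ->
  decaying C (m * s `^ (- q)) q th (x * s `^ (- nu)) 1.
Proof.
move=> s0 [m0 q0 D]; split => //; first by rewrite mulr_gt0// powR_gt0.
move=> r r0; have sr : 0 < s^-1 * r by rewrite mulr_gt0// invr_gt0.
have := D _ sr; rewrite /Ray.ray_expo !powR_div// !mulrA divff ?gt_eqF//.
Qed.

(** The substitution z -> z / s: every ray integral is self-similar. *)
Lemma ray_scaling b psi th x s C m q : 0 < s -> admissible b psi ->
  decaying C m q th x s ->
  ray b psi th x s = s `^ (b - 1) * ray b psi th (x * s `^ (- nu)) 1.
Proof.
move=> s0 ab D; have si : 0 < s^-1 by rewrite invr_gt0.
rewrite /Ray.ray (Rintegral_scale si); last exact: (integrable_adm nu_gt0 ab D).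
have E r : r \in Rp -> ray_fun b psi th x s (s^-1 * r) =
    s `^ b * ray_fun b psi th (x * s `^ (- nu)) 1 r.
  rewrite inE/= in_itv/= andbT => r0.
  rewrite /Ray.ray_fun /Ray.ray_expo /Ray.ray_phase.
  rewrite !powR_div// opprK -mulrA; congr (_ * (_ * (expR _ * sin _))).
    by rewrite !mulrA divff ?gt_eqF// mul1r.
  by rewrite !mulrA divff ?gt_eqF// mul1r.
rewrite [X in _ * X](_ : _ = \int[mu]_(r in Rp)
    (s `^ b * ray_fun b psi th (x * s `^ (- nu)) 1 r))%R; last exact: eq_Rintegral.
rewrite RintegralZl//; last first.
  exact: (integrable_adm nu_gt0 ab (decaying_scale s0 D)).
rewrite mulrA; congr (_ * _).
by rewrite powRB ?(gt_eqF s0) ?implybT// powRr1 ?ltW// mulrC.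
Qed.

End Calculus.

(** * The vertical and the leftward ray *)

Module Axis.
Section Decay.
Context {R : realType} (nu : R) (nu_gt0 : 0 < nu) (nu_lt : nu < 2^-1).
Local Notation mu := (@lebesgue_measure R).
Local Notation Rp := (`]0%R, +oo[%classic : set R).
Implicit Types (b psi th x s r C m q e : R).
Local Notation ray := (ray nu).
Local Notation ray_fun := (ray_fun nu).
Local Notation ray_flux := (ray_flux nu).
Local Notation decaying := (decaying nu).

(** Up to the factor 1/pi, the inverse Laplace transform in [s] of p^(-b)
    exp(- x p^nu), taken along the imaginary axis. It is smooth in [s] on the
    whole line as soon as [x] is positive. *)
Definition rayV b x s := ray b 0 (pi / 2) x s.
(** The same transform along the negative axis, the two sides of a Hankel
    contour. There [s] is positive and [x] of either sign. *)
Definition rayL b x s := ray b 0 pi x s.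

Lemma le_cos th th' : 0 <= th -> th <= th' -> th' <= pi -> cos th' <= cos th.
Proof.
move=> th0; rewrite le_eqVlt => /predU1P[->//|tt] tp.
apply/ltW; rewrite ltr_cos//; rewrite in_itv/=; apply/andP; split => //; lra.
Qed.

Lemma nu_pi : nu * pi < pi / 2.
Proof. by have := pi_gt0 R; have := nu_lt; nra. Qed.

Lemma nu_pi2 : nu * (pi / 2) < pi / 2.
Proof. by have := pi_gt0 R; have := nu_lt; nra. Qed.

(** Here nu < 1/2, that is alpha < 1, matters: the term - x z^nu still decays
    along the negative axis. *)
Lemma cosL_gt0 : 0 < cos (nu * pi).
Proof.
apply: cos_gt0_pihalf; rewrite nu_pi andbT.
have : 0 < nu * pi by rewrite mulr_gt0// pi_gt0.
by have := pi_gt0 R; lra.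
Qed.

Lemma cosV_gt0 : 0 < cos (nu * (pi / 2)).
Proof.
have p0 := pi_gt0 R; apply: cos_gt0_pihalf; rewrite nu_pi2 andbT.
have : 0 < nu * (pi / 2) by rewrite mulr_gt0//; lra.
by lra.
Qed.

Lemma decaying_V x x0 s : 0 < x0 -> x0 <= x ->
  decaying 0 (x0 * cos (nu * (pi / 2))) nu (pi / 2) x s.
Proof.
move=> x00 x0x; have cV := cosV_gt0; split => //; first by rewrite mulr_gt0.
move=> r r0; rewrite /ray_expo cos_pihalf mulr0 lerB// mulrAC.
by rewrite ler_wpM2r ?(ltW cV)// ler_wpM2r// powR_ge0.
Qed.

(** Between the positive and the imaginary axis both terms of the exponent
    have nonpositive real part when [s] is nonpositive. *)
Lemma decaying_turnV th x s : 0 < x -> s <= 0 -> 0 <= th <= pi / 2 ->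
  decaying 0 (x * cos (nu * (pi / 2))) nu th x s.
Proof.
move=> x0 s0 /andP[t0 t1]; have cV := cosV_gt0; have p0 := pi_gt0 R.
split => //; first by rewrite mulr_gt0.
have n0 := nu_gt0; have n1 := nu_lt.
move=> r r0; rewrite /ray_expo; apply: lerB.
  rewrite mulr_le0_ge0// ?mulr_le0_ge0// ?(ltW r0)//.
  by apply: cos_ge0_pihalf; rewrite t1 andbT; lra.
rewrite mulrAC ler_wpM2l ?mulr_ge0 ?powR_ge0 ?(ltW x0)//.
apply: le_cos; [nra|nra|have := nu_pi2; nra].
Qed.

(** Between the imaginary and the negative axis the same holds when [s] is
    nonnegative. *)
Lemma decaying_turnL th x s : 0 < x -> 0 <= s -> pi / 2 <= th <= pi ->
  decaying 0 (x * cos (nu * pi)) nu th x s.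
Proof.
move=> x0 s0 /andP[t0 t1]; have cL := cosL_gt0; have p0 := pi_gt0 R.
split => //; first by rewrite mulr_gt0.
have n0 := nu_gt0; have n1 := nu_lt.
move=> r r0; rewrite /ray_expo; apply: lerB.
  rewrite mulr_ge0_le0// ?mulr_ge0// ?(ltW r0)//.
  rewrite -cos_pihalf; apply: le_cos => //; lra.
rewrite mulrAC ler_wpM2l ?mulr_ge0 ?powR_ge0 ?(ltW x0)//.
apply: le_cos; [nra|nra|have := nu_pi; nra].
Qed.

Lemma decaying_L0 x s0 s : 0 < s0 -> s0 <= s -> 0 <= x -> decaying 0 s0 1 pi x s.
Proof.
move=> s00 s0s x0; have cL := cosL_gt0; split => // r r0.
rewrite /ray_expo cospi powRr1 ?(ltW r0)// mulrN1 sub0r lerBlDr.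
apply: (@le_trans _ _ (- (s0 * r))); first by rewrite lerN2 ler_wpM2r// ltW.
by rewrite lerDl mulr_ge0 ?(ltW cL)// mulr_ge0// powR_ge0.
Qed.

(** Whatever the sign of [x], the linear term wins over the power nu < 1 along
    the negative axis. *)
Lemma decaying_L s0 X : 0 < s0 -> exists C, forall x s, s0 <= s -> `|x| <= X ->
  decaying C (s0 / 2) 1 pi x s.
Proof.
move=> s00; pose X' := `|X| + 1.
have X0 : 0 < X' by rewrite /X' ltr_wpDl.
have n1 : 0 < 1 - nu by have := nu_lt; lra.
pose r0 := (2 * X' / s0) `^ (1 - nu)^-1.
have r00 : 0 < r0 by rewrite powR_gt0// divr_gt0// mulr_gt0.
exists (X' * r0 `^ nu) => x s s0s xX; split; rewrite ?divr_gt0// => r rp.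
have rn0 := powR_ge0 r nu.
have key : X' * r `^ nu <= X' * r0 `^ nu + s0 / 2 * r.
  have [rr0|rr0] := leP r r0.
    apply: ler_wpDr; first by rewrite mulr_ge0 ?divr_ge0 ?ltW.
    rewrite ler_wpM2l ?(ltW X0)//.
    by apply: ge0_ler_powR; rewrite ?nnegrE ?(ltW nu_gt0) ?(ltW rp) ?(ltW r00).
  apply: ler_wpDl; first by rewrite mulr_ge0 ?powR_ge0 ?ltW.
  have : r0 `^ (1 - nu) <= r `^ (1 - nu).
    by apply: ge0_ler_powR; rewrite ?nnegrE ?(ltW n1) ?(ltW rp) ?(ltW r00) ?(ltW rr0).
  rewrite -powRrM mulVf ?gt_eqF// powRr1; last by rewrite divr_ge0 ?mulr_ge0 ?ltW.
  rewrite ler_pdivrMr// => h.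
  have rE : r = r `^ (1 - nu) * r `^ nu.
    by rewrite -powRD ?(gt_eqF rp) ?implybT// subrK powRr1// ltW.
  rewrite [in leRHS]rE mulrA ler_wpM2r//; lra.
rewrite /ray_expo cospi powRr1 ?(ltW rp)// mulrN1.
apply: (@le_trans _ _ (- (s0 * r) + X' * r `^ nu)); last by lra.
apply: lerD; first by rewrite lerN2 ler_wpM2r// ltW.
rewrite (le_trans (ler_norm _))// normrN !normrM (ger0_norm rn0).
rewrite -[leRHS]mulr1 ler_pM ?mulr_ge0// ?cos_max//.
by rewrite ler_wpM2r// /X' (le_trans xX)// (le_trans (ler_norm _))// lerDl.
Qed.

Lemma ray_flux_cvg0 b psi th x s C m q : b < 1 -> decaying C m q th x s ->
  ray_flux b psi th x s r @[r --> (0:R)^'+] --> (0:R).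
Proof.
move=> b1 D; have [m0 q0 _] := D.
apply: cvg_norm_le (powR_decay_cvg0 C (b := 1 - b) m0 q0 _); last lra.
by near=> r; apply: ray_flux_le => //; near: r; exact: nbhs_right_gt.
Unshelve. all: by end_near. Qed.

(** At b = 1 the flux tends to the residue of dz / z. *)
Lemma ray_flux_cvg1 th x s : ray_flux 1 0 th x s r @[r --> (0:R)^'+] --> (1:R).
Proof.
have rc : r @[r --> (0:R)^'+] --> (0:R) by apply: cvg_at_right_filter; exact: cvg_id.
have rn : r `^ nu @[r --> (0:R)^'+] --> (0:R) by exact: powR_cvg0.
have lin (u v : R) : s * r * u - x * r `^ nu * v @[r --> (0:R)^'+] --> (0:R).
  rewrite [X in _ --> X](_ : 0 = s * 0 * u - x * 0 * v); last by ring.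
  by apply: cvgB; (apply: cvgM; [apply: cvgM; [exact: cvg_cst|]|exact: cvg_cst]).
have lin' (u v : R) : s * r * u - x * r `^ nu * v + (1 - 1) * th + 0 @[r --> (0:R)^'+] --> (0:R).
  rewrite [X in _ --> X](_ : 0 = 0 + (1 - 1) * th + 0); last by ring.
  by apply: cvgD; [apply: cvgD; [exact: lin|exact: cvg_cst]|exact: cvg_cst].
rewrite /Ray.ray_flux /ray_expo /ray_phase.
have e1 : expR (s * r * cos th - x * r `^ nu * cos (nu * th)) @[r --> (0:R)^'+] --> (1:R).
  by rewrite -expR0; exact: (cvg_comp _ _ (lin _ _) (@continuous_expR R 0)).
have c1 : cos (s * r * sin th - x * r `^ nu * sin (nu * th) + (1 - 1) * th + 0)
   @[r --> (0:R)^'+] --> (1:R).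
  by rewrite -[X in _ --> X]cos0; exact: (cvg_comp _ _ (lin' _ _) (@continuous_cos R 0)).
rewrite -[X in _ --> X](mul1r 1); apply: cvg_trans (cvgM e1 c1); apply: near_eq_cvg.
by near=> r; rewrite /= subrr powRr0 mul1r.
Unshelve. all: by end_near. Qed.

Lemma ray0 b x s : ray b 0 0 x s = 0.
Proof.
rewrite /Ray.ray /Rintegral integral0_eq// => r _; congr EFin.
by rewrite /Ray.ray_fun /ray_phase !(mulr0, sin0, oppr0, addr0).
Qed.

End Decay.
End Axis.
Import Axis.

Section Kernels.
Context {R : realType} (nu : R) (nu_gt0 : 0 < nu) (nu_lt : nu < 2^-1).
Local Notation mu := (@lebesgue_measure R).
Local Notation Rp := (`]0%R, +oo[%classic : set R).
Implicit Types (b psi th x s r C m q e : R).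
Local Notation ray := (ray nu).
Local Notation ray_fun := (ray_fun nu).
Local Notation ray_flux := (ray_flux nu).
Local Notation decaying := (decaying nu).
Local Notation rayV := (rayV nu).
Local Notation rayL := (rayL nu).

Lemma norm_Rintegral_le (D : set R) (f g : R -> R) : measurable D ->
  measurable_fun D f -> (forall x, D x -> `|f x| <= g x) ->
  mu.-integrable D (EFin \o g) ->
  `|(\int[mu]_(x in D) f x)%R| <= (\int[mu]_(x in D) g x)%R.
Proof.
move=> mD mf fg ig; have fi := bound_integrable mD mf fg ig.
apply: (@le_trans _ _ (\int[mu]_(x in D) `|f x|)%R); first exact: le_normr_Rintegral.
apply: le_Rintegral => //; exact: integrable_norm.
Qed.

Lemma admissible0 b : b <= 1 -> admissible b 0.
Proof. by rewrite le_eqVlt => /predU1P[->|]; [right|left]. Qed.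

Lemma pi2_gt0 : 0 < pi / 2 :> R. Proof. by have := pi_gt0 R; lra. Qed.

(** Causality: for [s] nonpositive the ray can be turned to the positive axis,
    where the integrand is real and its imaginary part 0. *)
Lemma rayV_neg b x s : b < 1 -> 0 < x -> s <= 0 -> rayV b x s = 0.
Proof.
move=> b1 x0 s0.
have D th := @decaying_turnV R nu nu_gt0 nu_lt th x s x0 s0.
have F th : 0 < th < pi / 2 -> ray_flux b 0 th x s r @[r --> (0:R)^'+] --> (0:R).
  by move=> /andP[t0 t1]; apply: (ray_flux_cvg0 _ b1 (D _ _)); rewrite !ltW.
have := ray_rotation nu_gt0 nu_lt pi2_gt0 (admissible0 (ltW b1)) D F.
by rewrite ray0 subr0 oppr0 mul0r.
Qed.

(** At b = 1 the same rotation makes a quarter turn around the pole at 0. *)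
Lemma rayV1_neg x s : 0 < x -> s <= 0 -> rayV 1 x s = - (pi / 2).
Proof.
move=> x0 s0.
have D th := @decaying_turnV R nu nu_gt0 nu_lt th x s x0 s0.
have F th : 0 < th < pi / 2 -> ray_flux 1 0 th x s r @[r --> (0:R)^'+] --> (1:R).
  by move=> _; apply: ray_flux_cvg1.
have := ray_rotation nu_gt0 nu_lt pi2_gt0 (admissible0 (lexx 1)) D F.
by rewrite ray0 !subr0 mulN1r.
Qed.

Lemma pi2_lt_pi : pi / 2 < pi :> R. Proof. by have := pi_gt0 R; lra. Qed.

(** For [s] nonnegative the ray can be turned on to the negative axis. *)
Lemma rayL_V b x s : b < 1 -> 0 < x -> 0 <= s -> rayL b x s = rayV b x s.
Proof.
move=> b1 x0 s0; apply/eqP; rewrite -subr_eq0; apply/eqP.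
have D th := @decaying_turnL R nu nu_gt0 nu_lt th x s x0 s0.
have F th : pi / 2 < th < pi -> ray_flux b 0 th x s r @[r --> (0:R)^'+] --> (0:R).
  by move=> /andP[t0 t1]; apply: (ray_flux_cvg0 _ b1 (D _ _)); rewrite !ltW.
have := ray_rotation nu_gt0 nu_lt pi2_lt_pi (admissible0 (ltW b1)) D F.
by rewrite oppr0 mul0r.
Qed.

Lemma rayL1_V x s : 0 < x -> 0 <= s -> rayL 1 x s = rayV 1 x s - pi / 2.
Proof.
move=> x0 s0.
have D th := @decaying_turnL R nu nu_gt0 nu_lt th x s x0 s0.
have F th : pi / 2 < th < pi -> ray_flux 1 0 th x s r @[r --> (0:R)^'+] --> (1:R).
  by move=> _; apply: ray_flux_cvg1.
have := ray_rotation nu_gt0 nu_lt pi2_lt_pi (admissible0 (lexx 1)) D F.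
by rewrite -/(rayL 1 x s) -/(rayV 1 x s); lra.
Qed.

Lemma is_derive_rayV_x b x s : b <= 1 -> 0 < x ->
  is_derive x 1 (fun x => rayV b x s) (- rayV (b - nu) x s).
Proof.
move=> b1 x0; have x20 : 0 < x / 2 by lra.
apply: (is_derive_ray_x nu_gt0 (admissible0 b1) x20) => x' xx'.
apply: (decaying_V nu_gt0 nu_lt s x20).
by move: xx'; rewrite ltr_norml; lra.
Qed.

Lemma is_derive_rayV_s b x s : b <= 1 -> 0 < x ->
  is_derive s 1 (fun s => rayV b x s) (rayV (b - 1) x s).
Proof.
move=> b1 x0; apply: (is_derive_ray_s nu_gt0 (admissible0 b1) (@ltr01 R)) => s' _.
exact: (decaying_V nu_gt0 nu_lt s' x0).
Qed.

Lemma is_derive_rayL_x b x s : b <= 1 -> 0 < s ->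
  is_derive x 1 (fun x => rayL b x s) (- rayL (b - nu) x s).
Proof.
move=> b1 s0; have [C H] := decaying_L nu_gt0 nu_lt (`|x| + 1) s0.
apply: (is_derive_ray_x nu_gt0 (admissible0 b1) (@ltr01 R)) => x' xx'.
apply: H => //; rewrite -(subrK x x') (le_trans (ler_normD _ _))// addrC.
by rewrite lerD2l ltW.
Qed.

Lemma is_derive_rayL_s b x s : b <= 1 -> 0 < s ->
  is_derive s 1 (fun s => rayL b x s) (rayL (b - 1) x s).
Proof.
move=> b1 s0; have s20 : 0 < s / 2 by lra.
have [C H] := decaying_L nu_gt0 nu_lt `|x| s20.
apply: (is_derive_ray_s nu_gt0 (admissible0 b1) s20) => s' ss'.
by apply: H => //; move: ss'; rewrite ltr_norml; lra.
Qed.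

Lemma rayL_decaying x s : 0 < s -> exists C m q, decaying C m q pi x s.
Proof.
move=> s0; have [C H] := decaying_L nu_gt0 nu_lt `|x| s0.
by exists C, (s / 2), 1; exact: H.
Qed.

(** For b = 1 it expresses the boundary kernel by the initial one: s rayL 0 =
    x nu rayL (1 - nu). *)
Lemma rayL_euler b x s : b <= 1 -> 0 < s ->
  (1 - b) * rayL b x s + s * rayL (b - 1) x s = x * nu * rayL (b - nu) x s.
Proof.
move=> b1 s0; have [C [m [q D]]] := rayL_decaying x s0.
exact: (ray_euler nu_gt0 (admissible0 b1) D).
Qed.

Lemma rayL_scaling b x s : b <= 1 -> 0 < s ->
  rayL b x s = s `^ (b - 1) * rayL b (x * s `^ (- nu)) 1.
Proof.
move=> b1 s0; have [C [m [q D]]] := rayL_decaying x s0.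
exact: (ray_scaling nu_gt0 s0 (admissible0 b1) D).
Qed.

Lemma rayV_bound b x0 : b < 1 -> 0 < x0 ->
  exists K, 0 <= K /\ forall x s, x0 <= x -> `|rayV b x s| <= K.
Proof.
move=> b1 x00; have c0 := cosV_gt0 nu_gt0 nu_lt.
pose g r := r `^ (- b) * expR (0 - x0 * cos (nu * (pi / 2)) * r `^ nu).
exists (\int[mu]_(r in Rp) g r)%R; split.
  by apply: Rintegral_ge0 => r _; rewrite mulr_ge0 ?powR_ge0 ?expR_ge0.
move=> x s xx; apply: norm_Rintegral_le => //.
- exact: measurable_funTS (measurable_ray_fun _ _ _ _ _ _).
- move=> r; rewrite /= in_itv/= andbT => r0.
  exact: (ray_fun_le _ _ (decaying_V nu_gt0 nu_lt s x00 xx) r0).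
- by apply: integrable_powR_decay; rewrite ?mulr_gt0//; lra.
Qed.

Lemma sqr_expRN_le (y a : R) : 0 <= y -> 0 < a ->
  y ^+ 2 * expR (- (y * a)) <= 4 / a ^+ 2.
Proof.
move=> y0 a0; have u0 : 0 <= y * a / 2 by rewrite divr_ge0 ?mulr_ge0 ?(ltW a0).
have h : (y * a / 2) ^+ 2 <= expR (y * a).
  have -> : y * a = y * a / 2 * 2 by lra.
  rewrite expRM_natr lerXn2r ?nnegrE ?expR_ge0//; try lra.
  by apply: le_trans (expR_ge1Dx _); lra.
rewrite expRN ler_pdivrMr ?expR_gt0// mulrAC ler_pdivlMr ?exprn_gt0//.
by move: h; rewrite !exprMn exprVn; lra.
Qed.

(** Near the origin the term - x z^nu gives decay in x: 1 + y^2 is absorbed at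
    the price of the factor r^(-2 nu). *)
Lemma rayL_bound0 b : b + 2 * nu < 1 -> exists K, 0 <= K /\
  forall y, 0 <= y -> `|rayL b y 1| <= K * (1 + y ^+ 2)^-1.
Proof.
move=> b1; have n0 := nu_gt0; have c0 := cosL_gt0 nu_gt0 nu_lt.
set c := cos (nu * pi) in c0 *.
pose g r := r `^ (- b) * expR (0 - 1 * r `^ 1) +
            4 / c ^+ 2 * (r `^ (- b - 2 * nu) * expR (0 - 1 * r `^ 1)).
have ig : mu.-integrable Rp (EFin \o g).
  apply: integrableD_EFin => //; last apply: integrableZ_EFin => //;
  by apply: integrable_powR_decay; lra.
exists (\int[mu]_(r in Rp) g r)%R; split.
  apply: Rintegral_ge0 => r _; rewrite addr_ge0 ?mulr_ge0 ?powR_ge0 ?expR_ge0//.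
  by rewrite invr_ge0 exprn_ge0// ltW.
move=> y y0; have y21 : 0 < 1 + y ^+ 2 by rewrite ltr_pwDl// sqr_ge0.
rewrite -RintegralZr//; apply: norm_Rintegral_le => //.
- exact: measurable_funTS (measurable_ray_fun _ _ _ _ _ _).
- move=> r; rewrite /= in_itv/= andbT => r0.
  rewrite ler_pdivlMr// /Ray.ray_fun !normrM ger0_norm ?powR_ge0//.
  rewrite (ger0_norm (expR_ge0 _)) /ray_expo cospi.
  have rn : 0 < r `^ nu by rewrite powR_gt0.
  have -> : g r = r `^ (- b) * (expR (- r) * (1 + 4 / (r `^ nu * c) ^+ 2)).
    rewrite /g !mul1r powRr1 ?(ltW r0)// !sub0r.
    rewrite (_ : - b - 2 * nu = - b + - (nu * 2)); last by ring.
    rewrite powRD ?(gt_eqF r0) ?implybT// (powRN r (nu * 2)) powRrM powR_mulrn ?(ltW rn)//.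
    by field; rewrite !gt_eqF.
  rewrite -[leLHS]mulrA ler_wpM2l ?powR_ge0//.
  rewrite (_ : 1 * r * -1 - y * r `^ nu * cos (nu * pi) = - r + - (y * (r `^ nu * c))); last by rewrite /c; ring.
  rewrite expRD -!mulrA ler_wpM2l ?expR_ge0//.
  apply: (@le_trans _ _ (expR (- (y * (r `^ nu * c))) * (1 + y ^+ 2))).
    rewrite ler_wpM2l ?expR_ge0// ler_piMl ?sin_max// ltW//.
  rewrite mulrDr mulr1 lerD//.
    by rewrite expR_le1 oppr_le0 !mulr_ge0 ?(ltW c0) ?(ltW rn).
  by rewrite mulrC sqr_expRN_le// mulr_gt0.
- rewrite (_ : (fun r => _) = (fun r => (1 + y ^+ 2)^-1 * g r)).
    exact: integrableZ_EFin.
  by apply/funext => r; rewrite mulrC.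
Qed.

End Kernels.

(** * Bounds and masses of the kernels *)

Section Masses.
Context {R : realType} (nu : R) (nu_gt0 : 0 < nu) (nu_lt : nu < 2^-1).
Local Notation mu := (@lebesgue_measure R).
Local Notation Rp := (`]0%R, +oo[%classic : set R).
Implicit Types (b psi th x s r C m q e y : R).
Local Notation rayV := (rayV nu).
Local Notation rayL := (rayL nu).

Lemma rayL_bounded b : b < 1 -> exists K, 0 <= K /\
  forall y, 0 <= y -> `|rayL b y 1| <= K.
Proof.
move=> b1; pose g r := r `^ (- b) * expR (0 - 1 * r `^ 1).
exists (\int[mu]_(r in Rp) g r)%R; split.
  by apply: Rintegral_ge0 => r _; rewrite mulr_ge0 ?powR_ge0 ?expR_ge0.
move=> y y0; apply: norm_Rintegral_le => //.
- exact: measurable_funTS (measurable_ray_fun _ _ _ _ _ _).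
- move=> r; rewrite /= in_itv/= andbT => r0.
  exact: (ray_fun_le _ _ (decaying_L0 nu_gt0 nu_lt (@ltr01 R) (lexx 1) y0) r0).
- by apply: integrable_powR_decay => //; lra.
Qed.

(** A bound on y k(y) and a bound on k together control k with the same decay.
    *)
Lemma decay_gain (h k : R -> R) (K K' : R) : 0 <= K' ->
  (forall y, 0 <= y -> y * `|k y| <= K * (1 + y ^+ 2)^-1) ->
  (forall y, 0 <= y -> `|k y| <= K') ->
  forall y, 0 <= y -> `|k y| <= (`|K| + 2 * K') * (1 + y ^+ 2)^-1.
Proof.
move=> K'0 yk k0 y y0; have y21 : 0 < 1 + y ^+ 2 by rewrite ltr_pwDl// sqr_ge0.
have [y1|y1] := leP y 1.
  rewrite ler_pdivlMr//; apply: (@le_trans _ _ (K' * 2)).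
    apply: ler_pM => //; [exact: ltW|exact: k0|nra].
  by have := normr_ge0 K; lra.
apply: (@le_trans _ _ (y * `|k y|)); first by rewrite ler_peMl// ltW.
apply: (le_trans (yk _ y0)); rewrite ler_wpM2r ?invr_ge0 ?(ltW y21)//.
by have := ler_norm K; lra.
Qed.

(** The direct estimate would need a smaller index; the Euler relation trades
    rayL 0, which it does cover, for y rayL (1 - nu). *)
Lemma rayL_bound_N : exists K, 0 <= K /\
  forall y, 0 <= y -> `|rayL (1 - nu) y 1| <= K * (1 + y ^+ 2)^-1.
Proof.
have n0 := nu_gt0; have n1 := nu_lt.
have [|K [K0 KE]] := @rayL_bound0 R nu nu_gt0 nu_lt 0; first lra.
have [|K' [K'0 KE']] := @rayL_bounded (1 - nu); first lra.
exists (`|K / nu| + 2 * K'); split; first by rewrite addr_ge0// mulr_ge0.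
apply: (@decay_gain id) => // y y0.
have := rayL_euler nu_gt0 nu_lt (b := 1) y (lexx 1) (@ltr01 R).
rewrite subrr mul0r add0r mul1r => E.
have -> : y * `|rayL (1 - nu) y 1| = `|rayL 0 y 1| / nu.
  rewrite [X in `|X| / nu]E !normrM (ger0_norm y0) (gtr0_norm n0).
  by field; rewrite gt_eqF.
by rewrite mulrAC ler_wpM2r ?invr_ge0 ?(ltW n0)//; exact: KE.
Qed.

(** The same trade one step further in the Euler relation. *)
Lemma rayL_bound_Nx : exists K, 0 <= K /\
  forall y, 0 <= y -> `|rayL (1 - 2 * nu) y 1| <= K * (1 + y ^+ 2)^-1.
Proof.
have n0 := nu_gt0; have n1 := nu_lt.
have [K1 [K10 KE1]] := rayL_bound_N.
have [|K [K0 KE]] := @rayL_bound0 R nu nu_gt0 nu_lt (- nu); first lra.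
have [|K' [K'0 KE']] := @rayL_bounded (1 - 2 * nu); first lra.
exists (`|K1 + K / nu| + 2 * K'); split; first by rewrite addr_ge0// mulr_ge0.
apply: (@decay_gain id) => // y y0.
have b1 : 1 - nu <= 1 by lra.
have := rayL_euler nu_gt0 nu_lt y b1 (@ltr01 R).
rewrite (_ : 1 - nu - 1 = - nu); last by ring.
rewrite (_ : 1 - nu - nu = 1 - 2 * nu); last by ring.
rewrite (_ : 1 - (1 - nu) = nu); last by ring.
rewrite mul1r => E.
have -> : y * `|rayL (1 - 2 * nu) y 1| = `|nu * rayL (1 - nu) y 1 + rayL (- nu) y 1| / nu.
  rewrite E !normrM (ger0_norm y0) (gtr0_norm n0).
  by field; rewrite gt_eqF.
rewrite ler_pdivrMr// (le_trans (ler_normD _ _))// normrM (gtr0_norm n0).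
have -> : (K1 + K / nu) * (1 + y ^+ 2)^-1 * nu =
  nu * (K1 * (1 + y ^+ 2)^-1) + K * (1 + y ^+ 2)^-1.
  by field; rewrite !gt_eqF// ltr_pwDl// sqr_ge0.
by rewrite lerD ?KE// ler_wpM2l ?(ltW n0)// KE1.
Qed.

(** Scaling turns the bound at time 1 into one that is uniform in the
    position, with the singularity in time made explicit. *)
Lemma rayL_bound b (S : R) : 0 < S -> b <= 1 ->
  (exists K, 0 <= K /\ forall y, 0 <= y -> `|rayL b y 1| <= K * (1 + y ^+ 2)^-1) ->
  exists K, 0 <= K /\ forall y s, 0 <= y -> 0 < s <= S ->
    `|rayL b y s| <= K * s `^ (b - 1) * (1 + y ^+ 2)^-1.
Proof.
move=> S0 b1 [K [K0 KE]]; have n0 := nu_gt0.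
pose c := 1 + S `^ (2 * nu).
have c1 : 1 <= c by rewrite /c lerDl powR_ge0.
exists (K * c); split; first by rewrite mulr_ge0//; lra.
move=> y s y0 /andP[s0 sS].
rewrite (rayL_scaling nu_gt0 nu_lt y b1 s0) normrM ger0_norm ?powR_ge0//.
rewrite [leRHS](_ : _ = s `^ (b - 1) * (K * (c * (1 + y ^+ 2)^-1))); last by ring.
rewrite ler_wpM2l ?powR_ge0//.
have ys0 : 0 <= y * s `^ (- nu) by rewrite mulr_ge0// powR_ge0.
apply: (le_trans (KE _ ys0)); rewrite ler_wpM2l//.
have y21 : 0 < 1 + y ^+ 2 by rewrite ltr_pwDl// sqr_ge0.
have z21 : 0 < 1 + (y * s `^ (- nu)) ^+ 2 by rewrite ltr_pwDl// sqr_ge0.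
rewrite ler_pdivlMr// mulrC ler_pdivrMr//.
have sn : 0 < s `^ (2 * nu) by rewrite powR_gt0.
have sSn : s `^ (2 * nu) <= S `^ (2 * nu).
  by apply: ge0_ler_powR; rewrite ?nnegrE//; lra.
rewrite exprMn -(powR_mulrn 2 (powR_ge0 s (- nu))) -powRrM (_ : - nu * 2%:R = - (2 * nu)); last by ring.
rewrite powRN -/c mulrDr mulr1 lerD//.
rewrite mulrCA ler_peMr ?sqr_ge0// ler_pdivlMr// mul1r /c.
by lra.
Qed.

Lemma powRN_cvgy (c : R) : 0 < c -> s `^ (- c) @[s --> +oo%R] --> (0 : R).
Proof.
move=> c0; apply/cvgrPdist_lt => e e0; near=> s.
have s1 : e `^ (- c^-1) < s by near: s; apply: nbhs_pinfty_gt; exact: num_real.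
have e1 : 0 < e `^ (- c^-1) by rewrite powR_gt0.
have s0 : 0 < s by exact: lt_trans s1.
rewrite sub0r normrN ger0_norm ?powR_ge0// powRN invf_plt ?posrE ?powR_gt0//.
have : (e `^ (- c^-1)) `^ c < s `^ c.
  by apply: gt0_ltr_powR; rewrite ?nnegrE// ltW.
by rewrite -powRrM mulNr mulVf ?gt_eqF// powR_inv1// ltW.
Unshelve. all: by end_near. Qed.

Lemma rayL1_at0 s : rayL 1 0 s = 0.
Proof.
rewrite /Axis.rayL /ray /Rintegral integral0_eq// => r _; congr EFin.
by rewrite /ray_fun /ray_phase !(sinpi, mulr0, mul0r, subrr, addr0, subr0, sin0).
Qed.

Lemma rayV1_cvgy : rayV 1 1 s @[s --> +oo%R] --> pi / 2.
Proof.
have c0 : {for (0:R), continuous (fun x => rayL 1 x 1)}.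
  exact: is_derive1_continuous (is_derive_rayL_x nu_gt0 nu_lt 0 (lexx 1) (@ltr01 R)).
have H : rayL 1 (s `^ (- nu)) 1 + pi / 2 @[s --> +oo%R] --> pi / 2.
  rewrite -[X in _ --> X]add0r; apply: cvgD; last exact: cvg_cst.
  have := cvg_comp _ _ (powRN_cvgy nu_gt0) c0; rewrite rayL1_at0; exact.
apply: cvg_trans H; apply: near_eq_cvg; near=> s.
have s0 : 0 < s by near: s; exact: nbhs_pinfty_gt.
have := rayL_scaling nu_gt0 nu_lt 1 (lexx 1) s0.
rewrite subrr powRr0 !mul1r => <-.
by rewrite rayL1_V ?(ltW s0)// subrK.
Unshelve. all: by end_near. Qed.

Lemma rayV_unit_bound : exists K, 0 <= K /\ forall s, 0 < s ->
  `|rayV 0 1 s| <= K * (1 + s) `^ (- (nu + 1)).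
Proof.
have n0 := nu_gt0; have n1 := nu_lt.
have [K1 [K10 KE1]] := rayV_bound nu_gt0 nu_lt (@ltr01 R) (@ltr01 R).
have [|K2 [K20 KE2]] := @rayL_bounded (1 - nu); first lra.
exists ((K1 + K2) * 2 `^ (nu + 1)); split; first by rewrite mulr_ge0 ?powR_ge0// addr_ge0.
move=> s s0; have s10 : 0 < 1 + s by lra.
rewrite powRN ler_pdivlMr ?powR_gt0//.
have [s1|s1] := leP s 1.
  apply: ler_pM; rewrite ?powR_ge0//.
    by apply: (le_trans (KE1 1 s (lexx 1))); lra.
  by apply: ge0_ler_powR; rewrite ?nnegrE; lra.
(* The Euler relation at b = 1 and scaling give the exact rate at infinity. *)
have E : rayV 0 1 s = nu * s `^ (- (nu + 1)) * rayL (1 - nu) (s `^ (- nu)) 1.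
  have := rayL_euler nu_gt0 nu_lt 1 (lexx 1) s0.
  rewrite subrr mul0r add0r mul1r rayL_V ?(ltW s0)// => H.
  have b1 : 1 - nu <= 1 by lra.
  rewrite (rayL_scaling nu_gt0 nu_lt 1 b1 s0) mul1r in H.
  have -> : rayV 0 1 s = s^-1 * (s * rayV 0 1 s) by rewrite mulKf// gt_eqF.
  rewrite H (_ : 1 - nu - 1 = - nu); last by ring.
  rewrite opprD powRD ?(gt_eqF s0) ?implybT// powR_inv1 ?(ltW s0)//; ring.
rewrite E !normrM (gtr0_norm n0) (ger0_norm (powR_ge0 _ _)).
have h1 : (1 + s) `^ (nu + 1) <= 2 `^ (nu + 1) * s `^ (nu + 1).
  rewrite -powRM ?(ltW s0)//; apply: ge0_ler_powR; rewrite ?nnegrE; lra.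
have h2 : `|rayL (1 - nu) (s `^ (- nu)) 1| <= K2 by apply: KE2; exact: powR_ge0.
apply: (@le_trans _ _ (nu * s `^ (- (nu + 1)) * K2 * (2 `^ (nu + 1) * s `^ (nu + 1)))).
  by apply: ler_pM; rewrite ?mulr_ge0 ?powR_ge0 ?(ltW n0)// ler_wpM2l// mulr_ge0 ?powR_ge0 ?(ltW n0).
rewrite powRN [leLHS](_ : _ = nu * K2 * 2 `^ (nu + 1)).
  rewrite ler_wpM2r ?powR_ge0//; nra.
by field; rewrite gt_eqF// powR_gt0.
Qed.

Lemma integrable_powR_tail (c : R) : 0 < c ->
  mu.-integrable Rp (EFin \o (fun s => (1 + s) `^ (- (c + 1)))).
Proof.
move=> c0.
have d1 r : is_derive r 1 (fun r : R => 1 + r) 1.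
  by apply: is_derive_eq; rewrite add0r mulr1.
have dp a r : 0 < r -> is_derive r 1 (fun r : R => (1 + r) `^ a) (a * (1 + r) `^ (a - 1)).
  move=> r0; have r1 : 0 < 1 + r by lra.
  have := @is_derive1_comp R (fun y : R => y `^ a) (fun r : R => 1 + r) r _ _
    (is_derive1_powR a r1) (d1 r).
  by rewrite mulr1.
apply: (@integrable_bounded_primitive R (fun r => - c^-1 * (1 + r) `^ (- c)) _ c^-1).
- move=> r r0; have d := dp (- c) r r0; apply: is_derive_eq.
  rewrite scale_realE (_ : - c - 1 = - (c + 1)); last by ring.
  by field; rewrite gt_eqF.
- by move=> r r0; exact: is_derive1_continuous (dp _ r r0).
- by move=> r _; exact: powR_ge0.
- move=> r r0; rewrite normrM normrN (gtr0_norm (_ : 0 < c^-1)) ?invr_gt0//.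
  rewrite ger0_norm ?powR_ge0// ler_piMr ?invr_ge0 ?(ltW c0)//.
  rewrite powRN invf_le1 ?powR_gt0//; last lra.
  rewrite [leLHS](_ : 1 = 1 `^ c); last by rewrite powR1.
  by apply: ge0_ler_powR; rewrite ?nnegrE; lra.
Qed.

Lemma measurable_rayV_s b x : b < 1 -> 0 < x -> measurable_fun setT (rayV b x).
Proof.
move=> b1 x0; apply: continuous_measurable_fun => s.
exact: is_derive1_continuous (is_derive_rayV_s nu_gt0 nu_lt s (ltW b1) x0).
Qed.

Lemma integrable_rayV_unit : mu.-integrable Rp (EFin \o rayV 0 1).
Proof.
have [K [K0 KE]] := rayV_unit_bound.
apply: (bound_integrable (g := fun s => K * (1 + s) `^ (- (nu + 1)))) => //.
- by apply: measurable_funTS; exact: measurable_rayV_s.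
- by move=> s; rewrite /= in_itv/= andbT; exact: KE.
- by apply: integrableZ_EFin => //; exact: integrable_powR_tail.
Qed.

(** The primitive is rayV 1, with limits - pi / 2 at time 0 and pi / 2 at
    infinity. *)
Lemma Rintegral_rayV_unit : (\int[mu]_(s in Rp) rayV 0 1 s = pi)%R.
Proof.
have d s := is_derive_rayV_s nu_gt0 nu_lt s (lexx 1) (@ltr01 R).
rewrite (_ : pi = pi / 2 - - (pi / 2)); last by lra.
apply: (@FTC_halfline R (rayV 1 1)).
- by move=> s s0; have := d s; rewrite subrr.
- move=> s s0; have l01 : (0:R) <= 1 by [].
  exact: is_derive1_continuous (is_derive_rayV_s nu_gt0 nu_lt s l01 (@ltr01 R)).
- exact: integrable_rayV_unit.
- rewrite -(@rayV1_neg R nu nu_gt0 nu_lt 1 0)//; apply: cvg_at_right_filter.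
  exact: is_derive1_continuous (d 0).
- exact: rayV1_cvgy.
Qed.

Lemma measurable_rayL_x b s : b <= 1 -> 0 < s -> measurable_fun setT (fun x => rayL b x s).
Proof.
move=> b1 s0; apply: continuous_measurable_fun => x.
exact: is_derive1_continuous (is_derive_rayL_x nu_gt0 nu_lt x b1 s0).
Qed.

(** The primitive in space is - rayL 1, and large [y] at time 1 is, by
    scaling, a small time at y = 1. *)
Lemma Rintegral_rayL_N : (\int[mu]_(y in Rp) rayL (1 - nu) y 1 = pi)%R.
Proof.
have n0 := nu_gt0; have n1 := nu_lt.
have d x := is_derive_rayL_x nu_gt0 nu_lt x (lexx 1) (@ltr01 R).
rewrite -(subr0 pi); apply: (@FTC_halfline R (fun x => - rayL 1 x 1)).
- by move=> x x0; have := d x => ?; apply: is_derive_eq; rewrite opprK.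
- move=> x _; have b1 : 1 - nu <= 1 by lra.
  exact: is_derive1_continuous (is_derive_rayL_x nu_gt0 nu_lt x b1 (@ltr01 R)).
- have [K [K0 KE]] := rayL_bound_N.
  apply: (bound_integrable (g := fun y => K * (1 + y ^+ 2)^-1)) => //.
  + by apply: measurable_funTS; apply: measurable_rayL_x; lra.
  + by move=> y; rewrite /= in_itv/= andbT => /ltW; exact: KE.
  + by apply: integrableZ_EFin => //; exact: integrable_invsqr.
- have : - rayL 1 x 1 @[x --> (0:R)^'+] --> - rayL 1 0 1.
    by apply: cvgN; apply: cvg_at_right_filter; exact: is_derive1_continuous (d 0).
  by rewrite rayL1_at0 oppr0.
- have cV : {for (0:R), continuous (rayV 1 1)}.
    exact: is_derive1_continuous (is_derive_rayV_s nu_gt0 nu_lt 0 (lexx 1) (@ltr01 R)).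
  have ni : 0 < nu^-1 by rewrite invr_gt0.
  have H : - (rayV 1 1 (y `^ (- nu^-1)) - pi / 2) @[y --> +oo%R] --> pi.
    rewrite [X in _ --> X](_ : pi = - (- (pi / 2) - pi / 2)); last by lra.
    apply: cvgN; apply: cvgB; last exact: cvg_cst.
    have := cvg_comp _ _ (powRN_cvgy ni) cV.
    by rewrite (@rayV1_neg R nu nu_gt0 nu_lt 1 0)//; exact.
  apply: cvg_trans H; apply: near_eq_cvg; near=> y.
  have y0 : 0 < y by near: y; exact: nbhs_pinfty_gt.
  have s0 : 0 < y `^ (- nu^-1) by rewrite powR_gt0.
  congr (- _); rewrite -rayL1_V ?(ltW s0)//.
  rewrite (rayL_scaling nu_gt0 nu_lt 1 (lexx 1) s0) subrr powRr0 !mul1r.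
  by rewrite -powRrM mulrNN mulVf ?gt_eqF// powRr1// ltW.
Unshelve. all: by end_near. Qed.

End Masses.

(** * Fractional integrals of the vertical ray *)

Section Damping.
Context {R : realType} (nu : R) (nu_gt0 : 0 < nu) (nu_lt : nu < 2^-1).
Local Notation mu := (@lebesgue_measure R).
Local Notation Rp := (`]0%R, +oo[%classic : set R).
Implicit Types (b psi th x s r v C m q e y p g phi : R).
Local Notation ray := (ray nu).
Local Notation rayV := (rayV nu).
Local Notation rayL := (rayL nu).

Lemma eq_integrable_EFin (D : set R) (f h : R -> R) : measurable D ->
  (forall r, D r -> f r = h r) -> mu.-integrable D (EFin \o f) ->
  mu.-integrable D (EFin \o h).
Proof.
move=> mD fh; apply: eq_integrable => // r; rewrite inE => Dr /=.
by rewrite fh.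
Qed.

Lemma euler_gamma_scale g p : 0 < g -> 0 < p ->
  (\int[mu]_(r in Rp) (r `^ (g - 1) * expR (- (p * r))))%R = p `^ (- g) * euler_gamma g.
Proof.
move=> g0 p0.
have ig : mu.-integrable Rp (EFin \o (fun r => r `^ (g - 1) * expR (- (1 * r `^ 1)))).
  by apply: integrable_powR_expR; lra.
have E1 r : r \in Rp -> r `^ (g - 1) * expR (- r) = r `^ (g - 1) * expR (- (1 * r `^ 1)).
  by rewrite inE/= in_itv/= andbT => r0; rewrite mul1r powRr1// ltW.
have -> : euler_gamma g = (\int[mu]_(r in Rp) (r `^ (g - 1) * expR (- (1 * r `^ 1))))%R.
  exact: eq_Rintegral.
rewrite (Rintegral_scale p0 ig).
have ip : mu.-integrable Rp (EFin \o (fun r => r `^ (g - 1) * expR (- (p * r `^ 1)))).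
  by apply: integrable_powR_expR; lra.
have E2 r : r \in Rp -> (p * r) `^ (g - 1) * expR (- (1 * (p * r) `^ 1)) =
    p `^ (g - 1) * (r `^ (g - 1) * expR (- (p * r `^ 1))).
  rewrite inE/= in_itv/= andbT => r0.
  rewrite powRM ?(ltW r0) ?(ltW p0)// mul1r !powRr1 ?mulr_ge0 ?(ltW r0) ?(ltW p0)//.
  by rewrite mulrA.
rewrite [X in _ * (_ * X)](_ : _ = \int[mu]_(r in Rp)
  (p `^ (g - 1) * (r `^ (g - 1) * expR (- (p * r `^ 1)))))%R; last exact: eq_Rintegral.
rewrite RintegralZl// [p * _]mulrA mulr_powRB1 ?(ltW p0)// mulrA powRN mulVf ?mul1r; last first.
  by rewrite gt_eqF// powR_gt0.
by apply: eq_Rintegral => r; rewrite inE/= in_itv/= andbT => r0; rewrite powRr1// ltW.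
Qed.

(** Euler integral along a ray of argument [phi]: the ray integral with x = 0
    and s = - p, turned back to the positive axis. *)
Lemma euler_gamma_ray g p phi psi : 0 < g -> 0 < p -> 0 <= phi < pi / 2 ->
  (\int[mu]_(v in Rp) (v `^ (g - 1) * (expR (- (p * cos phi * v)) *
     sin (psi - p * sin phi * v))))%R =
  p `^ (- g) * euler_gamma g * sin (psi - g * phi).
Proof.
move=> g0 p0 /andP[phi0 phi1]; have p2 := @pi2_gt0 R.
have E v phi' psi' : ray_fun nu (1 - g) psi' phi' 0 (- p) v =
    v `^ (g - 1) * (expR (- (p * cos phi' * v)) * sin (psi' + g * phi' - p * sin phi' * v)).
  rewrite /ray_fun /ray_expo /ray_phase opprB.
  by congr (_ * (expR _ * sin _)); ring.
have E0 : ray (1 - g) (psi - g * phi) 0 0 (- p) = p `^ (- g) * euler_gamma g * sin (psi - g * phi).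
  rewrite -euler_gamma_scale// -RintegralZr//; last first.
    have H : mu.-integrable Rp (EFin \o (fun r => r `^ (g - 1) * expR (- (p * r `^ 1)))).
      by apply: integrable_powR_expR; lra.
    apply: eq_integrable_EFin H => // r; rewrite /= in_itv/= andbT => r0.
    by rewrite powRr1// ltW.
  apply: eq_Rintegral => v _; rewrite E cos0 sin0 !mulr0 mulr1 mul0r addr0 subr0.
  by rewrite mulrA.
rewrite -E0.
have -> : (\int[mu]_(v in Rp) (v `^ (g - 1) * (expR (- (p * cos phi * v)) *
     sin (psi - p * sin phi * v))))%R = ray (1 - g) (psi - g * phi) phi 0 (- p).
  by apply: eq_Rintegral => v _; rewrite E subrK.
move: phi0; rewrite le_eqVlt => /predU1P[<-//|phi0].
have cphi : 0 < cos phi by apply: cos_gt0_pihalf; rewrite phi1 andbT; lra.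
have b1 : 1 - g < 1 by lra.
have D th : 0 <= th <= phi -> decaying nu 0 (p * cos phi) 1 th 0 (- p).
  move=> /andP[t0 t1]; split; rewrite ?mulr_gt0// => r r0.
  rewrite /ray_expo !mul0r subr0 powRr1 ?(ltW r0)// sub0r !mulNr lerN2 mulrAC.
  rewrite ler_wpM2l ?mulr_ge0 ?(ltW p0) ?(ltW r0)//.
  by apply: le_cos => //; have := pi_gt0 R; lra.
have F th : 0 < th < phi -> ray_flux nu (1 - g) (psi - g * phi) th 0 (- p) r @[r --> (0:R)^'+] --> (0:R).
  by move=> /andP[t0 t1]; apply: (ray_flux_cvg0 _ b1 (D _ _)); rewrite !ltW.
have := ray_rotation nu_gt0 nu_lt phi0 (or_introl b1) D F.
by rewrite oppr0 mul0r => /eqP; rewrite subr_eq0 => /eqP.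
Qed.

Lemma polar_atan e r : 0 < e -> 0 < r -> let p := e / cos (atan (r / e)) in
  [/\ 0 < p, p * cos (atan (r / e)) = e, p * sin (atan (r / e)) = r & r <= p <= r + e].
Proof.
move=> e0 r0 /=; set phi := atan _.
have c0 : 0 < cos phi.
  by apply: cos_gt0_pihalf; rewrite atan_gtNpi2 atan_ltpi2.
have p0 : 0 < e / cos phi by rewrite divr_gt0.
have h1 : e / cos phi * cos phi = e by rewrite divfK// gt_eqF.
have h2 : e / cos phi * sin phi = r.
  have : tan phi = r / e by rewrite /phi atanK.
  rewrite /tan => t; rewrite mulrAC -mulrA t mulrCA divff ?mulr1// gt_eqF//.
split => //.
have := cos2Dsin2 phi => cs.
have pp : (e / cos phi) ^+ 2 = e ^+ 2 + r ^+ 2.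
  by rewrite -[LHS]mulr1 -cs mulrDr -!exprMn h1 h2.
apply/andP; split; nra.
Qed.

Lemma euler_gamma_ge0 g : 0 <= euler_gamma g.
Proof. by apply: Rintegral_ge0 => r _; rewrite mulr_ge0 ?powR_ge0 ?expR_ge0. Qed.

Lemma rayV_expand b x s r : ray_fun nu b 0 (pi / 2) x s r =
  r `^ (- b) * expR (0 - x * cos (nu * (pi / 2)) * r `^ nu) *
  sin (s * r - x * sin (nu * (pi / 2)) * r `^ nu + (1 - b) * (pi / 2)).
Proof.
rewrite /ray_fun /ray_expo /ray_phase cos_pihalf sin_pihalf -[RHS]mulrA.
by congr (_ * (expR _ * sin _)); ring.
Qed.

(** Exchange of the two integrals, allowed by the damping e^(- e v) which
    makes the double integral absolutely convergent. *)
Lemma damped_integral b g x s e : b < 1 -> 0 < g -> 0 < x -> 0 < e ->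
  (\int[mu]_(v in Rp) (v `^ (g - 1) * expR (- (e * v)) * rayV b x (s - v)))%R =
  (\int[mu]_(r in Rp) (r `^ (- b) * expR (0 - x * cos (nu * (pi / 2)) * r `^ nu) *
     \int[mu]_(v in Rp) (v `^ (g - 1) * (expR (- (e * v)) * sin (s * r
       - x * sin (nu * (pi / 2)) * r `^ nu + (1 - b) * (pi / 2) - r * v)))))%R.
Proof.
move=> b1 g0 x0 e0; have n0 := nu_gt0; have c0 := cosV_gt0 nu_gt0 nu_lt.
pose A v := v `^ (g - 1) * expR (- (e * v)).
pose B r := r `^ (- b) * expR (0 - x * cos (nu * (pi / 2)) * r `^ nu).
pose k v r := A v * ray_fun nu b 0 (pi / 2) x (s - v) r.
have iA : mu.-integrable Rp (EFin \o A).
  have H : mu.-integrable Rp (EFin \o (fun r => r `^ (g - 1) * expR (- (e * r `^ 1)))).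
    by apply: integrable_powR_expR; lra.
  apply: eq_integrable_EFin H => // r; rewrite /= in_itv/= andbT => r0.
  by rewrite /A powRr1// ltW.
have iB : mu.-integrable Rp (EFin \o B).
  by apply: integrable_powR_decay; rewrite ?mulr_gt0//; lra.
have mp (c : R) : measurable_fun setT (fun r : R => r `^ c) by exact: measurable_powR.
have ms : measurable_fun setT (@sin R).
  exact: continuous_measurable_fun (@continuous_sin R).
have mA : measurable_fun setT A.
  apply: measurable_funM => //; apply: measurableT_comp => //.
  by apply: measurableT_comp => //; exact: measurable_funM.
have mB : measurable_fun setT B.
  apply: measurable_funM => //; apply: measurableT_comp => //.
  by apply: measurable_funB => //; exact: measurable_funM.
have kE v r : k v r = A v * (B r * sin ((s - v) * r - x * sin (nu * (pi / 2)) * r `^ nu + (1 - b) * (pi / 2))).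
  by rewrite /k rayV_expand.
have mk : measurable_fun (Rp `*` Rp) (fun z : R * R => k z.1 z.2).
  apply: measurable_funTS; under eq_fun do rewrite kE.
  apply: measurable_funM; first exact: (measurableT_comp mA).
  apply: measurable_funM; first exact: (measurableT_comp mB).
  apply: (measurableT_comp ms); apply: measurable_funD => //.
  apply: measurable_funB.
    by apply: measurable_funM => //; exact: measurable_funB.
  by apply: measurable_funM => //; exact: (measurableT_comp (mp _)).
have kAB v r : Rp v -> Rp r -> `|k v r| <= A v * B r.
  have A0 : 0 <= A v by rewrite mulr_ge0 ?powR_ge0 ?expR_ge0.
  have B0 : 0 <= B r by rewrite mulr_ge0 ?powR_ge0 ?expR_ge0.
  move=> _ _; rewrite kE normrM (ger0_norm A0) normrM (ger0_norm B0).
  by rewrite ler_wpM2l// ler_piMr// sin_max.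
transitivity (\int[mu]_(v in Rp) \int[mu]_(r in Rp) k v r)%R.
  apply: eq_Rintegral => v _; rewrite /k RintegralZl//.
  exact: (integrable_ray _ b1 (decaying_V nu_gt0 nu_lt (s - v) x0 (lexx x))).
rewrite (Rfubini _ _ mk kAB)//; apply: eq_Rintegral => r; rewrite inE/= in_itv/= andbT => r0.
have fE v : k v r = B r * (v `^ (g - 1) * (expR (- (e * v)) * sin (s * r
       - x * sin (nu * (pi / 2)) * r `^ nu + (1 - b) * (pi / 2) - r * v))).
  rewrite kE /A (_ : (s - v) * r - _ + _ = s * r
    - x * sin (nu * (pi / 2)) * r `^ nu + (1 - b) * (pi / 2) - r * v); last by ring.
  by ring.
rewrite -RintegralZl//; first by apply: eq_Rintegral => v _; exact: fE.
apply: (bound_integrable (g := A)) => //.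
  apply: measurable_funTS; apply: measurable_funM => //; apply: measurable_funM.
    by apply: measurableT_comp => //; apply: measurableT_comp => //; exact: measurable_funM.
  apply: (measurableT_comp ms); apply: measurable_funB => //; exact: measurable_funM.
move=> v _; rewrite mulrA normrM [`|_ * _|]ger0_norm ?mulr_ge0 ?powR_ge0 ?expR_ge0//.
by rewrite ler_piMr ?sin_max ?mulr_ge0 ?powR_ge0 ?expR_ge0.
Qed.

End Damping.

Section FractionalIntegral.
Context {R : realType} (nu : R) (nu_gt0 : 0 < nu) (nu_lt : nu < 2^-1).
Local Notation mu := (@lebesgue_measure R).
Local Notation Rp := (`]0%R, +oo[%classic : set R).
Implicit Types (b psi th x s r v C m q e y p g phi : R).
Local Notation ray := (ray nu).
Local Notation rayV := (rayV nu).
Local Notation rayL := (rayL nu).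

Lemma measurable_reflect (f : R -> R) (t : R) : measurable_fun setT f ->
  measurable_fun setT (fun v => f (t - v)).
Proof. by move=> mf; apply: measurableT_comp => //; exact: measurable_funB. Qed.

Lemma integrable_frac b g x s : b < 1 -> 0 < g -> 0 < x ->
  mu.-integrable Rp (EFin \o (fun v => v `^ (g - 1) * rayV b x (s - v))).
Proof.
move=> b1 g0 x0; have [K [K0 KE]] := rayV_bound nu_gt0 nu_lt b1 x0.
pose T := `|s| + 1; have T0 : 0 <= T by rewrite /T addr_ge0.
apply: (bound_integrable (g := (fun v => K * v `^ (g - 1)) \_ `]0, T[)) => //.
- apply: measurable_funTS; apply: measurable_funM; first exact: measurable_powR.
  exact: measurable_reflect (measurable_rayV_s nu_gt0 nu_lt b1 x0).
- move=> v; rewrite /= in_itv/= andbT => v0; rewrite patchE.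
  have [vT|vT] := ltP v T.
    rewrite mem_set/=; last by rewrite in_itv/= v0.
    by rewrite normrM ger0_norm ?powR_ge0// mulrC ler_wpM2r ?powR_ge0// KE.
  rewrite rayV_neg//; last by move: vT; rewrite /T; have := ler_norm s; lra.
  rewrite mulr0 normr0; case: ifP => // _.
  by rewrite mulr_ge0// powR_ge0.
- apply: (@integrableS _ _ _ mu setT) => //.
  by apply: integrable_restrictT => //; apply: integrableZ_EFin => //;
    apply: integrable_powR_itv => //; lra.
Qed.

Lemma cvg_cont (h : R -> R) (G : set_system R) (f : R -> R) (l : R) :
  {for l, continuous h} -> f x @[x --> G] --> l -> h (f x) @[x --> G] --> h l.
Proof. by move=> hl fl; exact: (cvg_comp f h fl hl). Qed.

Lemma cvg_atan_ratio r : 0 < r -> atan (r / e) @[e --> (0:R)^'+] --> pi / 2.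
Proof.
move=> r0; apply: (cvg_comp (fun e => r / e) atan _ (@cvgy_atan R)).
apply/cvgryPge => A; near=> e.
have A0 : 0 < `|A| + 1 by rewrite ltr_wpDl.
have e0 : 0 < e by near: e; exact: nbhs_right_gt.
have e1 : e < r / (`|A| + 1) by near: e; apply: nbhs_right_lt; rewrite divr_gt0.
rewrite ler_pdivlMr//; move: e1; rewrite ltr_pdivlMr// => e1.
have := ler_norm A; nra.
Unshelve. all: by end_near. Qed.

Lemma cvg_polar r : 0 < r -> e / cos (atan (r / e)) @[e --> (0:R)^'+] --> r.
Proof.
move=> r0; apply: (squeeze_cvgr (f := cst r) (h := fun e => r + e)).
- near=> e; have e0 : 0 < e by near: e; exact: nbhs_right_gt.
  by have [_ _ _] := polar_atan e0 r0.
- exact: cvg_cst.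
- rewrite -[X in _ --> X]addr0; apply: cvgD; first exact: cvg_cst.
  by apply: cvg_at_right_filter; exact: cvg_id.
Unshelve. all: by end_near. Qed.

(** Fractional integration shifts the index of the family: each mode e^(i r s)
    is an eigenfunction, with eigenvalue Gamma(g) (i r)^(-g). The mode itself
    has no convergent integral for g >= 1 and no absolutely convergent one for
    g < 1, so the damping is introduced first and removed at the end, by
    dominated convergence on both sides. *)
Lemma frac_rayV b g x s : b < 1 -> 0 < g -> b + g < 1 -> 0 < x ->
  (\int[mu]_(v in Rp) (v `^ (g - 1) * rayV b x (s - v)))%R =
  euler_gamma g * rayV (b + g) x s.
Proof.
move=> b1 g0 bg1 x0; have c0 := cosV_gt0 nu_gt0 nu_lt.
have ir := integrable_frac s b1 g0 x0.
have Hl : (\int[mu]_(v in Rp) (v `^ (g - 1) * expR (- (e * v)) * rayV b x (s - v)))%R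
    @[e --> (0:R)^'+] --> (\int[mu]_(v in Rp) (v `^ (g - 1) * rayV b x (s - v)))%R.
  apply: (@dominated_cvg_filter R _ _ Rp _ _
    (fun v => `|v `^ (g - 1) * rayV b x (s - v)|) (@sequential_at_right R 0)) => //.
  - apply: nearW => e; apply: measurable_funTS; apply: measurable_funM; last first.
      exact: measurable_reflect (measurable_rayV_s nu_gt0 nu_lt b1 x0).
    apply: measurable_funM; first exact: measurable_powR.
    by apply: measurableT_comp => //; apply: measurableT_comp => //; exact: measurable_funM.
  - near=> e; have e0 : 0 < e by near: e; exact: nbhs_right_gt.
    move=> v; rewrite /= in_itv/= andbT => v0; rewrite mulrAC normrM.
    rewrite ler_piMr// ger0_norm ?expR_ge0// expR_le1 oppr_le0 mulr_ge0 ?ltW//.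
  - exact: integrable_norm.
  - move=> v _.
    have ce : {for (0:R), continuous (fun e => expR (- (e * v)))}.
      by apply/differentiable_continuous/derivable1_diffP; exact: ex_derive.
    have := cvg_at_right_filter ce; rewrite mul0r oppr0 expR0 => H.
    have -> : v `^ (g - 1) * rayV b x (s - v) = v `^ (g - 1) * 1 * rayV b x (s - v).
      by rewrite mulr1.
    by apply: cvgM; [apply: cvgM; [exact: cvg_cst|exact: H]|exact: cvg_cst].
pose B r := r `^ (- b) * expR (0 - x * cos (nu * (pi / 2)) * r `^ nu).
pose P r := s * r - x * sin (nu * (pi / 2)) * r `^ nu + (1 - b) * (pi / 2).
pose I e r := (\int[mu]_(v in Rp) (v `^ (g - 1) * (expR (- (e * v)) * sin (P r - r * v))))%R.
(* With the damping the eigenvalue is Gamma(g) (e + i r)^(-g); e + i r is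
   written in polar coordinates, of angle atan (r / e). *)
have IE e r : 0 < e -> 0 < r -> I e r = (e / cos (atan (r / e))) `^ (- g) * euler_gamma g *
    sin (P r - g * atan (r / e)).
  move=> e0 r0; have [p0 pe pr _] := polar_atan e0 r0.
  have a0 : 0 <= atan (r / e) < pi / 2.
    by rewrite atan_ltpi2 andbT -atan0 le_atan// divr_ge0 ?ltW.
  rewrite -(euler_gamma_ray nu_gt0 nu_lt (P r) g0 p0 a0).
  by apply: eq_Rintegral => v _; rewrite pe pr.
have Hr : (\int[mu]_(r in Rp) (B r * I e r))%R @[e --> (0:R)^'+] -->
    (\int[mu]_(r in Rp) (euler_gamma g * ray_fun nu (b + g) 0 (pi / 2) x s r))%R.
  apply: (@dominated_cvg_filter R _ _ Rp _ _
    (fun r => euler_gamma g * (r `^ (- (b + g)) * expR (0 - x * cos (nu * (pi / 2)) * r `^ nu)))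
    (@sequential_at_right R 0)) => //.
  - near=> e; have e0 : 0 < e by near: e; exact: nbhs_right_gt.
    apply: (eq_measurable_fun (fun r => B r * ((e / cos (atan (r / e))) `^ (- g) *
        euler_gamma g * sin (P r - g * atan (r / e))))).
      by move=> r; rewrite inE/= in_itv/= andbT => r0; rewrite -IE.
    apply: open_continuous_measurable_fun => // r; rewrite inE/= in_itv/= andbT => r0.
    have [p0 _ _ _] := polar_atan e0 r0.
    have ca : atan (z / e) @[z --> r] --> atan (r / e).
      apply: (cvg_cont (@continuous_atan R (r / e))).
      by apply: cvgM; [exact: cvg_id|exact: cvg_cst].
    have cc : e / cos (atan (z / e)) @[z --> r] --> e / cos (atan (r / e)).
      apply: cvgM; first exact: cvg_cst.
      apply: cvgV; first by move: p0; rewrite pmulr_rgt0// invr_gt0 => /lt0r_neq0.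
      exact: (cvg_cont (@continuous_cos R _) ca).
    have cn (d : R) : {for r, continuous (fun y : R => y `^ d)}.
      exact: is_derive1_continuous (is_derive1_powR d r0).
    have cp : (e / cos (atan (z / e))) `^ (- g) @[z --> r] --> (e / cos (atan (r / e))) `^ (- g).
      apply: (cvg_cont (h := fun y => y `^ (- g)) _ cc).
      exact: is_derive1_continuous (is_derive1_powR (- g) p0).
    have cP : P z @[z --> r] --> P r.
      apply: cvgD; last exact: cvg_cst.
      apply: cvgB; first by apply: cvgM; [exact: cvg_cst|exact: cvg_id].
      by apply: cvgM; [exact: cvg_cst|exact: cn].
    apply: cvgM.
      apply: cvgM; first exact: cn.
      apply: (cvg_cont (h := expR)); first exact: continuous_expR.
      by apply: cvgB; [exact: cvg_cst|apply: cvgM; [exact: cvg_cst|exact: cn]].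
    apply: cvgM; first by apply: cvgM; [exact: cp|exact: cvg_cst].
    apply: (cvg_cont (h := sin)); first exact: continuous_sin.
    by apply: cvgB; [exact: cP|apply: cvgM; [exact: cvg_cst|exact: ca]].
  - near=> e; have e0 : 0 < e by near: e; exact: nbhs_right_gt.
    move=> r; rewrite /= in_itv/= andbT => r0; rewrite IE//.
    have [p0 pe pr /andP[rp _]] := polar_atan e0 r0.
    have -> : - (b + g) = - b + - g by ring.
    rewrite powRD ?(gt_eqF r0) ?implybT// /B !normrM.
    rewrite !(ger0_norm (powR_ge0 _ _)) (ger0_norm (expR_ge0 _)) (ger0_norm (euler_gamma_ge0 _)).
    rewrite [leRHS](_ : _ = r `^ (- b) * expR (0 - x * cos (nu * (pi / 2)) * r `^ nu) *
      (r `^ (- g) * euler_gamma g)); last by ring.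
    rewrite ler_wpM2l ?mulr_ge0 ?powR_ge0 ?expR_ge0//.
    rewrite -[leRHS]mulr1 ler_pM ?mulr_ge0 ?powR_ge0 ?euler_gamma_ge0 ?sin_max//.
    rewrite ler_wpM2r ?euler_gamma_ge0// !powRN lef_pV2 ?posrE ?powR_gt0//.
    by apply: ge0_ler_powR; rewrite ?nnegrE ?(ltW g0) ?(ltW p0) ?(ltW r0).
  - by apply: integrableZ_EFin => //; apply: integrable_powR_decay; rewrite ?mulr_gt0//; lra.
  - move=> r; rewrite /= in_itv/= andbT => r0; rewrite rayV_expand.
    have -> : euler_gamma g * (r `^ (- (b + g)) *
       expR (0 - x * cos (nu * (pi / 2)) * r `^ nu) *
       sin (s * r - x * sin (nu * (pi / 2)) * r `^ nu + (1 - (b + g)) * (pi / 2))) =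
       B r * (r `^ (- g) * euler_gamma g * sin (P r - g * (pi / 2))).
      have -> : - (b + g) = - b + - g by ring.
      rewrite powRD ?(gt_eqF r0) ?implybT// /B /P.
      rewrite (_ : _ + (1 + (- b - g)) * (pi / 2) = s * r - x * sin (nu * (pi / 2)) * r `^ nu +
        (1 - b) * (pi / 2) - g * (pi / 2)); last by ring.
      by ring.
    apply: cvgM; first exact: cvg_cst.
    have cp : {for r, continuous (fun y : R => y `^ (- g))}.
      exact: is_derive1_continuous (is_derive1_powR (- g) r0).
    have H : (e / cos (atan (r / e))) `^ (- g) * euler_gamma g *
        sin (P r - g * atan (r / e)) @[e --> (0:R)^'+] -->
        r `^ (- g) * euler_gamma g * sin (P r - g * (pi / 2)).
      apply: cvgM.
        apply: cvgM; last exact: cvg_cst.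
        exact: (cvg_comp _ _ (cvg_polar r0) cp).
      apply: (cvg_cont (h := sin)); first exact: continuous_sin.
      apply: cvgB; first exact: cvg_cst.
      by apply: cvgM; [exact: cvg_cst|exact: cvg_atan_ratio].
    apply: cvg_trans H; apply: near_eq_cvg; near=> e.
    by rewrite IE//; near: e; exact: nbhs_right_gt.
rewrite /Axis.rayV /Ray.ray -RintegralZl//; last first.
  exact: (integrable_ray _ bg1 (decaying_V nu_gt0 nu_lt s x0 (lexx x))).
apply: (cvg_unique _ Hl); first exact: Rhausdorff.
apply: cvg_trans Hr; apply: near_eq_cvg; near=> e.
have e0 : 0 < e by near: e; exact: nbhs_right_gt.
exact/esym/(damped_integral nu_gt0 nu_lt s b1 g0 x0 e0).
Unshelve. all: by end_near. Qed.

End FractionalIntegral.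

(** * Concentration of the boundary kernel *)

Section ApproximateIdentity.
Context {R : realType} (nu : R) (nu_gt0 : 0 < nu) (nu_lt : nu < 2^-1).
Local Notation mu := (@lebesgue_measure R).
Local Notation Rp := (`]0%R, +oo[%classic : set R).
Implicit Types (b psi th x s r v C m q e y p g phi t : R).
Local Notation rayV := (rayV nu).
Local Notation rayL := (rayL nu).

Lemma integrable_subT (D : set R) (f : R -> R) : measurable D ->
  mu.-integrable setT (EFin \o f) -> mu.-integrable D (EFin \o f).
Proof. by move=> mD; apply: integrableS. Qed.

Lemma Rintegral_reflect (f : R -> R) t : mu.-integrable `]0, t[ (EFin \o f) ->
  (\int[mu]_(v in `]0, t[) f v)%R = (\int[mu]_(v in `]0, t[) f (t - v))%R.
Proof.
move=> fi; have N1 : (-1 : R) != 0 by rewrite oppr_eq0 oner_eq0.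
rewrite Rintegral_mkcond (Rintegral_affine t N1); last exact: integrable_restrictT.
rewrite normrN1 mul1r [RHS]Rintegral_mkcond; apply: eq_Rintegral => v _.
rewrite !patchE mulN1r addrC; congr (if _ then _ else _).
by apply/idP/idP; rewrite !inE/= !in_itv/= => /andP[? ?]; apply/andP; split; lra.
Qed.

(** Causality cuts the fractional integral off at the left of [sg]. *)
Lemma frac_rayV_local b g x t sg : b < 1 -> 0 < g -> b + g < 1 -> 0 < x -> 0 < t ->
  0 <= sg ->
  (\int[mu]_(u in `]0, t[) ((t - u) `^ (g - 1) * rayV b x (u - sg)))%R =
  euler_gamma g * rayV (b + g) x (t - sg).
Proof.
move=> b1 g0 bg1 x0 t0 sg0.
rewrite -(frac_rayV nu_gt0 nu_lt (t - sg) b1 g0 bg1 x0).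
have Rpt : `]0, t[%classic `<=` Rp by apply: subset_itvl; rewrite bnd_simp.
pose h v := v `^ (g - 1) * rayV b x (t - sg - v).
have ih := integrable_frac nu_gt0 nu_lt (t - sg) b1 g0 x0.
have iht : mu.-integrable `]0, t[ (EFin \o h) by apply: integrableS ih.
transitivity (\int[mu]_(v in `]0, t[) h v)%R.
  rewrite (Rintegral_reflect iht); apply: eq_Rintegral => u _.
  by rewrite /h; congr (_ * rayV _ _ _); ring.
rewrite [LHS]Rintegral_mkcond [RHS]Rintegral_mkcond; apply: eq_Rintegral => v _.
rewrite !patchE; have [vt|vt] := boolP (v \in `]0, t[%classic).
  by rewrite mem_set//; apply: Rpt; exact: set_mem.
case: ifPn => //; rewrite inE/= in_itv/= andbT => v0.
rewrite rayV_neg ?mulr0//; have [vt'|] := ltP v t; last lra.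
by case/negP: vt; rewrite inE/= in_itv/= v0.
Qed.

(** Up to the factor in front, [rayV 0 y] is [rayV 0 1] run with the time unit
    y^(1/nu). *)
Lemma rayV_selfsimilar y w : 0 < y -> 0 < w ->
  y `^ nu^-1 * rayV 0 y (y `^ nu^-1 * w) = rayV 0 1 w.
Proof.
move=> y0 w0; have a0 : 0 < y `^ nu^-1 by rewrite powR_gt0.
have aw : 0 < y `^ nu^-1 * w by rewrite mulr_gt0.
have l01 : (0:R) < 1 by [].
rewrite -!rayL_V ?(ltW aw) ?(ltW w0)//.
rewrite (rayL_scaling nu_gt0 nu_lt y (ltW l01) aw) (rayL_scaling nu_gt0 nu_lt 1 (ltW l01) w0).
have -> : y * (y `^ nu^-1 * w) `^ (- nu) = 1 * w `^ (- nu).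
  rewrite powRM ?(ltW a0) ?(ltW w0)// -powRrM mulrN mulVf ?gt_eqF//.
  by rewrite powR_inv1 ?(ltW y0)// mulrA divff ?gt_eqF.
rewrite sub0r !powR_inv1 ?(ltW aw) ?(ltW w0)// invfM !mulrA divff ?gt_eqF//.
by rewrite !mul1r.
Qed.

(** By self-similarity the kernel [rayV 0 y], of mass pi, lives on the time
    scale y^(1/nu) and concentrates at 0 with [y]. *)
Lemma rayV_approx_identity (h : R -> R) (l M : R) :
  measurable_fun setT h -> (forall s, 0 < s -> `|h s| <= M) ->
  h s @[s --> (0:R)^'+] --> l ->
  (\int[mu]_(s in Rp) (rayV 0 y s * h s))%R @[y --> (0:R)^'+] --> pi * l.
Proof.
move=> mh hM hl; have l01 : (0:R) < 1 by [].
have mV := measurable_rayV_s nu_gt0 nu_lt l01 l01.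
have i1 := integrable_rayV_unit nu_gt0 nu_lt.
have ib : mu.-integrable Rp (EFin \o (fun w => M * `|rayV 0 1 w|)).
  by apply: integrableZ_EFin => //; exact: integrable_norm.
have mah (a : R) : measurable_fun setT (fun w => rayV 0 1 w * h (a * w)).
  have ma : measurable_fun setT (fun w : R => a * w) by apply: measurable_funM.
  by apply: measurable_funM => //; exact: measurableT_comp mh ma.
have bah (a w : R) : 0 < a -> Rp w -> `|rayV 0 1 w * h (a * w)| <= M * `|rayV 0 1 w|.
  move=> a0; rewrite /= in_itv/= andbT => w0.
  by rewrite normrM mulrC ler_wpM2r// hM// mulr_gt0.
have E y : 0 < y -> (\int[mu]_(s in Rp) (rayV 0 y s * h s))%R =
    (\int[mu]_(w in Rp) (rayV 0 1 w * h (y `^ nu^-1 * w)))%R.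
  move=> y0; set a := y `^ nu^-1; have a0 : 0 < a by rewrite powR_gt0.
  have ia : mu.-integrable Rp (EFin \o (fun w => rayV 0 1 w * h (a * w))).
    apply: (bound_integrable (g := fun w => M * `|rayV 0 1 w|)) => //.
    - exact: measurable_funTS (mah a).
    - by move=> w; exact: bah.
  have ai : 0 < a^-1 by rewrite invr_gt0.
  have Es s : Rp s -> rayV 0 1 (a^-1 * s) * h (a * (a^-1 * s)) = a * (rayV 0 y s * h s).
    rewrite /= in_itv/= andbT => s0; rewrite mulrA divff ?gt_eqF// mul1r.
    by rewrite -(rayV_selfsimilar y0 (mulr_gt0 ai s0)) -/a mulrA divff ?gt_eqF// mul1r mulrA.
  rewrite (Rintegral_scale ai ia).
  have -> : (\int[mu]_(r in Rp) (rayV 0 1 (a^-1 * r) * h (a * (a^-1 * r))))%R =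
      (\int[mu]_(s in Rp) (a * (rayV 0 y s * h s)))%R.
    by apply: eq_Rintegral => s /set_mem; exact: Es.
  rewrite RintegralZl ?mulrA ?mulVf ?mul1r ?gt_eqF//.
  have /(integrable_subT (measurable_itv `]0, +oo[)) H :=
    integrable_affine 0 (lt0r_neq0 ai) (integrable_restrictT (measurable_itv _) ia).
  have := integrableZ_EFin a^-1 (measurable_itv _) H.
  apply: eq_integrable_EFin => // s Rs; rewrite addr0 patchE mem_set/=; last first.
    by move: Rs; rewrite /= !in_itv/= !andbT pmulr_rgt0.
  by rewrite Es// mulrA mulVf ?mul1r// gt_eqF.
rewrite -(Rintegral_rayV_unit nu_gt0 nu_lt) -RintegralZr//.
have H : (\int[mu]_(w in Rp) (rayV 0 1 w * h (y `^ nu^-1 * w)))%R @[y --> (0:R)^'+] -->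
    (\int[mu]_(w in Rp) (rayV 0 1 w * l))%R.
  apply: (@dominated_cvg_filter R _ _ Rp _ _ (fun w => M * `|rayV 0 1 w|)
    (@sequential_at_right R 0)) => //.
  - by apply: nearW => y; exact: measurable_funTS.
  - near=> y; have y0 : 0 < y by near: y; exact: nbhs_right_gt.
    by move=> w Rw; apply: bah => //; rewrite powR_gt0.
  - move=> w; rewrite /= in_itv/= andbT => w0; apply: cvgM; first exact: cvg_cst.
    apply/cvg_at_rightP => u [u0 ucv].
    have := (cvg_at_rightP _ _ _).1 hl (fun n => u n `^ nu^-1 * w); apply; split.
      by move=> n; rewrite mulr_gt0 ?powR_gt0//; exact: u0.
    rewrite -(mul0r w); apply: cvgM; last exact: cvg_cst.
    have ni : 0 < nu^-1 by rewrite invr_gt0.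
    by have := (cvg_at_rightP _ _ _).1 (powR_cvg0 ni) u; apply; split.
apply: cvg_trans H; apply: near_eq_cvg; near=> y.
by apply/esym/E; near: y; exact: nbhs_right_gt.
Unshelve. all: by end_near. Qed.

(** At x = 0 the integral is Euler integral, with the constant phase pi times
    an index. *)
Lemma rayL_zero g : 0 < g -> rayL (1 - g) 0 1 = euler_gamma g * sin (g * pi).
Proof.
move=> g0; rewrite /Axis.rayL /ray.
have := euler_gamma_scale g0 (@ltr01 R); rewrite powR1 mul1r => <-.
rewrite -RintegralZr//.
  apply: eq_Rintegral => r _; rewrite /ray_fun /ray_expo /ray_phase cospi sinpi.
  rewrite -[RHS]mulrA opprB; congr (_ * (expR _ * sin _)); ring.
have H : mu.-integrable Rp (EFin \o (fun r => r `^ (g - 1) * expR (- (1 * r `^ 1)))).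
  by apply: integrable_powR_expR; lra.
by apply: eq_integrable_EFin H => // r; rewrite /= in_itv/= andbT => r0; rewrite powRr1// ltW.
Qed.

Lemma sin_pi_sub (z : R) : sin (pi - z) = sin z.
Proof. by rewrite addrC sinDpi sinN opprK. Qed.

End ApproximateIdentity.

(** * The Gamma function *)

Section GammaFunction.
Context {R : realType}.
Local Notation mu := (@lebesgue_measure R).
Local Notation Rp := (`]0%R, +oo[%classic : set R).
Implicit Types (b psi th x s r v C m q e y p g phi t a z : R).

(** Away from time 0 the boundary kernel vanishes linearly in [y]. *)
Lemma rayV0_small (nu : R) : 0 < nu -> nu < 2^-1 -> exists K, 0 <= K /\
  forall y s, 0 < y -> 2^-1 <= s -> `|rayV nu 0 y s| <= K * y.
Proof.
move=> n0 n1; have [|K [K0 KE]] := @rayL_bounded R nu n0 n1 (1 - nu); first lra.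
exists (2 * (2^-1 `^ (- nu) * K)); split; first by rewrite !mulr_ge0// powR_ge0.
move=> y s y0 s2; have s0 : 0 < s by lra.
have b1 : 1 - nu <= 1 by lra.
have := rayL_euler n0 n1 y (lexx 1) s0.
rewrite subrr mul0r add0r (rayL_scaling n0 n1 y b1 s0) rayL_V ?(ltW s0)// => E.
rewrite (_ : 1 - nu - 1 = - nu) in E; last by ring.
have -> : rayV nu 0 y s = s^-1 * (nu * (s `^ (- nu) * rayL nu (1 - nu) (y * s `^ (- nu)) 1)) * y.
  rewrite -[LHS](mulKf (lt0r_neq0 s0)) E; ring.
rewrite normrM (gtr0_norm y0) ler_wpM2r ?(ltW y0)//.
rewrite !normrM (gtr0_norm (_ : 0 < s^-1)) ?invr_gt0// (gtr0_norm n0).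
rewrite (ger0_norm (powR_ge0 _ _)).
apply: ler_pM; rewrite ?invr_ge0 ?(ltW s0) ?mulr_ge0 ?powR_ge0 ?(ltW n0)//.
  by rewrite invf_ple ?posrE.
rewrite -[leRHS]mul1r; apply: ler_pM; rewrite ?mulr_ge0 ?powR_ge0 ?(ltW n0)//; first lra.
apply: ler_pM; rewrite ?powR_ge0//.
  rewrite !powRN lef_pV2 ?posrE ?powR_gt0//.
  by apply: ge0_ler_powR; rewrite ?nnegrE; lra.
by apply: KE; rewrite mulr_ge0 ?powR_ge0// ltW.
Qed.

(** Let y tend to 0 in the fractional integral at time 1 of the kernel [rayV 0
    y]. The kernel concentrates at time 0 with mass pi, where the weight is 1,
    so the limit is pi; by the index shift it is also Gamma(g) rayL g 0 1,
    which is explicit. *)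
Lemma euler_reflection g : 0 < g < 1 ->
  euler_gamma g * (euler_gamma (1 - g) * sin (g * pi)) = pi.
Proof.
(* Any index nu below 1/2 would do. *)
move=> /andP[g0 g1]; pose nu : R := 4^-1.
have n0 : 0 < nu by rewrite invr_gt0.
have n1 : nu < 2^-1 by rewrite ltf_pV2 ?posrE// ltr_nat.
have l01 : (0:R) < 1 by [].
pose f y v := v `^ (g - 1) * rayV nu 0 y (1 - v).
have iF y : 0 < y -> mu.-integrable Rp (EFin \o f y).
  by move=> y0; exact: integrable_frac.
(* The weight (1 - s)^(g - 1), cut at s = 1/2 to keep away from its
   singularity; the rest of the integral is negligible. *)
pose h s : R := ((fun s => (1 - s) `^ (g - 1)) \_ `]-oo, 2^-1]) s.
have hl : h s @[s --> (0:R)^'+] --> (1:R).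
  have c1 : (1 - s) `^ (g - 1) @[s --> (0:R)^'+] --> (1:R).
    rewrite -[X in _ --> X](_ : (1 - 0) `^ (g - 1) = 1); last by rewrite subr0 powR1.
    apply: (cvg_cont (h := fun z => z `^ (g - 1))).
      have p1 : 0 < 1 - 0 :> R by rewrite subr0.
      exact: is_derive1_continuous (is_derive1_powR (g - 1) p1).
    by apply: cvgB; [exact: cvg_cst|apply: cvg_at_right_filter; exact: cvg_id].
  apply: cvg_trans c1; apply: near_eq_cvg; near=> s.
  have s2 : s <= 2^-1 by near: s; apply: nbhs_right_le; rewrite invr_gt0.
  by rewrite /h patchE mem_set.
have mh : measurable_fun setT h.
  apply/(measurable_restrictT _ _).1 => //; apply: measurable_funTS.
  exact: (@measurable_reflect R (fun z => z `^ (g - 1)) 1 (measurable_powR _)).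
have hM s : 0 < s -> `|h s| <= 2^-1 `^ (g - 1).
  move=> s0; rewrite /h patchE; case: ifPn => [|_]; last by rewrite normr0 powR_ge0.
  rewrite inE/= in_itv/= => s2; rewrite ger0_norm ?powR_ge0//.
  rewrite (_ : g - 1 = - (1 - g)); last by ring.
  rewrite !powRN lef_pV2 ?posrE ?powR_gt0//; try lra.
  by apply: ge0_ler_powR; rewrite ?nnegrE; lra.
have lim2 := rayV_approx_identity n0 n1 mh hM hl.
have split_f y : 0 < y -> (\int[mu]_(v in Rp) f y v)%R =
    (\int[mu]_(v in `]0, 2^-1[) f y v)%R + (\int[mu]_(s in Rp) (rayV nu 0 y s * h s))%R.
  move=> y0.
  have RpU : Rp = `]0, 2^-1[ `|` `[2^-1, +oo[.
    apply/seteqP; split => v; rewrite /= !in_itv/= ?andbT.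
      by move=> v0; have [v2|v2] := ltP v 2^-1; [left; rewrite v0|right].
    move=> [/andP[]//|]; apply: lt_le_trans; by rewrite invr_gt0.
  rewrite RpU Rintegral_setU//; first last.
  - apply/disj_setPS => v [] /=; rewrite !in_itv/= andbT => /andP[_ v2].
    by rewrite leNgt v2.
  - by rewrite -RpU; exact: iF.
  congr (_ + _); rewrite -RpU.
  have i2 : mu.-integrable `[2^-1, +oo[ (EFin \o f y).
    by apply: integrableS (iF _ y0) => //; rewrite RpU; exact: subsetUr.
  have N1 : (-1 : R) != 0 by rewrite oppr_eq0 oner_eq0.
  rewrite [LHS]Rintegral_mkcond (Rintegral_affine 1 N1); last exact: integrable_restrictT.
  rewrite normrN1 mul1r [RHS]Rintegral_mkcond; apply: eq_Rintegral => s _.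
  rewrite !patchE /h patchE mulN1r addrC.
  have -> : (1 - s \in `[2^-1, +oo[%classic) = (s \in `]-oo, 2^-1]%classic).
    by apply/idP/idP; rewrite !inE/= !in_itv/=; lra.
  have [s2|s2] := boolP (s \in `]-oo, 2^-1]%classic); last by rewrite mulr0 if_same.
  rewrite /f (_ : 1 - (1 - s) = s); last by ring.
  case: ifPn => [_|]; first by rewrite mulrC.
  move=> /negP; rewrite inE/= in_itv/= andbT => /negP; rewrite -leNgt => s0.
  by rewrite rayV_neg ?mulr0.
have lim1 : (\int[mu]_(v in `]0, 2^-1[) f y v)%R @[y --> (0:R)^'+] --> (0:R).
  have [K [K0 KE]] := rayV0_small n0 n1.
  pose J : R := (\int[mu]_(v in `]0, 2^-1[) (v `^ (g - 1)))%R.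
  have iJ : mu.-integrable `]0, 2^-1[ (EFin \o (fun v : R => v `^ (g - 1))).
    by apply: integrable_powR_itv; rewrite ?invr_ge0//; lra.
  apply: (cvg_norm_le (k := fun y => K * y * J)); last first.
    rewrite [X in _ --> X](_ : 0 = K * 0 * J); last by ring.
    apply: cvgM; last exact: cvg_cst.
    by apply: cvgM; [exact: cvg_cst|apply: cvg_at_right_filter; exact: cvg_id].
  near=> y; have y0 : 0 < y by near: y; exact: nbhs_right_gt.
  rewrite /J -RintegralZl//; apply: norm_Rintegral_le => //.
  - have /integrableP[/measurable_EFinP mf _] := iF _ y0.
    by apply: measurable_funS mf => //; apply: subset_itvl; rewrite bnd_simp.
  - move=> v; rewrite /= in_itv/= => /andP[v0 v2].
    rewrite normrM ger0_norm ?powR_ge0// mulrC ler_wpM2r ?powR_ge0// KE//; lra.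
  - exact: integrableZ_EFin.
have limL : (\int[mu]_(v in Rp) f y v)%R @[y --> (0:R)^'+] --> pi.
  have H : (\int[mu]_(v in `]0, 2^-1[) f y v)%R +
      (\int[mu]_(s in Rp) (rayV nu 0 y s * h s))%R @[y --> (0:R)^'+] --> pi.
    rewrite [X in _ --> X](_ : pi = 0 + pi * 1); last by rewrite add0r mulr1.
    exact: cvgD.
  apply: cvg_trans H; apply: near_eq_cvg; near=> y.
  by apply/esym/split_f; near: y; exact: nbhs_right_gt.
have limR : (\int[mu]_(v in Rp) f y v)%R @[y --> (0:R)^'+] -->
    euler_gamma g * (euler_gamma (1 - g) * sin (g * pi)).
  have E : rayL nu g 0 1 = euler_gamma (1 - g) * sin (g * pi).
    rewrite {1}(_ : g = 1 - (1 - g)); last by ring.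
    rewrite rayL_zero//; last lra.
    by rewrite mulrBl mul1r sin_pi_sub.
  rewrite -E.
  have c0 : rayL nu g y 1 @[y --> (0:R)^'+] --> rayL nu g 0 1.
    apply: cvg_at_right_filter.
    exact: is_derive1_continuous (is_derive_rayL_x n0 n1 0 (ltW g1) l01).
  have H : euler_gamma g * rayL nu g y 1 @[y --> (0:R)^'+] --> euler_gamma g * rayL nu g 0 1.
    by apply: cvgM; [exact: cvg_cst|exact: c0].
  apply: cvg_trans H; apply: near_eq_cvg; near=> y.
  have y0 : 0 < y by near: y; exact: nbhs_right_gt.
  have g01 : 0 + g < 1 by rewrite add0r.
  by rewrite /f (frac_rayV n0 n1 1 l01 g0 g01 y0) add0r rayL_V.
exact: (cvg_unique (@Rhausdorff R) limR limL).
Unshelve. all: by end_near. Qed.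

End GammaFunction.

Section ReciprocalGamma.
Context {R : realType}.
Local Notation mu := (@lebesgue_measure R).
Local Notation Rp := (`]0%R, +oo[%classic : set R).
Implicit Types (b psi th x s r v C m q e y p g phi t a z c w : R).

Lemma euler_gammaS a : 0 < a -> euler_gamma (a + 1) = a * euler_gamma a.
Proof.
move=> a0; apply/eqP; rewrite -subr_eq0; apply/eqP.
have i (c : R) : -1 < c -> mu.-integrable Rp (EFin \o (fun r => r `^ c * expR (- r))).
  move=> c1; have := integrable_powR_expR c1 (@ltr01 R) (@ltr01 R).
  by apply: eq_integrable_EFin => // r; rewrite /= in_itv/= andbT => r0; rewrite mul1r powRr1// ltW.
have i1 : mu.-integrable Rp (EFin \o (fun r => r `^ (a + 1 - 1) * expR (- r))).
  by apply: i; lra.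
have i2 : mu.-integrable Rp (EFin \o (fun r => r `^ (a - 1) * expR (- r))).
  by apply: i; lra.
have ia2 := integrableZ_EFin a (measurable_itv `]0, +oo[) i2.
rewrite /euler_gamma -RintegralZl// -RintegralB//.
rewrite -[RHS](subrr 0).
have ends (F : set_system R) (FF : Filter F) : (\forall r \near F, 0 < r) ->
    r `^ a * expR (0 - 1 * r `^ 1) @[r --> F] --> (0:R) ->
    - (r `^ a * expR (- r)) @[r --> F] --> (0:R).
  move=> F0 H; rewrite -oppr0; apply: cvgN; apply: cvg_trans H; apply: near_eq_cvg.
  by apply: filterS F0 => r r0; rewrite sub0r mul1r powRr1// ltW.
apply: (@FTC_halfline R (fun r => - (r `^ a * expR (- r)))).
- move=> r r0; have d1 := is_derive1_powR a r0; apply: is_derive_eq.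
  by rewrite !scale_realE addrK; ring.
- move=> r r0; apply/differentiable_continuous/derivable1_diffP.
  have d1 := is_derive1_powR (a - 1) r0; have d2 := is_derive1_powR (a + 1 - 1) r0.
  exact: ex_derive.
- exact: integrableB_EFin.
- apply: ends; first exact: nbhs_right_gt.
  exact: powR_decay_cvg0.
- apply: ends; first exact: nbhs_pinfty_gt.
  exact: powR_decay_cvgy.
Qed.

Lemma euler_gamma_shift (n : nat) c : 0 < c ->
  euler_gamma (c + n%:R) = \prod_(i < n) (c + i%:R) * euler_gamma c.
Proof.
move=> c0; elim: n => [|n IH]; first by rewrite addr0 big_ord0 mul1r.
rewrite -natr1 addrA euler_gammaS; last by rewrite ltr_wpDr.
by rewrite IH big_ord_recr/= mulrA [_ * (c + n%:R)]mulrC.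
Qed.

Lemma sin_shift (n : nat) c : sin ((c + n%:R) * pi) = (-1) ^+ n * sin (c * pi) :> R.
Proof.
by rewrite mulrDl mulr_natl (alternatingn (@sinDpi R)).
Qed.

(** The coefficients of the Mainardi series, with the reciprocal of the Gamma
    function moved to the right half-line by reflection; at the poles the sine
    vanishes. *)
Lemma inv_Gamma a : 0 < a -> (Gamma (1 - a))^-1 = euler_gamma a * sin (a * pi) / pi.
Proof.
move=> a0; have p0 := pi_gt0 R; have pn0 : (pi : R) != 0 by rewrite gt_eqF.
have refl g : 0 < g < 1 -> (euler_gamma (1 - g))^-1 = euler_gamma g * sin (g * pi) / pi.
  move=> g01; have E := euler_reflection g01.
  have En : euler_gamma (1 - g) != 0.
    by apply: contra_neq pn0 => h; rewrite -E h mul0r mulr0.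
  rewrite -[in X in _ / X]E.
  have h : euler_gamma g * sin (g * pi) != 0.
    by apply: contra_neq pn0 => h; rewrite -E mulrCA mulrC h mul0r.
  by rewrite mulrCA invfM mulrCA divff ?mulr1.
rewrite /Gamma; have [a1|a1] := ltP 0 (1 - a); first by apply: refl; lra.
set n := _.+1; have nE : `|1 - a| = a - 1 by rewrite ler0_norm ?opprB.
have /andP[nl nu] : (Num.truncn (a - 1))%:R <= a - 1 < n%:R.
  by rewrite /n nE; apply: truncn_itv; lra.
have w0 : 0 < 1 - a + n%:R by lra.
have nS : (n%:R : R) = (Num.truncn (a - 1))%:R + 1 by rewrite /n nE natr1.
set w := 1 - a + n%:R in w0 *.
have aE : a = (1 - w) + n%:R by rewrite /w; ring.
(* The product in the continuation of Gamma is, in reverse order and up to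
   sign, the one in the functional equation of Gamma a. *)
have prodE : \prod_(i < n) (1 - a + i%:R) = (-1) ^+ n * \prod_(i < n) (1 - w + i%:R).
  rewrite -[n in (-1) ^+ n]card_ord -prodrN (reindex_inj rev_ord_inj)/=.
  apply: eq_bigr => i _; rewrite natrB; last exact: ltn_ord.
  by rewrite /w -natr1; ring.
rewrite prodE invf_div.
have [w1|w1] := ltP w 1; last first.
  have {}w1 : 1 - w = 0 by rewrite /w; move: w1; rewrite /w; lra.
  have pz : \prod_(i < n) (1 - w + i%:R) = 0.
    by rewrite (bigD1 ord0)//= w1 addr0 mul0r.
  by rewrite pz mulr0 mul0r aE w1 sin_shift mul0r sin0 !mulr0 mul0r.
have w01 : 0 < 1 - w < 1 by lra.
have := refl _ w01; rewrite (_ : 1 - (1 - w) = w); last by ring.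
move=> ->; rewrite [in RHS]aE sin_shift euler_gamma_shift; last lra.
ring.
Qed.

End ReciprocalGamma.

(** * The Mainardi function *)

Section MainardiFunction.
Context {R : realType} (nu : R) (nu_gt0 : 0 < nu) (nu_lt : nu < 2^-1).
Local Notation mu := (@lebesgue_measure R).
Local Notation Rp := (`]0%R, +oo[%classic : set R).
Implicit Types (b psi th x s r v C m q e y p g phi t a z c w : R).
Local Notation rayL := (rayL nu).

Definition taylor_term x (k : nat) : R := (- x) ^+ k / k`!%:R.

Lemma is_derive_exprn (h : R -> R) (n : nat) x (dh : R) : is_derive x 1 h dh ->
  is_derive x 1 (fun x => h x ^+ n.+1) ((n.+1%:R * h x ^+ n) * dh).
Proof.
move=> d; have := @is_deriveX _ _ h n.+1 x 1 dh d.
by rewrite (_ : h ^+ n.+1 = fun x => h x ^+ n.+1)//; apply/funext => z; rewrite fctE.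
Qed.

Lemma is_derive_taylor_term x (k : nat) :
  is_derive x 1 (fun x => taylor_term x k.+1) (- taylor_term x k).
Proof.
have d1 : is_derive x 1 (fun x : R => - x) (-1) by apply: is_derive_eq.
have d2 := is_derive_exprn k d1.
have d3 := is_deriveM d2 (is_derive_cst ((k.+1)`!%:R^-1 : R) x 1).
rewrite [X in is_derive _ _ _ X](_ : _ = (- x) ^+ k.+1 *: 0 +
  (k.+1)`!%:R^-1 *: ((k.+1%:R * (- x) ^+ k) * -1)); first exact: d3.
rewrite !scale_realE mulr0 add0r.
rewrite /taylor_term factS natrM.
have k0 : (k`!%:R : R) != 0 by rewrite pnatr_eq0 -lt0n fact_gt0.
by field; rewrite k0 addrC natr1 pnatr_eq0.
Qed.

Lemma is_derive_taylor_sum (a : nat -> R) (n : nat) x :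
  is_derive x 1 (fun x => \sum_(k < n.+1) a k * taylor_term x k)
    (- \sum_(k < n) a k.+1 * taylor_term x k).
Proof.
elim: n => [|n IH].
  rewrite big_ord0 oppr0 (_ : (fun x => _) = cst (a 0%N)).
    exact: is_derive_cst.
  by apply/funext => z; rewrite big_ord1 /taylor_term expr0 fact0 divr1 mulr1.
rewrite (_ : (fun x => _) = (fun x => \sum_(k < n.+1) a k * taylor_term x k) +
    (fun x => a n.+1 * taylor_term x n.+1)); last first.
  by apply/funext => z; rewrite big_ord_recr.
have d := is_deriveZ (a n.+1) (is_derive_taylor_term x n).
have := is_deriveD IH d; rewrite [in X in _ -> X]big_ord_recr/= opprD.
by rewrite scale_realE mulrN.
Qed.

Lemma le_of_derive_le (G H dG dH : R -> R) :
  (forall x, is_derive x 1 G (dG x)) -> (forall x, is_derive x 1 H (dH x)) ->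
  (forall x, 0 <= x -> dG x <= dH x) -> G 0 <= H 0 ->
  forall x, 0 <= x -> G x <= H x.
Proof.
move=> dG1 dH1 GH GH0 x; rewrite le_eqVlt => /predU1P[<-//|x0].
have d y : is_derive y 1 (H - G) (dH y - dG y).
  by have h1 := dG1 y; have h2 := dH1 y; exact: is_deriveB.
have cr : {within `[0, x], continuous (H - G)}.
  by apply: derivable_within_continuous => y _; have [] := d y.
have [c cx E] := MVT x0 (fun y _ => d y) cr.
have c0 : 0 <= c by move: cx; rewrite in_itv/= => /andP[/ltW].
have : 0 <= (dH c - dG c) * (x - 0) by rewrite mulr_ge0 ?subr_ge0 ?GH// ltW.
by rewrite -E !fctE; lra.
Qed.

(** Taylor formula with a remainder controlled by the last derivative on the
    half-line only, by induction on the order: compare [F 0] minus its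
    polynomial with the bound through their derivatives. *)
Lemma taylor_remainder (n : nat) : forall (F : nat -> R -> R) (C : R),
  (forall k x, is_derive x 1 (F k) (- F k.+1 x)) ->
  (forall x, 0 <= x -> `|F n x| <= C) ->
  forall x, 0 <= x -> `|F 0%N x - \sum_(k < n) F k 0 * taylor_term x k| <= C * (x ^+ n / n`!%:R).
Proof.
elim: n => [F C _ FC x x0|n IH F C dF FC x x0].
  by rewrite big_ord0 subr0 expr0 fact0 divr1 mulr1 FC.
pose G x := F 0%N x - \sum_(k < n.+1) F k 0 * taylor_term x k.
pose dG x := - (F 1%N x - \sum_(k < n) F k.+1 0 * taylor_term x k).
have dGE y : is_derive y 1 G (dG y).
  have d1 := dF 0%N y; have d2 := is_derive_taylor_sum (F^~ 0) n y.
  have -> : dG y = - F 1%N y - - \sum_(k < n) F k.+1 0 * taylor_term y k.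
    by rewrite /dG; ring.
  exact: (is_deriveB d1 d2).
pose H x := C * (x ^+ n.+1 / (n.+1)`!%:R); pose dH x := C * (x ^+ n / n`!%:R).
have dHE y : is_derive y 1 H (dH y).
  have d1 := is_derive_exprn n (is_derive_id y 1).
  have d2 := is_deriveZ C (is_deriveM d1 (is_derive_cst ((n.+1)`!%:R^-1 : R) y 1)).
  rewrite [X in is_derive _ _ _ X](_ : _ = C *: (y ^+ n.+1 *: 0 +
    (n.+1)`!%:R^-1 *: ((n.+1%:R * y ^+ n) * 1))); first exact: d2.
  rewrite !scale_realE mulr0 add0r /dH factS natrM.
  have k0 : (n`!%:R : R) != 0 by rewrite pnatr_eq0 -lt0n fact_gt0.
  by field; rewrite k0 addrC natr1 pnatr_eq0.
have bd y : 0 <= y -> `|dG y| <= dH y.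
  move=> y0; rewrite normrN.
  by apply: (IH (fun k => F k.+1)) => // k z; exact: dF.
have G0 : G 0 = 0.
  rewrite /G big_ord_recl /taylor_term expr0 fact0 divr1 mulr1 big1 ?addr0 ?subrr//.
  by move=> i _; rewrite oppr0 expr0n/= mul0r mulr0.
have H0 : H 0 = 0 by rewrite /H expr0n/= mul0r mulr0.
have h1 : G x <= H x.
  apply: (le_of_derive_le dGE dHE _ _ x0); last by rewrite G0 H0.
  by move=> y y0; rewrite (le_trans (ler_norm _))// bd.
have h2 : (- G) x <= H x.
  have dNG y : is_derive y 1 (- G) (- dG y) by have d := dGE y; exact: is_deriveN.
  apply: (le_of_derive_le dNG dHE _ _ x0); last by rewrite fctE G0 H0 oppr0.
  by move=> y y0; rewrite (le_trans (ler_norm _))// normrN bd.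
by rewrite -/(G x) -/(H x) ler_norml h1 andbT lerNl.
Qed.

Lemma exp_coeff_le y (n : nat) : 0 <= y -> y ^+ n / n`!%:R <= expR y.
Proof.
move=> y0; apply: (@le_trans _ _ (series (exp_coeff y) n.+1)).
  rewrite /series/= big_nat_recr//= lerDr.
  by apply: sumr_ge0 => i _; exact: exp_coeff_ge0.
apply: nondecreasing_cvgn_le; last exact: is_cvg_series_exp_coeff.
apply/nondecreasing_seqP => k; rewrite /series/= big_nat_recr//= lerDl.
exact: exp_coeff_ge0.
Qed.

(** Under the integral the sequence is the general term of the exponential
    series of x r^nu, which tends to 0, dominated by its sum; the latter grows
    slower than e^r since nu < 1. *)
Lemma euler_gamma_growth x : 0 <= x ->
  euler_gamma (nu * n.+1%:R) * (x ^+ n / n`!%:R) @[n --> \oo] --> (0 : R).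
Proof.
move=> x0; have n0 := nu_gt0; have cL := cosL_gt0 nu_gt0 nu_lt.
have [C D] := decaying_L nu_gt0 nu_lt (x / cos (nu * pi)) (@ltr01 R).
have {}D : decaying nu C (1 / 2) 1 pi (- (x / cos (nu * pi))) 1.
  by apply: D => //; rewrite normrN ger0_norm// divr_ge0// ltW.
pose f n r := r `^ (nu - 1) * expR (- r) * ((x * r `^ nu) ^+ n / n`!%:R).
have ig (a : R) : 0 < a -> mu.-integrable Rp (EFin \o (fun r => r `^ (a - 1) * expR (- r))).
  move=> a0; have a1 : -1 < a - 1 by lra.
  have := integrable_powR_expR a1 (@ltr01 R) (@ltr01 R).
  by apply: eq_integrable_EFin => // r; rewrite /= in_itv/= andbT => r0; rewrite mul1r powRr1// ltW.
have E n : euler_gamma (nu * n.+1%:R) * (x ^+ n / n`!%:R) = (\int[mu]_(r in Rp) f n r)%R.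
  rewrite /euler_gamma -RintegralZr//; last by apply: ig; rewrite mulr_gt0.
  apply: eq_Rintegral => r; rewrite inE/= in_itv/= andbT => r0; rewrite /f.
  rewrite (_ : nu * n.+1%:R - 1 = (nu - 1) + nu * n%:R); last by rewrite -natr1; ring.
  rewrite powRD ?(gt_eqF r0) ?implybT// powRrM powR_mulrn ?powR_ge0// exprMn.
  by ring.
rewrite (_ : (fun n => _) = (fun n => \int[mu]_(r in Rp) f n r)%R); last exact/funext.
rewrite [X in _ --> X](_ : 0 = \int[mu]_(r in Rp) (cst 0 r))%R; last first.
  by rewrite /Rintegral integral0_eq.
apply: (@dominated_cvg_seq R Rp f (cst 0) (fun r => r `^ (nu - 1) * expR (C - 1 / 2 * r `^ 1)) _ _ _ _ _).2 => //.
- move=> n; apply: measurable_funTS; apply: measurable_funM.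
    apply: measurable_funM; first exact: measurable_powR.
    exact: measurableT_comp.
  have mxr : measurable_fun setT (fun r : R => x * r `^ nu).
    by apply: measurable_funM => //; exact: measurable_powR.
  apply: measurable_funM => //; exact: measurable_funX.
- move=> n r; rewrite /= in_itv/= andbT => r0.
  have xr0 : 0 <= x * r `^ nu by rewrite mulr_ge0 ?powR_ge0.
  rewrite /f ger0_norm; last by rewrite !mulr_ge0 ?powR_ge0 ?expR_ge0// exprn_ge0.
  rewrite -mulrA ler_wpM2l ?powR_ge0//.
  apply: (@le_trans _ _ (expR (- r) * expR (x * r `^ nu))).
    by rewrite ler_wpM2l ?expR_ge0// exp_coeff_le.
  rewrite -expRD ler_expR; have [_ _ /(_ _ r0)] := D; rewrite /ray_expo cospi.
  apply: le_trans; rewrite le_eqVlt; apply/orP; left; apply/eqP.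
  by field; rewrite gt_eqF.
- by apply: integrable_powR_decay; lra.
- move=> r _; rewrite /f -[X in _ --> X](mulr0 (r `^ (nu - 1) * expR (- r))).
  apply: cvgM; first exact: cvg_cst.
  have := cvg_exp_coeff (x * r `^ nu); apply: cvg_trans.
  by apply: near_eq_cvg; apply: nearW => n.
Qed.

(** The successive derivatives in x of [rayL (1 - nu) x 1] are its relatives
    of index 1 - nu (k + 1), whose values at 0 are pi / Gamma(1 - nu (k + 1))
    by reflection: the Mainardi series is its Taylor series, and the remainder
    tends to 0. *)
Theorem mainardi_ray z : 0 <= z -> mainardi nu z = rayL (1 - nu) z 1 / pi.
Proof.
move=> z0; have n0 := nu_gt0; have n1 := nu_lt.
have pn0 : (pi : R) != 0 by rewrite gt_eqF// pi_gt0.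
pose F (k : nat) x := rayL (1 - nu * k.+1%:R) x 1.
have ak (k : nat) : 0 < nu * k.+1%:R by rewrite mulr_gt0.
have dF k x : is_derive x 1 (F k) (- F k.+1 x).
  have b1 : 1 - nu * k.+1%:R <= 1 by have := ak k; lra.
  have := is_derive_rayL_x nu_gt0 nu_lt x b1 (@ltr01 R).
  by rewrite (_ : 1 - nu * k.+1%:R - nu = 1 - nu * k.+2%:R)// -(natr1 k.+1); ring.
have bF n x : 0 <= x -> `|F n x| <= euler_gamma (nu * n.+1%:R).
  move=> x0; have := euler_gamma_scale (ak n) (@ltr01 R).
  rewrite powR1 mul1r => <-; apply: norm_Rintegral_le => //.
  - exact: measurable_funTS (measurable_ray_fun _ _ _ _ _ _).
  - move=> r; rewrite /= in_itv/= andbT => r0.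
    have := ray_fun_le (1 - nu * n.+1%:R) 0 (decaying_L0 nu_gt0 nu_lt (@ltr01 R) (lexx 1) x0) r0.
    by rewrite opprB powRr1 ?(ltW r0)// sub0r.
  - have a1 : -1 < nu * n.+1%:R - 1 by have := ak n; lra.
    have := integrable_powR_expR a1 (@ltr01 R) (@ltr01 R).
    by apply: eq_integrable_EFin => // r; rewrite /= in_itv/= andbT => r0; rewrite powRr1// ltW.
have coefE k : (k`!%:R * Gamma (- nu * k%:R + 1 - nu))^-1 = F k 0 / pi / k`!%:R.
  rewrite (_ : - nu * k%:R + 1 - nu = 1 - nu * k.+1%:R); last by rewrite -natr1; ring.
  by rewrite invfM inv_Gamma// /F rayL_zero// mulrC.
have sumE n : pseries (fun k => (k`!%:R * Gamma (- nu * k%:R + 1 - nu))^-1) (- z) n =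
    (\sum_(k < n) F k 0 * taylor_term z k) / pi.
  rewrite /pseries /series/= big_mkord mulr_suml; apply: eq_bigr => k _.
  by rewrite coefE /taylor_term; ring.
rewrite /mainardi; apply/cvg_lim => //.
rewrite (_ : pseries _ _ = fun n => (\sum_(k < n) F k 0 * taylor_term z k) / pi); last exact/funext.
apply: cvgM; last exact: cvg_cst.
have -> : rayL (1 - nu) z 1 = F 0%N z by rewrite /F mulr1.
apply/subr_cvg0; apply: cvg_norm_le (euler_gamma_growth z0).
by apply: nearW => n; rewrite distrC; apply: taylor_remainder => //; exact: bF.
Qed.

End MainardiFunction.

(** * Truncated time integrals *)

Section TruncatedIntegrals.
Context {R : realType}.
Local Notation mu := (@lebesgue_measure R).
Local Notation Rp := (`]0%R, +oo[%classic : set R).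
Implicit Types (c e t : R) (f : R -> R).

Lemma measurable_powR_sub c t : measurable_fun setT (fun tau : R => (t - tau) `^ c).
Proof. by apply: (measurable_reflect (f := fun u => u `^ c)); exact: measurable_powR. Qed.

Lemma integrable_powR_sub c e t : -1 < c -> 0 <= e < t ->
  mu.-integrable `]e, t[ (EFin \o (fun tau => (t - tau) `^ c)).
Proof.
move=> c1 /andP[e0 et]; have N1 : (-1 : R) != 0 by rewrite oppr_eq0 oner_eq0.
have t0 : 0 <= t by lra.
have := integrable_affine t N1 (integrable_restrictT (measurable_itv _) (integrable_powR_itv c1 t0)).
move=> /(integrable_subT (measurable_itv `]e, t[)); apply: eq_integrable_EFin => // x.
rewrite /= in_itv/= => /andP[ex xt]; rewrite patchE mem_set/=; last first.
  by rewrite in_itv/=; apply/andP; split; lra.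
by congr (_ `^ _); ring.
Qed.

Lemma is_derive_powR_sub c t tau : tau < t ->
  is_derive tau 1 (fun tau => (t - tau) `^ c) (- c * (t - tau) `^ (c - 1)).
Proof.
move=> tt; have t0 : 0 < t - tau by lra.
have d1 : is_derive tau (1:R) (fun tau : R => t - tau) (-1).
  by apply: is_derive_eq; rewrite add0r mul1r.
have := @is_derive1_comp _ (fun u => u `^ c) (fun tau => t - tau) _ _ _
  (is_derive1_powR c t0) d1.
by rewrite mulrN1 mulNr.
Qed.

Lemma Rintegral_split f e t : 0 < e < t -> mu.-integrable `]0, t[ (EFin \o f) ->
  (\int[mu]_(tau in `]0, t[) f tau =
   \int[mu]_(tau in `]0, e[) f tau + \int[mu]_(tau in `]e, t[) f tau)%R.
Proof.
move=> /andP[e0 et] fi; rewrite (Rintegral_setD1 e)//.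
have E : `]0, t[ `\ e = `]0, e[ `|` `]e, t[%classic.
  apply/seteqP; split => x /=; rewrite !in_itv/=.
    move=> [/andP[x0 xt] /eqP xe]; move: xe; rewrite neq_lt => /orP[]xe; [left|right].
      by rewrite x0.
    by rewrite xe.
  move=> [|] /andP[a b]; (split; first by apply/andP; split; lra); apply/eqP.
    by rewrite lt_eqF.
  by rewrite gt_eqF.
rewrite E Rintegral_setU//.
  rewrite -E; apply: integrableS fi => //; exact: measurableD.
apply/disj_setPS => x [] /=; rewrite !in_itv/= => /andP[? ?] /andP[? ?].
lra.
Qed.

(** Dominated convergence of the restrictions to ]0, e[. *)
Lemma Rintegral_initial_cvg0 f t : 0 < t -> mu.-integrable `]0, t[ (EFin \o f) ->
  (\int[mu]_(tau in `]0, e[) f tau)%R @[e --> (0:R)^'+] --> (0 : R).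
Proof.
move=> t0 fi.
have it := integrable_restrictT (measurable_itv _) fi.
have H : (\int[mu]_(tau in setT) (f \_ `]0, e[) tau)%R @[e --> (0:R)^'+] -->
    (\int[mu]_(tau in (setT : set R)) 0)%R.
  apply: (@dominated_cvg_filter R _ _ setT (fun e => f \_ `]0%R, e[) (fun=> 0)
    (fun x => `|(f \_ `]0, t[) x|)
     (@sequential_at_right R 0)) => //.
  - near=> e; suff ie : mu.-integrable `]0, e[ (EFin \o f).
      have H := measurable_int mu (integrable_restrictT (measurable_itv _) ie).
      by apply/measurable_EFinP; exact: H.
    apply: (integrableS _ _ _ fi) => //.
    by apply: subset_itvl; rewrite bnd_simp; apply: ltW; near: e; exact: nbhs_right_lt.
  - near=> e; move=> x _; rewrite !patchE.
    have et : e <= t by apply: ltW; near: e; exact: nbhs_right_lt.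
    case: ifPn => [|_]; last by rewrite normr0.
    by rewrite inE/= in_itv/= => /andP[? ?]; rewrite mem_set//= in_itv/=; apply/andP; split; lra.
  - exact: integrable_norm.
  - move=> x _; apply: cvg_near_cst; have [x0|x0] := ltP 0 x; near=> e.
      rewrite patchE memNset//= in_itv/=; apply/negP/nandP; right; rewrite -leNgt.
      by apply: ltW; near: e; exact: nbhs_right_lt.
    by rewrite patchE memNset//= in_itv/= ltNge x0.
have E : (\int[mu]_(tau in (setT : set R)) 0)%R = 0 by rewrite /Rintegral integral0_eq.
rewrite E in H.
apply: cvg_trans H; apply: near_eq_cvg; near=> e.
by rewrite [RHS]Rintegral_mkcond.
Unshelve. all: by end_near. Qed.

Lemma Rintegral_truncated_cvg f t : 0 < t -> mu.-integrable `]0, t[ (EFin \o f) ->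
  (\int[mu]_(tau in `]e, t[) f tau)%R @[e --> (0:R)^'+] -->
  (\int[mu]_(tau in `]0, t[) f tau)%R.
Proof.
move=> t0 fi; rewrite -[X in _ --> X]subr0.
have H : (\int[mu]_(tau in `]0, t[) f tau)%R - (\int[mu]_(tau in `]0, e[) f tau)%R
    @[e --> (0:R)^'+] --> (\int[mu]_(tau in `]0, t[) f tau)%R - 0.
  by apply: cvgB; [exact: cvg_cst|exact: Rintegral_initial_cvg0 fi].
apply: cvg_trans H; apply: near_eq_cvg; near=> e.
have e0t : 0 < e < t.
  by apply/andP; split; near: e; [exact: nbhs_right_gt|exact: nbhs_right_lt].
by rewrite (Rintegral_split e0t fi) [X in X - _]addrC addrK.
Unshelve. all: by end_near. Qed.

End TruncatedIntegrals.

(** * The initial term as a function of time *)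

Section InitialTermInTime.
Context {R : realType} (nu : R) (nu_gt0 : 0 < nu) (nu_lt : nu < 2^-1).
Local Notation mu := (@lebesgue_measure R).
Local Notation Rp := (`]0%R, +oo[%classic : set R).
Implicit Types (b x s r v C K y t w e : R).
Local Notation rayV := (rayV nu).
Local Notation rayL := (rayL nu).
Variables (m : R -> R) (M m0 : R).
Hypotheses (mm : measurable_fun setT m) (mM : forall w, `|m w| <= M).

(** Decay enough to integrate over the half-line against bounded data. *)
Definition decays_at1 b := exists K, 0 <= K /\
  forall y, 0 <= y -> `|rayL b y 1| <= K * (1 + y ^+ 2)^-1.

(** With [b = 1 - nu] and [m] the sum of the data at distance proportional to
    [w] on both sides of a point, this is 2 pi times the initial term. The
    other indices give its derivatives, ordinary and fractional. *)
Definition heat b t := (\int[mu]_(w in Rp) (rayL b w t * m w))%R.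

Lemma M_ge0 : 0 <= M. Proof. exact: le_trans (normr_ge0 _) (mM 0). Qed.

Lemma invsqr_gt0 y : 0 < (1 + y ^+ 2)^-1.
Proof. by rewrite invr_gt0 ltr_pwDl// sqr_ge0. Qed.

Lemma heat_integrand_le b S : 0 < S -> b <= 1 -> decays_at1 b ->
  exists K, 0 <= K /\ forall w t, 0 < w -> 0 < t <= S ->
    `|rayL b w t * m w| <= K * t `^ (b - 1) * (1 + w ^+ 2)^-1.
Proof.
move=> S0 b1 db; have [K [K0 KE]] := rayL_bound nu_gt0 nu_lt S0 b1 db.
exists (K * M); split; first by rewrite mulr_ge0// M_ge0.
move=> w t w0 tS; rewrite normrM.
rewrite [leRHS](_ : _ = K * t `^ (b - 1) * (1 + w ^+ 2)^-1 * M); last by ring.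
by apply: ler_pM => //; apply: KE => //; exact: ltW.
Qed.

Lemma measurable_heat_integrand b t : b <= 1 -> 0 < t ->
  measurable_fun setT (fun w => rayL b w t * m w).
Proof. by move=> b1 t0; apply: measurable_funM => //; exact: measurable_rayL_x. Qed.

Lemma integrable_heat b t : 0 < t -> b <= 1 -> decays_at1 b ->
  mu.-integrable Rp (EFin \o (fun w => rayL b w t * m w)).
Proof.
move=> t0 b1 db; have [K [K0 KE]] := heat_integrand_le t0 b1 db.
apply: (bound_integrable (g := fun w => K * t `^ (b - 1) * (1 + w ^+ 2)^-1)) => //.
- by apply: measurable_funTS; exact: measurable_heat_integrand.
- by move=> w; rewrite /= in_itv/= andbT => w0; apply: KE; rewrite ?t0 ?lexx.
- by apply: integrableZ_EFin => //; exact: integrable_invsqr.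
Qed.

Lemma is_derive_heat b t : 0 < t -> b <= 1 -> decays_at1 b -> decays_at1 (b - 1) ->
  is_derive t 1 (heat b) (heat (b - 1) t).
Proof.
move=> t0 b1 db db1; have t20 : 0 < t / 2 by lra.
have S0 : 0 < 2 * t by lra.
have b11 : b - 1 <= 1 by lra.
have [K [K0 KE]] := heat_integrand_le S0 b11 db1.
have near_t t' : `|t' - t| < t / 2 -> t / 2 <= t' /\ t' <= 2 * t.
  by rewrite ltr_norml => /andP[? ?]; split; lra.
have d t' w : `|t' - t| < t / 2 -> Rp w ->
    is_derive t' 1 (fun t' => rayL b w t' * m w) (rayL (b - 1) w t' * m w).
  move=> /near_t[tt _] _; have t'0 : 0 < t' by lra.
  have H := is_derive_rayL_s nu_gt0 nu_lt w b1 t'0.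
  by apply: is_derive_eq; rewrite !scale_realE mulr0 add0r mulrC.
apply: (is_derive_under_integral_bound _ t20 (k := fun t' w => rayL b w t' * m w)
  (dk := fun t' w => rayL (b - 1) w t' * m w)
  (b := fun w => K * (t / 2) `^ (b - 1 - 1) * (1 + w ^+ 2)^-1)) => //.
- move=> t' /near_t[tt _]; apply: measurable_funTS.
  by apply: measurable_heat_integrand => //; lra.
- exact: integrable_heat.
- move=> t' w /near_t[tt tS]; rewrite /= in_itv/= andbT => w0.
  apply: (le_trans (KE _ _ w0 _)); first by apply/andP; split; lra.
  rewrite ler_wpM2r ?(ltW (invsqr_gt0 _))// ler_wpM2l//.
  rewrite (_ : b - 1 - 1 = - (2 - b)); last by ring.
  rewrite !powRN lef_pV2 ?posrE ?powR_gt0//; try lra.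
  by apply: ge0_ler_powR; rewrite ?nnegrE; lra.
- by apply: integrableZ_EFin => //; exact: integrable_invsqr.
Qed.

Lemma is_derive_heat_N t : 0 < t -> is_derive t 1 (heat (1 - nu)) (heat (- nu) t).
Proof.
move=> t0; have n0 := nu_gt0; have n1 := nu_lt.
have E : 1 - nu - 1 = - nu by ring.
suff : is_derive t 1 (heat (1 - nu)) (heat (1 - nu - 1) t) by rewrite E.
apply: is_derive_heat => //; first lra.
  exact: rayL_bound_N.
by apply: (rayL_bound0 nu_gt0 nu_lt); lra.
Qed.

Lemma continuous_heat_dt t : 0 < t -> {for t, continuous (heat (- nu))}.
Proof.
move=> t0; have n0 := nu_gt0; have n1 := nu_lt.
apply: (is_derive1_continuous (is_derive_heat t0 _ _ _)); first lra.
  by apply: (rayL_bound0 nu_gt0 nu_lt); lra.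
by apply: (rayL_bound0 nu_gt0 nu_lt); lra.
Qed.

Let bN : 1 - nu < 1. Proof. by have n0 := nu_gt0; lra. Qed.

Lemma mass_integrand_le : exists K, 0 <= K /\ forall w, Rp w -> forall a,
  `|rayL (1 - nu) w 1 * m (a * w)| <= K * M * (1 + w ^+ 2)^-1.
Proof.
have [K [K0 KE]] := rayL_bound_N nu_gt0 nu_lt.
exists K; split => // w; rewrite /= in_itv/= andbT => w0 a; rewrite normrM mulrAC.
by apply: ler_pM => //; exact: KE (ltW w0).
Qed.

Lemma measurable_mass_integrand (a : R) :
  measurable_fun setT (fun w => rayL (1 - nu) w 1 * m (a * w)).
Proof.
apply: measurable_funM; first exact: measurable_rayL_x (ltW bN) ltr01.
by apply: measurableT_comp mm _; exact: measurable_funM.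
Qed.

(** Fixing the kernel at time 1 and rescaling the data makes the limit at time
    0 a matter of dominated convergence. *)
Lemma heat_scaling t : 0 < t ->
  heat (1 - nu) t = (\int[mu]_(w in Rp) (rayL (1 - nu) w 1 * m (t `^ nu * w)))%R.
Proof.
move=> t0; have n0 := nu_gt0; have n1 := nu_lt.
have tn : 0 < t `^ nu by rewrite powR_gt0.
have [K [K0 KE]] := mass_integrand_le.
rewrite /heat (Rintegral_scale tn); last first.
  by apply: integrable_heat => //; [exact: ltW bN|exact: rayL_bound_N].
have -> : (\int[mu]_(w in Rp) (rayL (1 - nu) (t `^ nu * w) t * m (t `^ nu * w)))%R =
    (\int[mu]_(w in Rp) ((t `^ nu)^-1 * (rayL (1 - nu) w 1 * m (t `^ nu * w))))%R.
  apply: eq_Rintegral => w _; rewrite (rayL_scaling nu_gt0 nu_lt _ (ltW bN) t0) mulrA.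
  have -> : 1 - nu - 1 = - nu by ring.
  have -> : t `^ nu * w * t `^ (- nu) = w by rewrite powRN mulrAC divff ?mul1r ?gt_eqF.
  by rewrite powRN.
rewrite RintegralZl//; first by rewrite mulrA divff ?mul1r ?gt_eqF.
apply: (bound_integrable (g := fun w => K * M * (1 + w ^+ 2)^-1)) => //.
- by apply: measurable_funTS; exact: measurable_mass_integrand.
- by move=> w Rw; exact: KE.
- by apply: integrableZ_EFin => //; exact: integrable_invsqr.
Qed.

(** The kernel, of mass pi, concentrates at w = 0. *)
Lemma heat_cvg0 : m w @[w --> (0:R)^'+] --> m0 ->
  heat (1 - nu) t @[t --> (0:R)^'+] --> pi * m0.
Proof.
move=> mw; have [K [K0 KE]] := mass_integrand_le.
have iN : mu.-integrable Rp (EFin \o (fun w => rayL (1 - nu) w 1)).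
  have [C [C0 CE]] := rayL_bound_N nu_gt0 nu_lt.
  apply: (bound_integrable (g := fun w => C * (1 + w ^+ 2)^-1)) => //.
  - by apply: measurable_funTS; exact: measurable_rayL_x (ltW bN) ltr01.
  - by move=> w; rewrite /= in_itv/= andbT => /ltW; exact: CE.
  - by apply: integrableZ_EFin => //; exact: integrable_invsqr.
rewrite -(Rintegral_rayL_N nu_gt0 nu_lt) -RintegralZr//.
have H : (\int[mu]_(w in Rp) (rayL (1 - nu) w 1 * m (t `^ nu * w)))%R @[t --> (0:R)^'+]
    --> (\int[mu]_(w in Rp) (rayL (1 - nu) w 1 * m0))%R.
  apply: (@dominated_cvg_filter R _ _ Rp _ _ (fun w => K * M * (1 + w ^+ 2)^-1)
     (@sequential_at_right R 0)) => //.
  - by apply: nearW => t; apply: measurable_funTS; exact: measurable_mass_integrand.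
  - by apply: nearW => t w Rw; exact: KE.
  - by apply: integrableZ_EFin => //; exact: integrable_invsqr.
  - move=> w; rewrite /= in_itv/= andbT => w0; apply: cvgM; first exact: cvg_cst.
    apply/cvg_at_rightP => u [u0 ucv].
    have := (cvg_at_rightP _ _ _).1 mw (fun n => u n `^ nu * w); apply; split.
      by move=> n; rewrite mulr_gt0 ?powR_gt0//; exact: u0.
    rewrite -(mul0r w); apply: cvgM; last exact: cvg_cst.
    by have := (cvg_at_rightP _ _ _).1 (powR_cvg0 nu_gt0) u; apply; split.
apply: cvg_trans H; apply: near_eq_cvg; near=> t.
by apply/esym/heat_scaling; near: t; exact: nbhs_right_gt.
Unshelve. all: by end_near. Qed.

(** What integration by parts leaves on ]0, e[, where the time derivative of
    the kernel is not absolutely integrable uniformly in [w]. *)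
Definition rest e w t := (\int[mu]_(tau in `]0%R, e[)
  (2 * nu * (t - tau) `^ (- (2 * nu) - 1) * rayL (1 - nu) w tau))%R.

(** For w > 0 the integral over the whole ]0, t[ is the index shift of
    [frac_rayV_local]. From it the part over ]0, e[ is removed, after an
    integration by parts which moves the derivative from the kernel to the
    smooth weight: the kernel vanishes at time 0 and leaves a boundary term at
    [e] only. *)
Lemma truncated_kernel e w t : 0 < e < t -> 0 < w ->
  (\int[mu]_(tau in `]e, t[) ((t - tau) `^ (- (2 * nu)) * rayL (- nu) w tau))%R =
  euler_gamma (1 - 2 * nu) * rayL (1 - 3 * nu) w t
  - (t - e) `^ (- (2 * nu)) * rayL (1 - nu) w e + rest e w t.
Proof.
have balance (I I1 I2 A P : R) : I2 + I1 = P -> A = I1 + I -> I = A - P + I2 by lra.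
move=> /andP[e0 et] w0; have n0 := nu_gt0; have n1 := nu_lt; have b2 := bN.
have t0 : 0 < t by lra.
have b1 : - nu < 1 by lra.
(* The vertical ray is used because it is differentiable across time 0. *)
pose F tau := (t - tau) `^ (- (2 * nu)) * rayV (1 - nu) w tau.
pose f1 tau := (t - tau) `^ (- (2 * nu)) * rayV (- nu) w tau.
pose f2 tau := 2 * nu * (t - tau) `^ (- (2 * nu) - 1) * rayV (1 - nu) w tau.
have [K [K0 KE]] := rayV_bound nu_gt0 nu_lt b1 w0.
have i1 : mu.-integrable `]0, t[ (EFin \o f1).
  apply: (bound_integrable (g := fun tau => K * (t - tau) `^ (- (2 * nu)))) => //.
  - apply: measurable_funTS; apply: measurable_funM; first exact: measurable_powR_sub.
    exact: measurable_rayV_s.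
  - by move=> x _; rewrite normrM mulrC (ger0_norm (powR_ge0 _ _)) ler_wpM2r ?powR_ge0// KE.
  - by apply: integrableZ_EFin => //; apply: integrable_powR_sub; [lra|rewrite lexx].
have dF tau : tau < t -> is_derive tau 1 F (f2 tau + f1 tau).
  move=> tt; have dV := is_derive_rayV_s nu_gt0 nu_lt tau (ltW bN) w0.
  have dp := is_derive_powR_sub (- (2 * nu)) tt.
  apply: is_derive_eq; rewrite !scale_realE /f1 /f2 /=.
  by rewrite (_ : 1 - nu - 1 = - nu); ring.
have cp c tau : tau < t -> {for tau, continuous (fun tau => (t - tau) `^ c)}.
  by move=> tt; exact: is_derive1_continuous (is_derive_powR_sub c tt).
have cV b tau : b < 1 -> {for tau, continuous (rayV b w)}.
  by move=> b'; exact: is_derive1_continuous (is_derive_rayV_s nu_gt0 nu_lt tau (ltW b') w0).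
have c1 tau : tau < t -> {for tau, continuous f1}.
  by move=> tt; apply: cvgM; [exact: cp|exact: cV].
have c2 tau : tau < t -> {for tau, continuous f2}.
  move=> tt; apply: cvgM; last exact: cV.
  by apply: cvgM; [exact: cvg_cst|exact: cp].
have [||c12 parts] := @FTC2_oo R F (fun x => f2 x + f1 x) 0 e e0.
- by move=> x /andP[_ xe]; apply: dF; lra.
- by move=> x /andP[_ xe]; apply: cvgD; [apply: c2; lra|apply: c1; lra].
have i1e : mu.-integrable `]0, e[ (EFin \o f1).
  by apply: (integrableS _ _ _ i1) => //; apply: subset_itvl; rewrite bnd_simp ltW.
have i2e : mu.-integrable `]0, e[ (EFin \o f2).
  have := integrableB_EFin (measurable_itv _) c12 i1e.
  by apply: eq_integrable_EFin => // x _; rewrite addrK.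
have L_V b tau : b < 1 -> 0 < tau -> rayL b w tau = rayV b w tau.
  by move=> b' tau0; apply: (rayL_V nu_gt0 nu_lt) => //; exact: ltW.
have -> : (\int[mu]_(tau in `]e, t[) ((t - tau) `^ (- (2 * nu)) * rayL (- nu) w tau))%R =
    (\int[mu]_(tau in `]e, t[) f1 tau)%R.
  apply: eq_Rintegral => tau; rewrite inE/= in_itv/= => /andP[etau _].
  have tau0 : 0 < tau by lra.
  by rewrite (L_V _ _ b1 tau0).
have restE : rest e w t = (\int[mu]_(tau in `]0, e[) f2 tau)%R.
  apply: eq_Rintegral => tau; rewrite inE/= in_itv/= => /andP[tau0 _].
  by rewrite (L_V _ _ bN tau0).
have full : (\int[mu]_(tau in `]0, t[) f1 tau)%R =
    euler_gamma (1 - 2 * nu) * rayL (1 - 3 * nu) w t.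
  have g0 : 0 < 1 - 2 * nu by lra.
  have bg : - nu + (1 - 2 * nu) < 1 by lra.
  have := frac_rayV_local nu_gt0 nu_lt b1 g0 bg w0 t0 (lexx 0).
  rewrite subr0 (_ : - nu + (1 - 2 * nu) = 1 - 3 * nu); last by ring.
  have b3 : 1 - 3 * nu < 1 by lra.
  rewrite (L_V _ _ b3 t0) => <-; apply: eq_Rintegral => u _; rewrite subr0 /f1.
  by rewrite (_ : 1 - 2 * nu - 1 = - (2 * nu)); last by ring.
have e0t : 0 < e < t by rewrite e0.
have sp := Rintegral_split e0t i1; rewrite full in sp.
have F0 : F 0 = 0 by rewrite /F (rayV_neg nu_gt0 nu_lt bN w0 (lexx 0)) mulr0.
have D : (\int[mu]_(x in `]0, e[) (f2 x + f1 x))%R =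
    (\int[mu]_(x in `]0, e[) f2 x)%R + (\int[mu]_(x in `]0, e[) f1 x)%R.
  by apply: RintegralD.
rewrite D F0 subr0 in parts.
rewrite restE (L_V _ _ bN e0); exact: balance parts sp.
Qed.

(** For [e] below t / 2 the weight stays away from its singularity at [t]. *)
Lemma rest_le t : 0 < t -> exists C, 0 <= C /\ forall e w, 0 < e <= t / 2 -> 0 <= w ->
  (forall tau, 0 < tau < e ->
    `|2 * nu * (t - tau) `^ (- (2 * nu) - 1) * rayL (1 - nu) w tau| <=
    C * (1 + w ^+ 2)^-1 * tau `^ (- nu)) .
Proof.
move=> t0; have n0 := nu_gt0; have n1 := nu_lt.
have [K [K0 KE]] := rayL_bound nu_gt0 nu_lt t0 (ltW bN) (rayL_bound_N nu_gt0 nu_lt).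
exists (2 * nu * (t / 2) `^ (- (2 * nu) - 1) * K); split.
  by rewrite !mulr_ge0 ?powR_ge0//; lra.
move=> e w /andP[e0 et] w0 tau /andP[tau0 taue]; rewrite normrM.
rewrite [leRHS](_ : _ = 2 * nu * (t / 2) `^ (- (2 * nu) - 1) *
  (K * tau `^ (1 - nu - 1) * (1 + w ^+ 2)^-1)); last first.
  by rewrite (_ : 1 - nu - 1 = - nu); ring.
apply: ler_pM => //; last by apply: KE => //; rewrite tau0/=; lra.
rewrite ger0_norm ?mulr_ge0 ?powR_ge0//; last lra.
rewrite ler_pM2l; last lra.
rewrite (_ : - (2 * nu) - 1 = - (2 * nu + 1)); last by ring.
rewrite !powRN lef_pV2 ?posrE ?powR_gt0//; try lra.
by apply: ge0_ler_powR; rewrite ?nnegrE; lra.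
Qed.

End InitialTermInTime.

Section InitialTermCaputo.
Context {R : realType} (nu : R) (nu_gt0 : 0 < nu) (nu_lt : nu < 2^-1).
Local Notation mu := (@lebesgue_measure R).
Local Notation Rp := (`]0%R, +oo[%classic : set R).
Implicit Types (b x s r v C K y t w e : R).
Local Notation rayV := (rayV nu).
Local Notation rayL := (rayL nu).
Variables (m : R -> R) (M m0 : R).
Hypotheses (mm : measurable_fun setT m) (mM : forall w, `|m w| <= M).
Local Notation heat := (heat nu m).
Local Notation rest := (rest nu).

Lemma measurable_rayL_s b w u v : b < 1 -> 0 < w -> 0 <= u ->
  measurable_fun `]u, v[ (fun tau : R => rayL b w tau).
Proof.
move=> b1 w0 u0; apply: (eq_measurable_fun (fun tau : R => rayV b w tau)).
  move=> tau; rewrite inE/= in_itv/= => /andP[utau _].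
  by apply/esym/(rayL_V nu_gt0 nu_lt) => //; lra.
by apply: measurable_funTS; exact: measurable_rayV_s.
Qed.

(** Needed for measurability in [w]. *)
Lemma continuous_rest t e w : 0 < t -> 0 < e <= t / 2 -> 0 < w ->
  {for w, continuous (fun w => rest e w t)}.
Proof.
move=> t0 et w0; have n0 := nu_gt0; have n1 := nu_lt; have /andP[e0 et2] := et.
have bN : 1 - nu <= 1 by lra.
have [C [C0 CE]] := rest_le nu_gt0 nu_lt t0.
have near0 : \forall w' \near w, 0 < w' by exact: lt_nbhsr.
have mk w' : 0 < w' -> measurable_fun `]0, e[
    (fun tau => 2 * nu * (t - tau) `^ (- (2 * nu) - 1) * rayL (1 - nu) w' tau).
  move=> w'0; apply: measurable_funM; last by apply: measurable_rayL_s => //; lra.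
  apply: measurable_funM => //; apply: measurable_funTS; exact: measurable_powR_sub.
apply: (@dominated_cvg_filter R _ _ `]0, e[ 
   (fun w' tau => 2 * nu * (t - tau) `^ (- (2 * nu) - 1) * rayL (1 - nu) w' tau) _
   (fun tau => C * tau `^ (- nu)) (@sequential_nbhs R w)) => //.
- by apply: filterS near0 => w'; exact: mk.
- apply: filterS near0 => w' w'0 tau; rewrite /= in_itv/= => te.
  apply: (le_trans (CE _ _ et (ltW w'0) _ te)); rewrite ler_wpM2r ?powR_ge0//.
  by rewrite ler_piMr// invf_le1 ?ltr_pwDl ?sqr_ge0// lerDl sqr_ge0.
- by apply: integrableZ_EFin => //; apply: integrable_powR_itv; lra.
- move=> tau; rewrite /= in_itv/= => /andP[tau0 _].
  apply: cvgM; first exact: cvg_cst.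
  exact: is_derive1_continuous (is_derive_rayL_x nu_gt0 nu_lt w bN tau0).
Qed.

Lemma measurable_rest t e : 0 < t -> 0 < e <= t / 2 ->
  measurable_fun Rp (fun w => rest e w t).
Proof.
move=> t0 et; apply: open_continuous_measurable_fun => // w.
by rewrite inE/= in_itv/= andbT; exact: continuous_rest.
Qed.

Lemma rest_bound t : 0 < t -> exists C, 0 <= C /\ forall e w, 0 < e <= t / 2 -> 0 < w ->
  `|rest e w t| <= C * (1 + w ^+ 2)^-1 * (\int[mu]_(tau in `]0%R, e[) tau `^ (- nu))%R.
Proof.
move=> t0; have n0 := nu_gt0; have n1 := nu_lt.
have [C [C0 CE]] := rest_le nu_gt0 nu_lt t0; exists C; split => // e w et w0.
have /andP[e0 et2] := et.
have ip : mu.-integrable `]0, e[ (EFin \o (fun tau : R => tau `^ (- nu))).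
  by apply: integrable_powR_itv; [lra|exact: ltW].
rewrite -RintegralZl//; apply: norm_Rintegral_le => //.
- apply: measurable_funM; last by apply: measurable_rayL_s => //; lra.
  apply: measurable_funM => //; apply: measurable_funTS; exact: measurable_powR_sub.
- by move=> tau; rewrite /= in_itv/= => te; exact: CE et (ltW w0) _ te.
- by apply: integrableZ_EFin.
Qed.

(** By scaling, a function of two variables obtained from functions of one. *)
Lemma measurable_rayL_joint b : b <= 1 ->
  measurable_fun (Rp `*` Rp) (fun z : R * R => rayL b z.2 z.1).
Proof.
move=> b1.
apply: (eq_measurable_fun (fun z : R * R => z.1 `^ (b - 1) * rayL b (z.2 * z.1 `^ (- nu)) 1)).
  move=> [s x]; rewrite inE/= => -[]; rewrite !in_itv/= !andbT => s0 x0.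
  by rewrite [RHS](rayL_scaling nu_gt0 nu_lt _ b1 s0).
have mp (c : R) : measurable_fun setT (fun r : R => r `^ c) by exact: measurable_powR.
apply: measurable_funTS; apply: measurable_funM; first exact: (measurableT_comp (mp _)).
apply: (measurableT_comp (measurable_rayL_x nu_gt0 nu_lt b1 ltr01)).
by apply: measurable_funM => //; exact: (measurableT_comp (mp _)).
Qed.

Lemma rest_integrable t e : 0 < t -> 0 < e <= t / 2 ->
  mu.-integrable Rp (EFin \o (fun w => rest e w t * m w)).
Proof.
move=> t0 et; have [C [C0 CE]] := rest_bound t0.
apply: (bound_integrable (g := fun w => C * (\int[mu]_(tau in `]0%R, e[) tau `^ (- nu))%R * M * (1 + w ^+ 2)^-1)) => //.
- by apply: measurable_funM; [exact: measurable_rest|exact: measurable_funTS].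
- move=> w; rewrite /= in_itv/= andbT => w0; rewrite normrM.
  rewrite mulrAC -[C * _ * _]mulrAC; apply: ler_pM => //; exact: CE.
- by apply: integrableZ_EFin => //; exact: integrable_invsqr.
Qed.

Lemma truncated_heat_dominated e t : 0 < e < t -> exists K,
  forall tau w, e < tau < t -> 0 < w ->
  `|(t - tau) `^ (- (2 * nu)) * (rayL (- nu) w tau * m w)| <=
  (t - tau) `^ (- (2 * nu)) * (K * (1 + w ^+ 2)^-1).
Proof.
move=> /andP[e0 et]; have n0 := nu_gt0; have n1 := nu_lt.
have t0 : 0 < t by lra.
have dec : decays_at1 nu (- nu) by apply: (rayL_bound0 nu_gt0 nu_lt); lra.
have [|K [K0 KE]] := heat_integrand_le nu_gt0 nu_lt mM t0 _ dec; first lra.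
exists (K * e `^ (- nu - 1)) => tau w /andP[etau taut] w0.
rewrite normrM (ger0_norm (powR_ge0 _ _)) ler_wpM2l ?powR_ge0//.
apply: (le_trans (KE _ _ w0 _)); first by apply/andP; split; lra.
rewrite ler_wpM2r ?(ltW (invsqr_gt0 _))// ler_wpM2l//.
rewrite (_ : - nu - 1 = - (nu + 1)); last by ring.
rewrite !powRN lef_pV2 ?posrE ?powR_gt0//; try lra.
by apply: ge0_ler_powR; rewrite ?nnegrE; lra.
Qed.

Lemma truncated_heat_integrable e t : 0 < e < t ->
  mu.-integrable `]e, t[ (EFin \o (fun tau => (t - tau) `^ (- (2 * nu)) * heat (- nu) tau)).
Proof.
move=> et; have n0 := nu_gt0; have n1 := nu_lt; have /andP[e0 et'] := et.
have [K KE] := truncated_heat_dominated et.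
pose J := (\int[mu]_(w in Rp) (K * (1 + w ^+ 2)^-1))%R.
have iK : mu.-integrable Rp (EFin \o (fun w => K * (1 + w ^+ 2)^-1)).
  by apply: integrableZ_EFin => //; exact: integrable_invsqr.
have dec : decays_at1 nu (- nu) by apply: (rayL_bound0 nu_gt0 nu_lt); lra.
apply: (bound_integrable (g := fun tau => J * (t - tau) `^ (- (2 * nu)))) => //.
- apply: measurable_funM; first by apply: measurable_funTS; exact: measurable_powR_sub.
  apply: open_continuous_measurable_fun => // tau.
  rewrite inE/= in_itv/= => /andP[etau _].
  by apply: (continuous_heat_dt nu_gt0 nu_lt mm mM); lra.
- move=> tau; rewrite /= in_itv/= => te; have /andP[etau taut] := te.
  have tau0 : 0 < tau by lra.
  have pg : 0 < (t - tau) `^ (- (2 * nu)) by rewrite powR_gt0; lra.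
  rewrite normrM (ger0_norm (powR_ge0 _ _)) mulrC ler_wpM2r ?powR_ge0//.
  apply: norm_Rintegral_le => //.
    by apply: measurable_funTS; apply: measurable_heat_integrand => //; lra.
  move=> w; rewrite /= in_itv/= andbT => w0; have := KE _ _ te w0.
  by rewrite normrM (ger0_norm (powR_ge0 _ _)) ler_pM2l.
- by apply: integrableZ_EFin => //; apply: integrable_powR_sub; [lra|apply/andP; split; lra].
Qed.

(** Fubini on ]e, t[, where the integrand is dominated by a product, then
    [truncated_kernel]. *)
Lemma truncated_heat e t : 0 < t -> 0 < e <= t / 2 ->
  (\int[mu]_(tau in `]e, t[) ((t - tau) `^ (- (2 * nu)) * heat (- nu) tau))%R =
  euler_gamma (1 - 2 * nu) * heat (1 - 3 * nu) t -
  (t - e) `^ (- (2 * nu)) * heat (1 - nu) e + (\int[mu]_(w in Rp) (rest e w t * m w))%R.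
Proof.
move=> t0 et2; have n0 := nu_gt0; have n1 := nu_lt; have /andP[e0 et'] := et2.
have et : 0 < e < t by apply/andP; split; lra.
have [K KE] := truncated_heat_dominated et.
have dec : decays_at1 nu (- nu) by apply: (rayL_bound0 nu_gt0 nu_lt); lra.
have dec3 : decays_at1 nu (1 - 3 * nu) by apply: (rayL_bound0 nu_gt0 nu_lt); lra.
pose k tau w := (t - tau) `^ (- (2 * nu)) * (rayL (- nu) w tau * m w).
have iK : mu.-integrable Rp (EFin \o (fun w => K * (1 + w ^+ 2)^-1)).
  by apply: integrableZ_EFin => //; exact: integrable_invsqr.
have ip : mu.-integrable `]e, t[ (EFin \o (fun tau => (t - tau) `^ (- (2 * nu)))).
  by apply: integrable_powR_sub; [lra|apply/andP; split; lra].
transitivity (\int[mu]_(tau in `]e, t[) \int[mu]_(w in Rp) k tau w)%R.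
  apply: eq_Rintegral => tau; rewrite inE/= in_itv/= => /andP[etau _].
  by rewrite /k RintegralZl//; apply: integrable_heat => //; lra.
have mk : measurable_fun (`]e, t[ `*` Rp) (fun z : R * R => k z.1 z.2).
  apply: measurable_funM.
    apply: measurable_funTS; exact: (measurableT_comp (measurable_powR_sub (- (2 * nu)) t)).
  apply: measurable_funM; last first.
    by apply: measurable_funTS; exact: (measurableT_comp mm).
  apply: (measurable_funS _ _ (measurable_rayL_joint (b := - nu) _)); last lra.
    exact: measurableX.
  move=> [a b] [/=]; rewrite !in_itv/= !andbT => /andP[ea _] b0; split => /=; first by lra.
  exact: b0.
have kab tau w : `]e, t[%classic tau -> Rp w -> `|k tau w| <= (t - tau) `^ (- (2 * nu)) * (K * (1 + w ^+ 2)^-1).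
  by rewrite /= !in_itv/= andbT => te w0; exact: KE.
rewrite (Rfubini _ _ mk kab)//.
have i1 := integrable_heat nu_gt0 nu_lt mm mM t0 (ltac:(lra) : 1 - 3 * nu <= 1) dec3.
have i2 := integrable_heat nu_gt0 nu_lt mm mM e0 (ltac:(lra) : 1 - nu <= 1) (rayL_bound_N nu_gt0 nu_lt).
have i3 := rest_integrable t0 et2.
have i1' := integrableZ_EFin (euler_gamma (1 - 2 * nu)) (measurable_itv `]0, +oo[) i1.
have i2' := integrableZ_EFin ((t - e) `^ (- (2 * nu))) (measurable_itv `]0, +oo[) i2.
have i12 := integrableB_EFin (measurable_itv `]0, +oo[) i1' i2'.
rewrite -RintegralZl// -RintegralZl// -RintegralB// -RintegralD//.
apply: eq_Rintegral => w; rewrite inE/= in_itv/= andbT => w0.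
transitivity ((\int[mu]_(tau in `]e, t[) ((t - tau) `^ (- (2 * nu)) * rayL (- nu) w tau))%R * m w).
  rewrite -RintegralZr//; first by apply: eq_Rintegral => tau _; rewrite /k mulrA.
  have b1 : - nu < 1 by lra.
  have [C [C0 CE]] := rayV_bound nu_gt0 nu_lt b1 w0.
  apply: (bound_integrable (g := fun tau => C * (t - tau) `^ (- (2 * nu)))) => //.
  - apply: measurable_funM; last exact: measurable_rayL_s (ltW e0).
    by apply: measurable_funTS; exact: measurable_powR_sub.
  - move=> tau; rewrite /= in_itv/= => /andP[tau0 _].
    rewrite (rayL_V nu_gt0 nu_lt)//; try lra.
    by rewrite normrM mulrC (ger0_norm (powR_ge0 _ _)) ler_wpM2r ?powR_ge0// CE.
  - exact: integrableZ_EFin.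
by rewrite (truncated_kernel nu_gt0 nu_lt et w0) !mulrDl mulNr !mulrA.
Qed.

(** The boundary term of the integration by parts is the weight at 0 times the
    value of [heat (1 - nu)] at time 0: this is how the initial data enter the
    Caputo derivative. The rest tends to 0 like the integral of tau^(- nu)
    over ]0, e[. *)
Lemma truncated_heat_cvg t : 0 < t -> m w @[w --> (0:R)^'+] --> m0 ->
  (\int[mu]_(tau in `]e, t[) ((t - tau) `^ (- (2 * nu)) * heat (- nu) tau))%R
    @[e --> (0:R)^'+] -->
  euler_gamma (1 - 2 * nu) * heat (1 - 3 * nu) t - t `^ (- (2 * nu)) * (pi * m0).
Proof.
move=> t0 mw; have n0 := nu_gt0; have n1 := nu_lt.
have neart : \forall e \near (0:R)^'+, 0 < e <= t / 2.
  near=> e; apply/andP; split; near: e; first exact: nbhs_right_gt.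
  by apply: nbhs_right_le; lra.
have R0 : (\int[mu]_(w in Rp) (rest e w t * m w))%R @[e --> (0:R)^'+] --> (0 : R).
  have [C [C0 CE]] := rest_bound t0.
  have [ip ip0] : mu.-integrable `]0, t[ (EFin \o (fun tau : R => tau `^ (- nu))) /\
     (\int[mu]_(tau in `]0, e[) tau `^ (- nu))%R @[e --> (0:R)^'+] --> (0 : R).
    have ip : mu.-integrable `]0, t[ (EFin \o (fun tau : R => tau `^ (- nu))).
      by apply: integrable_powR_itv; [lra|exact: ltW].
    by split => //; exact: Rintegral_initial_cvg0 t0 ip.
  pose J := (\int[mu]_(w in Rp) (C * M * (1 + w ^+ 2)^-1))%R.
  have JH : J * (\int[mu]_(tau in `]0, e[) tau `^ (- nu))%R @[e --> (0:R)^'+] --> J * 0.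
    by apply: cvgM => //; exact: cvg_cst.
  rewrite mulr0 in JH; apply: (cvg_norm_le _ JH).
  apply: filterS neart => e et.
  have iC : mu.-integrable Rp (EFin \o (fun w => C * M * (1 + w ^+ 2)^-1)).
    by apply: integrableZ_EFin => //; exact: integrable_invsqr.
  rewrite /J -RintegralZr//; apply: norm_Rintegral_le => //.
  - by apply: measurable_funM; [exact: measurable_rest|exact: measurable_funTS].
  - move=> w; rewrite /= in_itv/= andbT => w0; rewrite normrM.
    rewrite [leRHS](_ : _ = C * (1 + w ^+ 2)^-1 * (\int[mu]_(tau in `]0%R, e[) tau `^ (- nu))%R * M); last by ring.
    by apply: ler_pM => //; exact: CE.
  - have := integrableZ_EFin (\int[mu]_(tau in `]0%R, e[) tau `^ (- nu))%R (measurable_itv _) iC.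
    by apply: eq_integrable_EFin => // w _; rewrite mulrC.
have H : euler_gamma (1 - 2 * nu) * heat (1 - 3 * nu) t -
  (t - e) `^ (- (2 * nu)) * heat (1 - nu) e + (\int[mu]_(w in Rp) (rest e w t * m w))%R
    @[e --> (0:R)^'+] --> euler_gamma (1 - 2 * nu) * heat (1 - 3 * nu) t - t `^ (- (2 * nu)) * (pi * m0) + 0.
  apply: cvgD => //; apply: cvgB; first exact: cvg_cst.
  apply: cvgM; last exact: (heat_cvg0 nu_gt0 nu_lt mm mM mw).
  have c0 : {for (0:R), continuous (fun e => (t - e) `^ (- (2 * nu)))}.
    exact: is_derive1_continuous (is_derive_powR_sub _ t0).
  by have := cvg_at_right_filter c0; rewrite subr0.
rewrite addr0 in H; apply: cvg_trans H; apply: near_eq_cvg.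
by apply: filterS neart => e et; rewrite -truncated_heat.
Unshelve. all: by end_near. Qed.

End InitialTermCaputo.

(** * The boundary term *)

Section BoundaryTerm.
Context {R : realType} (nu : R) (nu_gt0 : 0 < nu) (nu_lt : nu < 2^-1).
Local Notation mu := (@lebesgue_measure R).
Local Notation Rp := (`]0%R, +oo[%classic : set R).
Implicit Types (b x s r v C K y t w e : R).
Local Notation rayV := (rayV nu).
Variables (G : R -> R) (M S : R).
Hypotheses (mG : measurable_fun setT G) (GM : forall w, `|G w| <= M) (S_gt0 : 0 < S).

(** For [b = 0] and y = x / lambda, pi times the boundary term at time [t <=
    S]. Since the kernel vanishes for negative times the window ]0, S[ can be
    kept fixed, and no moving endpoint has to be differentiated. *)
Definition signal b y t := (\int[mu]_(sg in `]0%R, S[) (rayV b y (t - sg) * G sg))%R.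

Lemma G_bound_ge0 : 0 <= M. Proof. exact: le_trans (normr_ge0 _) (GM 0). Qed.

Lemma measurable_signal_integrand b y t : b < 1 -> 0 < y ->
  measurable_fun setT (fun sg : R => rayV b y (t - sg) * G sg).
Proof.
move=> b1 y0; apply: measurable_funM => //.
by apply: measurable_reflect; exact: measurable_rayV_s.
Qed.

(** Away from y = 0 the vertical ray integral is bounded in time, so all
    derivatives may be taken under the integral without singularity. *)
Lemma signal_integrand_le b y0 : b < 1 -> 0 < y0 -> exists K, 0 <= K /\
  forall y t sg, y0 <= y -> `|rayV b y (t - sg) * G sg| <= K.
Proof.
move=> b1 y00; have [K [K0 KE]] := rayV_bound nu_gt0 nu_lt b1 y00.
exists (K * M); split; first by rewrite mulr_ge0// G_bound_ge0.
by move=> y t sg yy; rewrite normrM; apply: ler_pM => //; exact: KE.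
Qed.

Lemma integrable_cst_S (c : R) : mu.-integrable `]0, S[ (EFin \o (fun=> c)).
Proof. by apply: (@bounded_integrable _ _ _ `|c|) => //. Qed.

Lemma signal_bound b y : b < 1 -> 0 < y -> exists K, 0 <= K /\ forall t, `|signal b y t| <= K.
Proof.
move=> b1 y0; have [K [K0 KE]] := signal_integrand_le b1 y0.
exists (\int[mu]_(sg in `]0%R, S[) K)%R; split; first exact: Rintegral_ge0.
move=> t; apply: norm_Rintegral_le => //.
- by apply: measurable_funTS; exact: measurable_signal_integrand.
- by move=> sg _; exact: KE.
- exact: integrable_cst_S.
Qed.

Lemma integrable_signal_integrand b y t : b < 1 -> 0 < y ->
  mu.-integrable `]0, S[ (EFin \o (fun sg => rayV b y (t - sg) * G sg)).
Proof.
move=> b1 y0; have [K [K0 KE]] := signal_integrand_le b1 y0.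
apply: (@bounded_integrable _ _ _ K).
- by apply: measurable_funTS; exact: measurable_signal_integrand.
- by move=> sg _; exact: KE.
Qed.

Lemma is_derive_signal_t b y t : b < 1 -> 0 < y ->
  is_derive t 1 (signal b y) (signal (b - 1) y t).
Proof.
move=> b1 y0; have b11 : b - 1 < 1 by lra.
have [K [K0 KE]] := signal_integrand_le b11 y0.
apply: (is_derive_under_integral_bound _ ltr01 (k := fun t sg => rayV b y (t - sg) * G sg)
  (dk := fun t sg => rayV (b - 1) y (t - sg) * G sg) (b := fun=> K)) => //.
- by move=> t' _; apply: measurable_funTS; exact: measurable_signal_integrand.
- exact: integrable_signal_integrand.
- move=> t' sg _ _.
  have d1 : is_derive t' (1:R) (fun t' : R => t' - sg) 1.
    by apply: is_derive_eq; rewrite subr0.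
  have H := @is_derive1_comp _ (rayV b y) (fun t' => t' - sg) _ _ _
    (is_derive_rayV_s nu_gt0 nu_lt (t' - sg) (ltW b1) y0) d1.
  by apply: is_derive_eq; rewrite !scale_realE mulr0 add0r mulr1 mulrC.
- by move=> t' sg _ _; exact: KE.
- exact: integrable_cst_S.
Qed.

Lemma is_derive_signal_y b y t : b < 1 -> 0 < y ->
  is_derive y 1 (fun y => signal b y t) (- signal (b - nu) y t).
Proof.
move=> b1 y0; have n0 := nu_gt0; have b11 : b - nu < 1 by lra.
have y20 : 0 < y / 2 by lra.
have [K [K0 KE]] := signal_integrand_le b11 y20.
have near_y y' : `|y' - y| < y / 2 -> y / 2 <= y' /\ 0 < y'.
  by rewrite ltr_norml => /andP[? ?]; split; lra.
rewrite -RintegralN//; last exact: integrable_signal_integrand.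
apply: (is_derive_under_integral_bound _ y20 (k := fun y sg => rayV b y (t - sg) * G sg)
  (dk := fun y sg => - (rayV (b - nu) y (t - sg) * G sg)) (b := fun=> K)) => //.
- move=> y' /near_y[_ y'0]; apply: measurable_funTS; exact: measurable_signal_integrand.
- exact: integrable_signal_integrand.
- move=> y' sg /near_y[_ y'0] _.
  have H := is_derive_rayV_x nu_gt0 nu_lt (t - sg) (ltW b1) y'0.
  by apply: is_derive_eq; rewrite !scale_realE mulr0 add0r mulrN mulrC.
- by move=> y' sg /near_y[yy _] _; rewrite normrN; exact: KE.
- exact: integrable_cst_S.
Qed.

Lemma continuous_signal b y : b < 1 -> 0 < y -> continuous (signal b y).
Proof. by move=> b1 y0 t; exact: is_derive1_continuous (is_derive_signal_t t b1 y0). Qed.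

Lemma frac_signal_integrable y t : 0 < y -> 0 < t ->
  mu.-integrable `]0, t[ (EFin \o (fun u => (t - u) `^ (- (2 * nu)) * signal (-1) y u)).
Proof.
move=> y0 t0; have n0 := nu_gt0; have n1 := nu_lt.
have bN : (-1 : R) < 1 by lra.
have [K [K0 KE]] := signal_bound bN y0.
apply: (bound_integrable (g := fun u => K * (t - u) `^ (- (2 * nu)))) => //.
- apply: measurable_funTS; apply: measurable_funM; first exact: measurable_powR_sub.
  exact: continuous_measurable_fun (continuous_signal bN y0).
- by move=> u _; rewrite normrM mulrC (ger0_norm (powR_ge0 _ _)) ler_wpM2r ?powR_ge0.
- by apply: integrableZ_EFin => //; apply: integrable_powR_sub; [lra|rewrite lexx].
Qed.

(** Fubini and the index shift, for the time derivative (index - 1) and the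
    fractional integral of order 1 - 2 nu: the Caputo derivative lowers the
    index by 2 nu. *)
Lemma frac_signal y t : 0 < y -> 0 < t ->
  (\int[mu]_(u in `]0, t[) ((t - u) `^ (- (2 * nu)) * signal (-1) y u))%R =
  euler_gamma (1 - 2 * nu) * signal (- (2 * nu)) y t.
Proof.
move=> y0 t0; have n0 := nu_gt0; have n1 := nu_lt.
have bN : (-1 : R) < 1 by lra.
have b2 : - (2 * nu) < 1 by lra.
have [K [K0 KE]] := signal_integrand_le bN y0.
pose k u sg := (t - u) `^ (- (2 * nu)) * (rayV (-1) y (u - sg) * G sg).
transitivity (\int[mu]_(u in `]0, t[) \int[mu]_(sg in `]0, S[) k u sg)%R.
  by apply: eq_Rintegral => u _; rewrite /k RintegralZl//; exact: integrable_signal_integrand.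
have mk : measurable_fun (`]0, t[ `*` `]0, S[) (fun z : R * R => k z.1 z.2).
  apply: measurable_funTS; apply: measurable_funM.
    exact: (measurableT_comp (measurable_powR_sub (- (2 * nu)) t)).
  apply: measurable_funM; last exact: (measurableT_comp mG).
  apply: (measurableT_comp (measurable_rayV_s nu_gt0 nu_lt bN y0)).
  exact: measurable_funB.
have kab u sg : `]0, t[%classic u -> `]0, S[%classic sg ->
    `|k u sg| <= (t - u) `^ (- (2 * nu)) * K.
  by move=> _ _; rewrite normrM (ger0_norm (powR_ge0 _ _)) ler_wpM2l ?powR_ge0// KE.
have ip : mu.-integrable `]0, t[ (EFin \o (fun u => (t - u) `^ (- (2 * nu)))).
  by apply: integrable_powR_sub; [lra|rewrite lexx].
rewrite (Rfubini _ _ mk kab)//; last exact: integrable_cst_S.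
rewrite -RintegralZl//; last exact: integrable_signal_integrand.
apply: eq_Rintegral => sg; rewrite inE/= in_itv/= => /andP[sg0 _].
have g0 : 0 < 1 - 2 * nu by lra.
have bg : -1 + (1 - 2 * nu) < 1 by lra.
have := frac_rayV_local nu_gt0 nu_lt bN g0 bg y0 t0 (ltW sg0).
have -> : -1 + (1 - 2 * nu) = - (2 * nu) by ring.
have -> : 1 - 2 * nu - 1 = - (2 * nu) by ring.
move=> E; rewrite mulrA -E -RintegralZr//.
  by apply: eq_Rintegral => u _; rewrite /k mulrA.
have [C [C0 CE]] := rayV_bound nu_gt0 nu_lt bN y0.
apply: (bound_integrable (g := fun u => C * (t - u) `^ (- (2 * nu)))) => //.
- apply: measurable_funTS; apply: measurable_funM; first exact: measurable_powR_sub.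
  apply: (measurableT_comp (measurable_rayV_s nu_gt0 nu_lt bN y0)).
  exact: measurable_funB.
- by move=> u _; rewrite normrM mulrC (ger0_norm (powR_ge0 _ _)) ler_wpM2r ?powR_ge0 ?CE.
- exact: integrableZ_EFin.
Qed.

(** Causality of the kernel: only the data before time [t] matter. *)
Lemma signal_causal b y t : b < 1 -> 0 < y -> 0 <= t <= S ->
  signal b y t = (\int[mu]_(sg in `]0%R, t[) (rayV b y (t - sg) * G sg))%R.
Proof.
move=> b1 y0 /andP[t0 tS]; rewrite /signal [LHS]Rintegral_mkcond [RHS]Rintegral_mkcond.
apply: eq_Rintegral => sg _; rewrite !patchE; have [H|H] := boolP (sg \in `]0, t[%classic).
  rewrite mem_set//=; move: H; rewrite inE/= !in_itv/= => /andP[? ?]; apply/andP; split => //; lra.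
case: ifPn => //; rewrite inE/= in_itv/= => /andP[sg0 sgS].
rewrite (rayV_neg nu_gt0 nu_lt) ?mul0r//; have [tsg|] := ltP sg t; last lra.
by case/negP: H; rewrite inE/= in_itv/= sg0.
Qed.

Lemma signal_at0 b y : b < 1 -> 0 < y -> signal b y 0 = 0.
Proof.
move=> b1 y0; rewrite signal_causal ?lexx ?(ltW S_gt0)//.
by rewrite set_itv_ge ?bnd_simp ?ltxx// Rintegral_set0.
Qed.

(** The integral is continuous in time, and empty at time 0. *)
Lemma signal_cvg0 y : 0 < y -> signal 0 y t @[t --> (0:R)^'+] --> (0 : R).
Proof.
move=> y0; have := cvg_at_right_filter (continuous_signal ltr01 y0 (x := 0)).
by rewrite signal_at0.
Qed.

(** Reversing time turns the boundary term into an integral of the approximate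
    identity against the past of [G]. *)
Lemma signal_boundary t : 0 < t <= S -> G s @[s --> t^'-] --> G t ->
  signal 0 y t @[y --> (0:R)^'+] --> pi * G t.
Proof.
move=> /andP[t0 tS] Gt.
pose h := fun s => ((fun s => G (t - s)) \_ `]0, t[) s.
have mh : measurable_fun setT h.
  apply/(measurable_restrictT _ _).1 => //; apply: measurable_funTS; exact: measurable_reflect.
have hM s : 0 < s -> `|h s| <= M.
  by move=> _; rewrite /h patchE; case: ifP => // _; rewrite normr0 G_bound_ge0.
have hl : h s @[s --> (0:R)^'+] --> G t.
  have H : G (t - s) @[s --> (0:R)^'+] --> G t.
    apply/cvg_at_rightP => u [u0 ucv].
    have := (cvg_at_leftP _ _ _).1 Gt (fun n => t - u n); apply; split.
      by move=> n; rewrite ltrBlDr ltrDl.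
    by rewrite -[X in _ --> X]subr0; apply: cvgB => //; exact: cvg_cst.
  apply: cvg_trans H; apply: near_eq_cvg; near=> s.
  rewrite /h patchE mem_set//= in_itv/=; apply/andP; split; near: s.
    exact: nbhs_right_gt.
  exact: nbhs_right_lt.
have := rayV_approx_identity nu_gt0 nu_lt mh hM hl.
apply: cvg_trans; apply: near_eq_cvg; near=> y.
have y0 : 0 < y by near: y; exact: nbhs_right_gt.
rewrite signal_causal ?(ltW t0)//.
rewrite Rintegral_reflect; last first.
  have := integrable_signal_integrand t ltr01 y0.
  by apply: integrableS => //; apply: subset_itvl; rewrite bnd_simp.
rewrite [LHS]Rintegral_mkcond [RHS]Rintegral_mkcond; apply: eq_Rintegral => s _.
rewrite !patchE; have [H|H] := boolP (s \in `]0, t[%classic); last first.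
  by rewrite /h patchE (negbTE H) mulr0; case: ifP.
rewrite mem_set/=; last by move: H; rewrite inE/= !in_itv/= andbT => /andP[].
by rewrite /h patchE H opprB addrCA subrr addr0.
Unshelve. all: by end_near. Qed.

End BoundaryTerm.

(** * Half-line convolutions *)

Section ShiftedKernel.
Context {R : realType}.
Local Notation mu := (@lebesgue_measure R).
Local Notation Rp := (`]0%R, +oo[%classic : set R).
Implicit Types (x z w a C M : R).

(** Only on a half-line, which is all that a fixed point of reference for the
    integral allows. *)
Lemma continuous_primitive (F : R -> R) (c : R) : continuous F ->
  exists P : R -> R, forall z, c < z -> is_derive z 1 P (F z).
Proof.
move=> cF; exists (fun z => \int[mu]_(t in `[c, z]) F t)%R => z cz.
have zz : z < z + 1 by rewrite ltrDl.
have iF : mu.-integrable `[c, z + 1] (EFin \o F).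
  apply: continuous_compact_integrable; first exact: segment_compact.
  by apply: continuous_subspaceT => x; exact: cF.
have [d e] := continuous_FTC1_closed zz iF cz (cF z).
by apply: (DeriveDef d); rewrite -e derive1E.
Qed.

Lemma invsqr_cvgy : (1 + w ^+ 2)^-1 @[w --> +oo%R] --> (0 : R).
Proof.
apply: (cvg_norm_le _ (powRN_cvgy (@ltr01 R))).
near=> w; have w0 : 0 < w by near: w; exact: nbhs_pinfty_gt.
rewrite (ger0_norm (ltW (invsqr_gt0 _))) (powR_inv1 (ltW w0)).
have w2 : 0 < 1 + w ^+ 2 by rewrite ltr_pwDl// sqr_ge0.
rewrite lef_pV2 ?posrE//.
have := sqr_ge0 (w - 2^-1); rewrite sqrrB; nra.
Unshelve. all: by end_near. Qed.

Section Kernel.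
Variables (ker dker : R -> R) (C : R).
Hypotheses (dk : forall w, is_derive w 1 ker (- dker w)) (cdk : continuous dker).
Hypotheses (kC : forall w, 0 <= w -> `|ker w| <= C * (1 + w ^+ 2)^-1).
Hypotheses (dkC : forall w, 0 <= w -> `|dker w| <= C * (1 + w ^+ 2)^-1).

Let mk : measurable_fun setT ker.
Proof.
by apply: continuous_measurable_fun => w; exact: is_derive1_continuous (dk w).
Qed.

Let mdk : measurable_fun setT dker. Proof. exact: continuous_measurable_fun. Qed.

Let iC c : mu.-integrable Rp (EFin \o (fun w => c * (1 + w ^+ 2)^-1)).
Proof. by apply: integrableZ_EFin => //; exact: integrable_invsqr. Qed.

(** Half of a convolution: the two signs of [a] cover the two sides of [x],
    and a jump or a kink on the diagonal appears through the value at 0 of the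
    half kernel. *)
Definition smear (k F : R -> R) a x := (\int[mu]_(w in Rp) (k w * F (x + a * w)))%R.

Lemma measurable_smear_integrand (k F : R -> R) a x : measurable_fun setT k ->
  continuous F -> measurable_fun setT (fun w => k w * F (x + a * w)).
Proof.
move=> mk' cF; apply: measurable_funM => //.
apply: measurableT_comp; first exact: continuous_measurable_fun.
by apply: measurable_funD => //; exact: measurable_funM.
Qed.

Lemma integrable_smear (k F : R -> R) a x M : measurable_fun setT k ->
  (forall w, 0 <= w -> `|k w| <= C * (1 + w ^+ 2)^-1) ->
  continuous F -> (forall z, `|F z| <= M) ->
  mu.-integrable Rp (EFin \o (fun w => k w * F (x + a * w))).
Proof.
move=> mk' k'C cF FM.
apply: (bound_integrable (g := fun w => C * M * (1 + w ^+ 2)^-1)) => //.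
- by apply: measurable_funTS; exact: measurable_smear_integrand.
- move=> w; rewrite /= in_itv/= andbT => w0; rewrite normrM mulrAC.
  by apply: ler_pM => //; exact: k'C (ltW w0).
Qed.

(** Integration by parts moves the derivative from the data, which are merely
    continuous, to the kernel. A primitive of the data makes sense of it; only
    its increments between [x0] and a nearby [x] are used, because these are
    bounded in [w] while the primitive itself may grow linearly. *)
Lemma is_derive_smear_pos (F : R -> R) a x0 M : 0 < a -> continuous F -> (forall z, `|F z| <= M) ->
  is_derive x0 1 (smear ker F a) (a^-1 * (smear dker F a x0 - ker 0 * F x0)).
Proof.
(* The base point x0 - 2 lies to the left of all points x + a w with |x - x0|
   < 1. *)
move=> a0 cF FM; have [P dP] := continuous_primitive (x0 - 2) cF.
have M0 : 0 <= M := le_trans (normr_ge0 _) (FM 0).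
have C0 : 0 <= C by have := le_trans (normr_ge0 _) (kC (lexx 0)); rewrite expr0n/= addr0 invr1 mulr1.
have far x w : `|x - x0| < 1 -> 0 <= w -> x0 - 2 < x + a * w.
  rewrite ltr_norml => /andP[x1 _] w0; have : 0 <= a * w by rewrite mulr_ge0// ltW.
  lra.
have x00 : `|x0 - x0| < 1 by rewrite subrr normr0.
have dPs x w : `|x - x0| < 1 -> 0 <= w -> is_derive x 1 (fun x => P (x + a * w)) (F (x + a * w)).
  move=> xx w0; have d1 : is_derive x (1:R) (fun x : R => x + a * w) 1.
    by apply: is_derive_eq; rewrite addr0.
  have d2 := dP _ (far _ _ xx w0).
  have := @is_derive1_comp _ P (fun x => x + a * w) _ _ _ d2 d1.
  by rewrite mulr1.
have dPw x w : `|x - x0| < 1 -> 0 <= w -> is_derive w 1 (fun w => P (x + a * w)) (a * F (x + a * w)).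
  move=> xx w0; have d1 : is_derive w (1:R) (fun w : R => x + a * w) a.
    by apply: is_derive_eq; rewrite add0r ?scale_realE mul1r mulr1.
  have d2 := dP _ (far _ _ xx w0).
  have := @is_derive1_comp _ P (fun w => x + a * w) _ _ _ d2 d1.
  by rewrite mulrC.
have lip x w : `|x - x0| < 1 -> 0 <= w -> `|P (x + a * w) - P (x0 + a * w)| <= `|x - x0| * M.
  move=> xx w0; apply: (@derive_bound_lipschitz _ (fun x => P (x + a * w))
    (fun x => F (x + a * w)) x0 1) => //.
  by move=> x' x'x; exact: dPs.
have mP x : `|x - x0| < 1 -> measurable_fun Rp (fun w => P (x + a * w)).
  move=> xx; apply: open_continuous_measurable_fun => // w.
  rewrite inE/= in_itv/= andbT => w0.
  exact: is_derive1_continuous (dPw _ _ xx (ltW w0)).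
pose J x := (\int[mu]_(w in Rp) (dker w * (P (x + a * w) - P (x0 + a * w))))%R.
have mJ x : `|x - x0| < 1 -> measurable_fun Rp (fun w => dker w * (P (x + a * w) - P (x0 + a * w))).
  move=> xx; apply: measurable_funM; first exact: measurable_funTS.
  by apply: measurable_funB; exact: mP.
have bJ x w : `|x - x0| < 1 -> Rp w ->
    `|dker w * (P (x + a * w) - P (x0 + a * w))| <= `|x - x0| * (C * M * (1 + w ^+ 2)^-1).
  move=> xx; rewrite /= in_itv/= andbT => w0; rewrite normrM.
  rewrite [leRHS](_ : _ = C * (1 + w ^+ 2)^-1 * (`|x - x0| * M)); last by ring.
  by apply: ler_pM => //; [exact: dkC (ltW w0)|exact: lip (ltW w0)].
have iJ x : `|x - x0| < 1 -> mu.-integrable Rp (EFin \o (fun w => dker w * (P (x + a * w) - P (x0 + a * w)))).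
  move=> xx; apply: (bound_integrable (g := fun w => `|x - x0| * (C * M * (1 + w ^+ 2)^-1))) => //.
  - exact: mJ.
  - by move=> w; exact: bJ.
  - by apply: integrableZ_EFin => //; exact: iC.
have dJ : is_derive x0 1 J (smear dker F a x0).
  apply: (is_derive_under_integral (e := 1) (b := fun w => C * M * (1 + w ^+ 2)^-1)
    (k := fun x w => dker w * (P (x + a * w) - P (x0 + a * w)))) => //.
  - move=> x w xx Rw; rewrite subrr mulr0 subr0; exact: bJ.
  - move=> w; rewrite /= in_itv/= andbT => w0; have d1 := dPs _ _ x00 (ltW w0).
    by apply: is_derive_eq; rewrite ?scale_realE; ring.
(* The increment of the convolution, by parts in w, in terms of the primitive. *)
have E x : `|x - x0| < 1 ->
    smear ker F a x = a^-1 * (J x - ker 0 * (P x - P x0)) + smear ker F a x0.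
  move=> xx; pose D w := P (x + a * w) - P (x0 + a * w).
  have dD w : 0 <= w -> is_derive w 1 D (a * (F (x + a * w) - F (x0 + a * w))).
    move=> w0; have d1 := dPw _ _ xx w0; have d2 := dPw _ _ x00 w0.
    by apply: is_derive_eq; rewrite mulrBr.
  have i1 := integrable_smear a x mk kC cF FM.
  have i2 := integrable_smear a x0 mk kC cF FM.
  have i12 := integrableZ_EFin a (measurable_itv _) (integrableB_EFin (measurable_itv _) i1 i2).
  pose phi w := a * (ker w * F (x + a * w) - ker w * F (x0 + a * w)) - dker w * D w.
  have iphi : mu.-integrable Rp (EFin \o phi).
    by apply: integrableB_EFin => //; exact: iJ.
  have kc w : {for w, continuous ker} by exact: is_derive1_continuous (dk w).
  have Dc w : 0 <= w -> {for w, continuous D} by move=> w0; exact: is_derive1_continuous (dD _ w0).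
  have parts : (\int[mu]_(w in Rp) phi w)%R = 0 - ker 0 * D 0.
    apply: (@FTC_halfline R (fun w => ker w * D w)).
    - move=> w w0; have d1 := dD _ (ltW w0); have d2 := dk w.
      apply: is_derive_eq; rewrite !scale_realE /phi; ring.
    - move=> w w0; have cFs y : {for w, continuous (fun w => F (y + a * w))}.
        apply: continuous_comp; last exact: cF.
        by apply: cvgD; [exact: cvg_cst|apply: cvgM; [exact: cvg_cst|exact: cvg_id]].
      apply: cvgB; last by apply: cvgM; [exact: cdk|exact: Dc (ltW w0)].
      apply: cvgM; first exact: cvg_cst.
      by apply: cvgB; apply: cvgM; [exact: kc|exact: cFs|exact: kc|exact: cFs].
    - exact: iphi.
    - apply: cvg_at_right_filter; apply: cvgM; [exact: kc|exact: Dc].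
    - have H : C * M * (1 + w ^+ 2)^-1 @[w --> +oo%R] --> C * M * 0.
        by apply: cvgM; [exact: cvg_cst|exact: invsqr_cvgy].
      rewrite mulr0 in H; apply: (cvg_norm_le _ H); near=> w.
      have w0 : 0 < w by near: w; exact: nbhs_pinfty_gt.
      rewrite normrM mulrAC; apply: ler_pM => //; first exact: kC (ltW w0).
      apply: (le_trans (lip _ _ xx (ltW w0))); rewrite -[leRHS]mul1r ler_wpM2r//.
      exact: ltW.
  have D0 : D 0 = P x - P x0 by rewrite /D mulr0 !addr0.
  have intphi : (\int[mu]_(w in Rp) phi w)%R = a * (smear ker F a x - smear ker F a x0) - J x.
    transitivity ((\int[mu]_(w in Rp) (a * (ker w * F (x + a * w) - ker w * F (x0 + a * w))))%R - J x).
      by apply: RintegralB => //; exact: iJ.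
    congr (_ - _).
    transitivity (a * (\int[mu]_(w in Rp) (ker w * F (x + a * w) - ker w * F (x0 + a * w)))%R).
      by apply: RintegralZl => //; exact: integrableB_EFin.
    by congr (_ * _); apply: RintegralB.
  have S : a * (smear ker F a x - smear ker F a x0) = J x - ker 0 * (P x - P x0).
    by move: parts; rewrite intphi D0; move=> H; apply/eqP; rewrite -subr_eq0; apply/eqP; lra.
  by rewrite -S mulrA mulVf ?mul1r ?subrK// gt_eqF.
have dPx : is_derive x0 1 P (F x0) by apply: dP; rewrite ltrBlDr ltrDl.
have dR : is_derive x0 1 (fun x => a^-1 * (J x - ker 0 * (P x - P x0)) + smear ker F a x0)
    (a^-1 * (smear dker F a x0 - ker 0 * F x0)).
  by apply: is_derive_eq; rewrite !scale_realE; ring.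
apply: (near_eq_is_derive _ dR); near=> x; apply/esym/E; near: x.
have := nbhsx_ballx x0 1 ltr01; apply: filterS => x.
by rewrite /ball/= distrC.
Unshelve. all: by end_near. Qed.

Lemma smear_reflect (k F : R -> R) a x : smear k F a x = smear k (F \o -%R) (- a) (- x).
Proof.
by apply: eq_Rintegral => w _; congr (_ * F _); rewrite opprD mulNr !opprK.
Qed.

(** The other sign of [a] by reflection of the data. *)
Lemma is_derive_smear (F : R -> R) a x0 M : a != 0 -> continuous F -> (forall z, `|F z| <= M) ->
  is_derive x0 1 (smear ker F a) (a^-1 * (smear dker F a x0 - ker 0 * F x0)).
Proof.
rewrite neq_lt => /orP[a0|a0] cF FM; last exact: is_derive_smear_pos FM.
have a0' : 0 < - a by rewrite oppr_gt0.
have cF' : continuous (F \o -%R).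
  by move=> z; apply: continuous_comp; [exact: opp_continuous|exact: cF].
have d := @is_derive_smear_pos (F \o -%R) (- a) (- x0) M a0' cF' (fun z => FM (- z)).
have d1 : is_derive x0 (1:R) (fun x : R => - x) (-1) by apply: is_derive_eq.
have := @is_derive1_comp _ (smear ker (F \o -%R) (- a)) (fun x => - x) _ _ _ d d1.
rewrite (_ : _ \o _ = smear ker F a); last first.
  by apply/funext => x; rewrite /= [RHS]smear_reflect.
by rewrite -smear_reflect /= opprK invrN mulrN1 mulNr opprK.
Qed.

End Kernel.

Lemma Rintegral_two_sided (f : R -> R) : mu.-integrable setT (EFin \o f) ->
  (\int[mu]_x f x = \int[mu]_(w in Rp) f w + \int[mu]_(w in Rp) f (- w))%R.
Proof.
move=> fi; have N1 : (-1 : R) != 0 by rewrite oppr_eq0 oner_eq0.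
pose Rn := (`]-oo, 0%R[%classic : set R).
have En : (\int[mu]_(w in Rn) f w)%R = (\int[mu]_(w in Rp) f (- w))%R.
  rewrite Rintegral_mkcond (Rintegral_affine 0 N1); last first.
    exact: (integrable_restrictT (measurable_itv _) (integrable_subT (measurable_itv _) fi)).
  rewrite normrN1 mul1r [RHS]Rintegral_mkcond; apply: eq_Rintegral => v _.
  rewrite !patchE mulN1r addr0; congr (if _ then _ else _).
  by apply/idP/idP; rewrite !inE/= /Rn /= !in_itv/= ?andbT => H; lra.
rewrite -En (Rintegral_setD1 0)//.
have -> : setT `\ (0:R) = Rp `|` Rn.
  apply/seteqP; split => x /=; rewrite !in_itv/= andbT.
    by move=> [_ /eqP]; rewrite neq_lt => /orP[]; [right|left].
  by move=> [|] H; split => //; apply/eqP; [rewrite gt_eqF|rewrite lt_eqF].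
rewrite Rintegral_setU//.
- exact: measurable_itv.
- apply: integrableS fi => //; apply: measurableU; exact: measurable_itv.
apply/disj_setPS => x [] /=; rewrite /Rn /= !in_itv/= ?andbT => ? ?; lra.
Qed.

End ShiftedKernel.

(** * The initial term as a function of space *)

Section InitialTermInSpace.
Context {R : realType} (nu : R) (nu_gt0 : 0 < nu) (nu_lt : nu < 2^-1).
Local Notation mu := (@lebesgue_measure R).
Local Notation Rp := (`]0%R, +oo[%classic : set R).
Implicit Types (b x s r v C K y t w e : R).
Local Notation rayL := (rayL nu).
Variables (h : R -> R) (M l : R).
Hypotheses (hc : continuous h) (hM : forall w, `|h w| <= M) (l_gt0 : 0 < l).

Let mh : measurable_fun setT h. Proof. exact: continuous_measurable_fun. Qed.

Lemma rayL_decay b t : 0 < t -> b <= 1 -> decays_at1 nu b ->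
  exists C, 0 <= C /\ forall y, 0 <= y -> `|rayL b y t| <= C * (1 + y ^+ 2)^-1.
Proof.
move=> t0 b1 db; have [K [K0 KE]] := rayL_bound nu_gt0 nu_lt t0 b1 db.
exists (K * t `^ (b - 1)); split; first by rewrite mulr_ge0 ?powR_ge0.
by move=> y y0; apply: KE => //; rewrite t0/=.
Qed.

Lemma continuous_rayL_x b t : 0 < t -> b <= 1 -> continuous (fun y => rayL b y t).
Proof.
move=> t0 b1 y.
exact: is_derive1_continuous (is_derive_rayL_x nu_gt0 nu_lt y b1 t0).
Qed.

Lemma is_derive_smear_rayL b a x t : 0 < t -> b <= 1 -> decays_at1 nu b ->
  decays_at1 nu (b - nu) -> a != 0 ->
  is_derive x 1 (smear (fun y => rayL b y t) h a)
    (a^-1 * (smear (fun y => rayL (b - nu) y t) h a x - rayL b 0 t * h x)).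
Proof.
move=> t0 b1 db db' a0; have b1' : b - nu <= 1 by have := nu_gt0; lra.
have [C [C0 CE]] := rayL_decay t0 b1 db.
have [C' [C'0 CE']] := rayL_decay t0 b1' db'.
apply: (@is_derive_smear _ (fun y => rayL b y t) (fun y => rayL (b - nu) y t) (C + C')
  _ _ _ _ h a x M) => //.
- by move=> w; exact: is_derive_rayL_x.
- exact: continuous_rayL_x.
- move=> w w0; apply: (le_trans (CE _ w0)).
  by rewrite ler_wpM2r ?(ltW (invsqr_gt0 _))// lerDl.
- move=> w w0; apply: (le_trans (CE' _ w0)).
  by rewrite ler_wpM2r ?(ltW (invsqr_gt0 _))// lerDr.
Qed.

(** The contribution of the data reflected across 0. For [x] positive the
    kernel is evaluated away from its kink, so that this is differentiated
    directly. *)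
Definition image b t x := (\int[mu]_(xi in Rp) (rayL b ((x + xi) / l) t * h xi))%R.

Lemma image_integrand_le b t : 0 < t -> b <= 1 -> decays_at1 nu b ->
  exists K, 0 <= K /\ forall x xi, 0 <= x -> 0 < xi ->
    `|rayL b ((x + xi) / l) t * h xi| <= K * (1 + (xi / l) ^+ 2)^-1.
Proof.
move=> t0 b1 db; have [C [C0 CE]] := rayL_decay t0 b1 db.
exists (C * M); split; first by rewrite mulr_ge0// (le_trans _ (hM 0)).
move=> x xi x0 xi0; rewrite normrM [leRHS]mulrAC; apply: ler_pM => //.
have y0 : 0 <= (x + xi) / l by rewrite divr_ge0 ?(ltW l_gt0)//; lra.
apply: (le_trans (CE _ y0)); rewrite ler_wpM2l//.
have w0 : 0 <= xi / l by rewrite divr_ge0 ?ltW.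
have wy : xi / l <= (x + xi) / l.
  by apply: ler_wpM2r; [rewrite invr_ge0 ltW|lra].
rewrite lef_pV2 ?posrE ?ltr_pwDl ?sqr_ge0// lerD2l.
by apply: lerXn2r; rewrite ?nnegrE.
Qed.

Lemma integrable_invsqr_scaled K :
  mu.-integrable Rp (EFin \o (fun xi => K * (1 + (xi / l) ^+ 2)^-1)).
Proof.
apply: integrableZ_EFin => //.
have li0 : l^-1 != 0 by rewrite invr_eq0 gt_eqF.
have := integrable_affine 0 li0 integrable_invsqrT.
move=> /(integrable_subT (measurable_itv `]0, +oo[)).
by apply: eq_integrable_EFin => // x _; rewrite addr0 mulrC.
Qed.

Lemma measurable_image_integrand b t x : 0 < t -> b <= 1 ->
  measurable_fun setT (fun xi => rayL b ((x + xi) / l) t * h xi).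
Proof.
move=> t0 b1; apply: measurable_funM => //.
apply: (measurableT_comp (measurable_rayL_x nu_gt0 nu_lt b1 t0)).
by apply: measurable_funM => //; exact: measurable_funD.
Qed.

Lemma integrable_image b t x : 0 < t -> b <= 1 -> decays_at1 nu b -> 0 <= x ->
  mu.-integrable Rp (EFin \o (fun xi => rayL b ((x + xi) / l) t * h xi)).
Proof.
move=> t0 b1 db x0; have [K [K0 KE]] := image_integrand_le t0 b1 db.
apply: (bound_integrable (g := fun xi => K * (1 + (xi / l) ^+ 2)^-1)) => //.
- by apply: measurable_funTS; exact: measurable_image_integrand.
- by move=> xi; rewrite /= in_itv/= andbT; exact: KE.
- exact: integrable_invsqr_scaled.
Qed.

Lemma is_derive_image b t x : 0 < t -> b <= 1 -> decays_at1 nu b ->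
  decays_at1 nu (b - nu) -> 0 < x ->
  is_derive x 1 (image b t) (- l^-1 * image (b - nu) t x).
Proof.
move=> t0 b1 db db' x0; have b1' : b - nu <= 1 by have := nu_gt0; lra.
have [K [K0 KE]] := image_integrand_le t0 b1' db'.
have near_x x' : `|x' - x| < x -> 0 <= x'.
  by rewrite ltr_norml => /andP[? ?]; lra.
rewrite -RintegralZl//; last by apply: integrable_image => //; exact: ltW.
apply: (is_derive_under_integral_bound _ x0
  (k := fun x xi => rayL b ((x + xi) / l) t * h xi)
  (dk := fun x xi => - l^-1 * (rayL (b - nu) ((x + xi) / l) t * h xi))
  (b := fun xi => l^-1 * (K * (1 + (xi / l) ^+ 2)^-1))) => //.
- by move=> x' _; apply: measurable_funTS; exact: measurable_image_integrand.
- by apply: integrable_image => //; exact: ltW.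
- move=> x' xi _ _.
  have d1 : is_derive x' (1:R) (fun x' : R => (x' + xi) / l) l^-1.
    by apply: is_derive_eq; rewrite ?scale_realE; ring.
  have H := @is_derive1_comp _ (fun y => rayL b y t) (fun x' => (x' + xi) / l) _ _ _
    (is_derive_rayL_x nu_gt0 nu_lt ((x' + xi) / l) b1 t0) d1.
  by apply: is_derive_eq; rewrite ?scale_realE /=; ring.
- move=> x' xi /near_x x'0; rewrite /= in_itv/= andbT => xi0.
  rewrite normrM normrN (gtr0_norm (_ : 0 < l^-1)) ?invr_gt0//.
  by rewrite ler_wpM2l ?invr_ge0 ?(ltW l_gt0)//; exact: KE.
- by apply: integrableZ_EFin => //; exact: integrable_invsqr_scaled.
Qed.

(** Since [h] is even, the sum of the values at distance [l * w] from [x] of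
    the odd continuation of [h] from the half-line. The even continuation has
    the advantage of being continuous at 0; the correction turns it into the
    odd one. *)
Definition odd_mean x w :=
  h (x + l * w) + h (x - l * w) - 2 * (if x < l * w then h (l * w - x) else 0).

Lemma measurable_odd_mean x : measurable_fun setT (odd_mean x).
Proof.
have ml : measurable_fun setT (fun w => l * w) by exact: measurable_funM.
apply: measurable_funB.
  by apply: measurable_funD; apply: measurableT_comp => //;
    [exact: measurable_funD|exact: measurable_funB].
apply: measurable_funM => //; apply: measurable_fun_ifT => //.
  exact: measurable_fun_ltr.
by apply: measurableT_comp => //; exact: measurable_funB.
Qed.

Lemma odd_mean_le x w : `|odd_mean x w| <= 4 * M.
Proof.
have M0 : 0 <= M := le_trans (normr_ge0 _) (hM 0).
rewrite (le_trans (ler_normB _ _))// (_ : 4 * M = (M + M) + 2 * M); last by ring.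
apply: lerD; first by rewrite (le_trans (ler_normD _ _))// lerD.
by rewrite normrM ger0_norm// ler_pM2l//; case: ifP => // _; rewrite normr0.
Qed.

Lemma odd_mean_cvg0 x : 0 < x -> odd_mean x w @[w --> (0:R)^'+] --> 2 * h x.
Proof.
move=> x0; have H : h (x + l * w) + h (x - l * w) @[w --> (0:R)^'+] --> h x + h x.
  have c : {for (0:R), continuous (fun w => h (x + l * w) + h (x - l * w))}.
    apply: cvgD; apply: continuous_comp; try exact: hc.
      by apply: cvgD; [exact: cvg_cst|apply: cvgM; [exact: cvg_cst|exact: cvg_id]].
    by apply: cvgB; [exact: cvg_cst|apply: cvgM; [exact: cvg_cst|exact: cvg_id]].
  by have := cvg_at_right_filter c; rewrite mulr0 addr0 subr0.
rewrite mulr_natl mulr2n; apply: cvg_trans H; apply: near_eq_cvg; near=> w.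
rewrite /odd_mean ltNge ifF ?mulr0 ?subr0//; apply/negbF.
rewrite -ler_pdivlMl//; near: w; apply: nbhs_right_le.
by rewrite mulr_gt0// invr_gt0.
Unshelve. all: by end_near. Qed.

(** A smooth part and two convolutions with continuous data: the form in which
    the space derivatives can be taken. *)
Lemma heat_decomp b t x : 0 < t -> b <= 1 -> decays_at1 nu b -> 0 < x ->
  heat nu (odd_mean x) b t =
  smear (fun y => rayL b y t) h l x + smear (fun y => rayL b y t) h (- l) x
  - 2 / l * image b t x.
Proof.
move=> t0 b1 db x0; have [C [C0 CE]] := rayL_decay t0 b1 db.
have mr := measurable_rayL_x nu_gt0 nu_lt b1 t0.
have i1 := integrable_smear l x mr CE hc hM.
have i2 := integrable_smear (- l) x mr CE hc hM.
pose p xi := rayL b ((x + xi) / l) t * h xi.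
have ip : mu.-integrable Rp (EFin \o p) by apply: integrable_image => //; exact: ltW.
have ipT := integrable_restrictT (measurable_itv _) ip.
have l0 : l != 0 by rewrite gt_eqF.
have E w : 0 < w -> (p \_ Rp) (l * w - x) = rayL b w t * (if x < l * w then h (l * w - x) else 0).
  move=> w0; rewrite patchE; have [xw|xw] := ltP x (l * w).
    rewrite mem_set/=; last by rewrite in_itv/= andbT subr_gt0.
    by rewrite /p [x + _]addrC subrK mulrAC divff// mul1r.
  by rewrite memNset ?mulr0//= in_itv/= andbT subr_gt0 ltNge xw.
have i3 : mu.-integrable Rp (EFin \o (fun w => rayL b w t * (if x < l * w then h (l * w - x) else 0))).
  have := integrable_subT (measurable_itv `]0, +oo[) (integrable_affine (- x) l0 ipT).
  by apply: eq_integrable_EFin => // w; rewrite /= in_itv/= andbT => w0; exact: E.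
have Z : image b t x = l * (\int[mu]_(w in Rp) (rayL b w t * (if x < l * w then h (l * w - x) else 0)))%R.
  rewrite /image Rintegral_mkcond (Rintegral_affine (- x) l0 ipT) gtr0_norm//.
  congr (_ * _); rewrite [RHS]Rintegral_mkcond; apply: eq_Rintegral => w _.
  rewrite [RHS]patchE; case: ifPn => [|wn].
    by rewrite inE/= in_itv/= andbT; exact: E.
  rewrite patchE memNset//= in_itv/= andbT => xw; case/negP: wn.
  rewrite inE/= in_itv/= andbT -(pmulr_rgt0 _ l_gt0); lra.
have i3' := integrableZ_EFin 2 (measurable_itv _) i3.
have i12 := integrableD_EFin (measurable_itv _) i1 i2.
rewrite Z mulrA divfK//.
rewrite -[2 * _]RintegralZl// /smear -RintegralD// -RintegralB//.
by apply: eq_Rintegral => w _; rewrite /odd_mean mulNr; ring.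
Qed.

End InitialTermInSpace.

(** * The two kernels as ray integrals *)

Section KernelIdentities.
Context {R : realType} (nu : R) (nu_gt0 : 0 < nu) (nu_lt : nu < 2^-1).
Local Notation mu := (@lebesgue_measure R).
Local Notation Rp := (`]0%R, +oo[%classic : set R).
Implicit Types (b x s C K y t w e : R).
Local Notation rayL := (rayL nu).
Local Notation rayV := (rayV nu).
Variables (l : R).
Hypotheses (l_gt0 : 0 < l).

(** Scaling, from time 1 to time [s]. *)
Lemma mainardi_rayL y s : 0 <= y -> 0 < s ->
  mainardi nu (y / s `^ nu) / s `^ nu = rayL (1 - nu) y s / pi.
Proof.
move=> y0 s0; have n0 := nu_gt0; have n1 := nu_lt.
have sn : 0 < s `^ nu by rewrite powR_gt0.
rewrite (mainardi_ray nu_gt0 nu_lt); last by rewrite divr_ge0 ?(ltW sn).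
have b1 : 1 - nu <= 1 by lra.
rewrite (rayL_scaling nu_gt0 nu_lt y b1 s0).
have -> : 1 - nu - 1 = - nu by ring.
by rewrite powRN mulrAC; congr (_ / _); rewrite mulrC.
Qed.

Lemma two_nu_half : 2 * nu / 2 = nu. Proof. by field. Qed.

Lemma initial_kernelE x t xi : 0 < t -> initial_kernel (2 * nu) l x t xi =
  (2 * l * pi)^-1 *
  (rayL (1 - nu) (`|x - xi| / l) t - rayL (1 - nu) (`|x + xi| / l) t).
Proof.
move=> t0; have pn0 : (pi : R) != 0 by rewrite gt_eqF// pi_gt0.
have tn : t `^ nu != 0 by rewrite gt_eqF// powR_gt0.
have l0 : l != 0 by rewrite gt_eqF.
have E z : rayL (1 - nu) (`|z| / l) t = pi * (mainardi nu (`|z| / (l * t `^ nu)) / t `^ nu).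
  have -> : `|z| / (l * t `^ nu) = `|z| / l / t `^ nu by rewrite invfM mulrA.
  rewrite mainardi_rayL//; last by rewrite divr_ge0 ?(ltW l_gt0).
  by rewrite [RHS]mulrC divfK.
rewrite /initial_kernel two_nu_half !E.
move: (pi : R) pn0 => p p0; field.
by rewrite ?p0 ?tn ?l0.
Qed.

(** The factor x / s in the boundary kernel is the one in the Euler relation
    at b = 1. *)
Lemma boundary_kernelE x t tau : 0 < x -> tau < t ->
  boundary_kernel (2 * nu) l x t tau = rayV 0 (x / l) (t - tau) / pi.
Proof.
move=> x0 tt; have s0 : 0 < t - tau by lra.
set s := t - tau in s0 *.
have y0 : 0 < x / l by rewrite divr_gt0.
have pn0 : (pi : R) != 0 by rewrite gt_eqF// pi_gt0.
have tn : s `^ nu != 0 by rewrite gt_eqF// powR_gt0.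
have l0 : l != 0 by rewrite gt_eqF.
have sn0 : s != 0 by rewrite gt_eqF.
have l01 : (0:R) < 1 by [].
rewrite -(rayL_V nu_gt0 nu_lt l01 y0 (ltW s0)).
have := rayL_euler nu_gt0 nu_lt (x / l) (lexx 1) s0.
rewrite subrr mul0r add0r => E.
have -> : rayL 0 (x / l) s = x / l * nu * rayL (1 - nu) (x / l) s / s by rewrite -E mulrAC divff ?mul1r.
have N := mainardi_rayL (ltW y0) s0.
have -> : rayL (1 - nu) (x / l) s = pi * (mainardi nu (x / l / s `^ nu) / s `^ nu).
  by rewrite N [RHS]mulrC divfK.
rewrite /boundary_kernel two_nu_half -/s.
have -> : s `^ (nu + 1) = s `^ nu * s by rewrite powRD ?powRr1 ?(ltW s0)// sn0 implybT.
have -> : x / (l * s `^ nu) = x / l / s `^ nu by rewrite invfM mulrA.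
move: (pi : R) pn0 {N} => p p0; field.
by rewrite ?p0 ?tn ?l0 ?sn0.
Qed.

Section InitialTerm.
Variables (f h : R -> R) (M : R).
Hypotheses (hc : continuous h) (hM : forall w, `|h w| <= M).
Hypotheses (fh : forall xi, 0 < xi -> f xi = h xi) (h_even : forall z, h (- z) = h z).

Let mh : measurable_fun setT h. Proof. exact: continuous_measurable_fun. Qed.

Let bN : 1 - nu <= 1. Proof. by have n0 := nu_gt0; lra. Qed.

(** The substitutions xi = x + l w, on both sides of [x], and xi = l w - x for
    the reflected kernel. *)
Lemma initial_integrand_rayL x t : 0 < x -> 0 < t ->
  mu.-integrable Rp (EFin \o initial_integrand (2 * nu) l f x t) /\
  (\int[mu]_(xi in Rp) initial_integrand (2 * nu) l f x t xi =
   (2 * pi)^-1 * heat nu (odd_mean h l x) (1 - nu) t)%R.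
Proof.
move=> x0 t0; have dN := rayL_bound_N nu_gt0 nu_lt.
have pn0 : (pi : R) != 0 by rewrite gt_eqF// pi_gt0.
have l0 : l != 0 by rewrite gt_eqF.
have li0 : l^-1 != 0 by rewrite invr_eq0.
have [C [C0 CE]] := rayL_decay nu_gt0 nu_lt t0 bN dN.
have M0 : 0 <= M := le_trans (normr_ge0 _) (hM 0).
pose psi z := rayL (1 - nu) `|z| t * h (x + l * z).
have mr := measurable_rayL_x nu_gt0 nu_lt bN t0.
have ipsi : mu.-integrable setT (EFin \o psi).
  apply: (bound_integrable (g := fun z => C * M * (1 + z ^+ 2)^-1)) => //.
  - apply: measurable_funM; first exact: (measurableT_comp mr).
    by apply: measurableT_comp => //; apply: measurable_funD => //; exact: measurable_funM.
  - move=> z _; rewrite normrM mulrAC; apply: ler_pM => //.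
    by apply: (le_trans (CE _ (normr_ge0 z))); rewrite real_normK ?num_real.
  - by apply: integrableZ_EFin => //; exact: integrable_invsqrT.
pose phi xi := rayL (1 - nu) (`|x - xi| / l) t * h xi.
have phiE : phi = (fun xi => psi (l^-1 * xi + - (x / l))).
  apply/funext => xi; rewrite /phi /psi.
  have -> : x + l * (l^-1 * xi + - (x / l)) = xi by field.
  have -> : l^-1 * xi + - (x / l) = (xi - x) / l by field.
  by rewrite normrM distrC (gtr0_norm (_ : 0 < l^-1))// invr_gt0.
have iphi : mu.-integrable setT (EFin \o phi).
  rewrite phiE; exact: integrable_affine.
pose p xi := rayL (1 - nu) ((x + xi) / l) t * h xi.
have ip : mu.-integrable Rp (EFin \o p).
  by apply: (integrable_image nu_gt0 nu_lt hc hM l_gt0) => //; exact: ltW.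
have iphi' := integrable_subT (measurable_itv `]0, +oo[) iphi.
have iE xi : Rp xi -> initial_integrand (2 * nu) l f x t xi = (2 * l * pi)^-1 * (phi xi - p xi).
  rewrite /= in_itv/= andbT => xi0.
  rewrite /initial_integrand initial_kernelE// fh// (ger0_norm (_ : 0 <= x + xi)); last lra.
  by rewrite /phi /p; ring.
have ipp := integrableB_EFin (measurable_itv _) iphi' ip.
have i2 := integrableZ_EFin (2 * l * pi)^-1 (measurable_itv _) ipp.
split; first by apply: eq_integrable_EFin i2 => // xi /iE ->.
have -> : (\int[mu]_(xi in Rp) initial_integrand (2 * nu) l f x t xi)%R =
    (\int[mu]_(xi in Rp) ((2 * l * pi)^-1 * (phi xi - p xi)))%R.
  by apply: eq_Rintegral => xi /set_mem/iE.
have two : (\int[mu]_(xi in Rp) phi xi)%R + (\int[mu]_(xi in Rp) p xi)%R =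
    l * (smear (fun y => rayL (1 - nu) y t) h l x + smear (fun y => rayL (1 - nu) y t) h (- l) x).
  transitivity (\int[mu]_xi phi xi)%R.
    rewrite (Rintegral_two_sided iphi); congr (_ + _).
    apply: eq_Rintegral => xi; rewrite inE/= in_itv/= andbT => xi0.
    by rewrite /phi /p h_even opprK ger0_norm//; lra.
  rewrite (Rintegral_affine x l0 iphi) gtr0_norm//; congr (_ * _).
  have -> : (\int[mu]_z phi (l * z + x))%R = (\int[mu]_z psi z)%R.
    apply: eq_Rintegral => z _; rewrite phiE; congr psi; field.
    exact: l0.
  rewrite (Rintegral_two_sided ipsi); congr (_ + _); apply: eq_Rintegral => w;
    rewrite inE/= in_itv/= andbT => w0; rewrite /psi.
    by rewrite gtr0_norm.
  by rewrite normrN gtr0_norm// mulrN mulNr.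
rewrite (heat_decomp nu_gt0 nu_lt hc hM l_gt0 t0 bN dN x0).
transitivity ((2 * l * pi)^-1 * ((\int[mu]_(xi in Rp) phi xi)%R - (\int[mu]_(xi in Rp) p xi)%R)).
  transitivity ((2 * l * pi)^-1 * (\int[mu]_(xi in Rp) (phi xi - p xi))%R).
    by apply: RintegralZl.
  by congr (_ * _); apply: RintegralB.
have -> : (\int[mu]_(xi in Rp) phi xi)%R = l * (smear (fun y => rayL (1 - nu) y t) h l x +
  smear (fun y => rayL (1 - nu) y t) h (- l) x) - (\int[mu]_(xi in Rp) p xi)%R.
  by rewrite -two addrK.
rewrite /image -/p; set I := (\int[mu]_(xi in Rp) p xi)%R.
move: (pi : R) pn0 {iE i2} => q p0; field.
by rewrite ?p0 ?l0.
Qed.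

(** At x = 0 the odd continuation has mean 0 at every distance. *)
Lemma heat_boundary t : 0 < t ->
  heat nu (odd_mean h l x) (1 - nu) t @[x --> (0:R)^'+] --> (0 : R).
Proof.
move=> t0; have dN := rayL_bound_N nu_gt0 nu_lt.
have [C [C0 CE]] := rayL_decay nu_gt0 nu_lt t0 bN dN.
have mo x := measurable_odd_mean l hc x.
have H : heat nu (odd_mean h l x) (1 - nu) t @[x --> (0:R)^'+] -->
    (\int[mu]_(w in Rp) (rayL (1 - nu) w t * 0))%R.
  apply: (@dominated_cvg_filter R _ _ Rp (fun x w => rayL (1 - nu) w t * odd_mean h l x w) _
     (fun w => C * (4 * M) * (1 + w ^+ 2)^-1) (@sequential_at_right R 0)) => //.
  - apply: nearW => x; apply: measurable_funTS; apply: measurable_funM => //.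
    exact: measurable_rayL_x.
  - apply: nearW => x w; rewrite /= in_itv/= andbT => w0; rewrite normrM mulrAC.
    by apply: ler_pM => //; [exact: CE (ltW w0)|exact: odd_mean_le].
  - by apply: integrableZ_EFin => //; exact: integrable_invsqr.
  - move=> w; rewrite /= in_itv/= andbT => w0; apply: cvgM; first exact: cvg_cst.
    have H : h (x + l * w) + h (x - l * w) - 2 * h (l * w - x) @[x --> (0:R)^'+] --> (0 : R).
      have c : {for (0:R), continuous (fun x => h (x + l * w) + h (x - l * w) - 2 * h (l * w - x))}.
        have cc (k : R -> R) : {for (0:R), continuous k} -> {for (0:R), continuous (h \o k)}.
          by move=> ck; apply: continuous_comp => //; exact: hc.
        apply: cvgB; last first.
          apply: cvgM; first exact: cvg_cst.
          by apply: (cc (fun x => l * w - x)); apply: cvgB; [exact: cvg_cst|exact: cvg_id].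
        apply: cvgD.
          by apply: (cc (fun x => x + l * w)); apply: cvgD; [exact: cvg_id|exact: cvg_cst].
        by apply: (cc (fun x => x - l * w)); apply: cvgB; [exact: cvg_id|exact: cvg_cst].
      have := cvg_at_right_filter c; rewrite add0r sub0r subr0 h_even.
      by rewrite (_ : h (l * w) + h (l * w) - 2 * h (l * w) = 0); last by ring.
    apply: cvg_trans H; apply: near_eq_cvg; near=> x.
    rewrite /odd_mean ifT//; near: x; apply: nbhs_right_lt.
    exact: mulr_gt0.
suff E : (\int[mu]_(w in Rp) (rayL (1 - nu) w t * 0))%R = 0 by rewrite E in H.
by rewrite /Rintegral integral0_eq// => w _; rewrite mulr0.
Unshelve. all: by end_near. Qed.

(** The slope of the initial kernel at its kink is the weight of the initial
    value in the Caputo derivative. *)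
Lemma rayL_zero_time t : 0 < t ->
  rayL (1 - 2 * nu) 0 t = pi * t `^ (- (2 * nu)) * (Gamma (1 - 2 * nu))^-1.
Proof.
move=> t0; have n0 := nu_gt0; have a0 : 0 < 2 * nu by lra.
have pn0 : (pi : R) != 0 by rewrite gt_eqF// pi_gt0.
have b1 : 1 - 2 * nu <= 1 by lra.
rewrite (rayL_scaling nu_gt0 nu_lt 0 b1 t0) mul0r rayL_zero// (inv_Gamma a0).
have -> : 1 - 2 * nu - 1 = - (2 * nu) by ring.
move: (euler_gamma _ * sin _) => X; move: (pi : R) pn0 => p p0; field.
exact: p0.
Qed.

Definition heat_flux t x :=
  smear (fun y => rayL (1 - 2 * nu) y t) h l x
  - smear (fun y => rayL (1 - 2 * nu) y t) h (- l) x
  + 2 / l * image nu h l (1 - 2 * nu) t x.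

(** The kinks of the two sides cancel in the first derivative. *)
Lemma is_derive_heat_x t x : 0 < t -> 0 < x ->
  is_derive x 1 (fun x => heat nu (odd_mean h l x) (1 - nu) t) (l^-1 * heat_flux t x).
Proof.
move=> t0 x0; have n0 := nu_gt0; have dN := rayL_bound_N nu_gt0 nu_lt.
have dNx := rayL_bound_Nx nu_gt0 nu_lt.
have l0 : l != 0 by rewrite gt_eqF.
have nl0 : - l != 0 by rewrite oppr_eq0.
have E : 1 - nu - nu = 1 - 2 * nu by ring.
have dNx' : decays_at1 nu (1 - nu - nu) by rewrite E.
have d1 := is_derive_smear_rayL nu_gt0 nu_lt hc hM x t0 bN dN dNx' l0.
have d2 := is_derive_smear_rayL nu_gt0 nu_lt hc hM x t0 bN dN dNx' nl0.
have d3 := is_derive_image nu_gt0 nu_lt hc hM l_gt0 t0 bN dN dNx' x0.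
rewrite E in d1 d2 d3.
have d : is_derive x 1 (fun x => smear (fun y => rayL (1 - nu) y t) h l x +
    smear (fun y => rayL (1 - nu) y t) h (- l) x - 2 / l * image nu h l (1 - nu) t x)
    (l^-1 * heat_flux t x).
  apply: is_derive_eq; rewrite ?scale_realE invrN /heat_flux; field.
  exact: l0.
apply: near_eq_is_derive d; near=> x'.
rewrite (heat_decomp nu_gt0 nu_lt hc hM l_gt0 t0 bN dN)//; near: x'; exact: lt_nbhsr.
Unshelve. all: by end_near. Qed.

(** In the second derivative they add, and leave the value of the data at [x].
    *)
Lemma is_derive_heat_flux t x : 0 < t -> 0 < x ->
  is_derive x 1 (heat_flux t)
    (l^-1 * (heat nu (odd_mean h l x) (1 - 3 * nu) t - 2 * rayL (1 - 2 * nu) 0 t * h x)).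
Proof.
move=> t0 x0; have n0 := nu_gt0; have n1 := nu_lt.
have dNx := rayL_bound_Nx nu_gt0 nu_lt.
have l0 : l != 0 by rewrite gt_eqF.
have nl0 : - l != 0 by rewrite oppr_eq0.
have b1 : 1 - 2 * nu <= 1 by lra.
have b3 : 1 - 3 * nu <= 1 by lra.
have E : 1 - 2 * nu - nu = 1 - 3 * nu by ring.
have dd : decays_at1 nu (1 - 3 * nu) by apply: (rayL_bound0 nu_gt0 nu_lt); lra.
have dd' : decays_at1 nu (1 - 2 * nu - nu) by rewrite E.
have d1 := is_derive_smear_rayL nu_gt0 nu_lt hc hM x t0 b1 dNx dd' l0.
have d2 := is_derive_smear_rayL nu_gt0 nu_lt hc hM x t0 b1 dNx dd' nl0.
have d3 := is_derive_image nu_gt0 nu_lt hc hM l_gt0 t0 b1 dNx dd' x0.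
rewrite E in d1 d2 d3.
rewrite (heat_decomp nu_gt0 nu_lt hc hM l_gt0 t0 b3 dd x0) /heat_flux.
apply: is_derive_eq; rewrite ?scale_realE invrN; field.
exact: l0.
Qed.

End InitialTerm.
End KernelIdentities.

(** * The candidate solves the problem *)

Section Solution.
Context {R : realType} (nu : R) (nu_gt0 : 0 < nu) (nu_lt : nu < 2^-1).
Local Notation mu := (@lebesgue_measure R).
Local Notation Rp := (`]0%R, +oo[%classic : set R).
Implicit Types (b x s C K y t w e : R).
Variables (l : R) (f h g : R -> R) (M : R).
Hypotheses (l_gt0 : 0 < l).
Hypotheses (hc : continuous h) (hM : forall w, `|h w| <= M).
Hypotheses (fh : forall xi, 0 < xi -> f xi = h xi) (h_even : forall z, h (- z) = h z).
Local Notation m := (odd_mean h l).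

Let mm x : measurable_fun setT (m x). Proof. exact: measurable_odd_mean. Qed.
Let mM x w : `|m x w| <= 4 * M. Proof. exact: odd_mean_le. Qed.

Section BoundaryData.
Variables (G : R -> R) (N S : R).
Hypotheses (mG : measurable_fun setT G) (GN : forall w, `|G w| <= N) (S_gt0 : 0 < S).
Hypotheses (gG : forall tau, 0 < tau < S -> g tau = G tau).
Local Notation V := (signal nu G S).

Lemma boundary_integrand_signal x t : 0 < x -> 0 < t <= S ->
  mu.-integrable `]0, t[ (EFin \o boundary_integrand (2 * nu) l g x t) /\
  (\int[mu]_(tau in `]0, t[) boundary_integrand (2 * nu) l g x t tau =
   pi^-1 * V 0 (x / l) t)%R.
Proof.
move=> x0 /andP[t0 tS]; have y0 : 0 < x / l by rewrite divr_gt0.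
have i1 := integrable_signal_integrand nu_gt0 nu_lt S mG GN t ltr01 y0.
have i2 : mu.-integrable `]0, t[ (EFin \o (fun sg => rayV nu 0 (x / l) (t - sg) * G sg)).
  by apply: integrableS i1 => //; apply: subset_itvl; rewrite bnd_simp.
have bE tau : `]0, t[%classic tau ->
    boundary_integrand (2 * nu) l g x t tau = pi^-1 * (rayV nu 0 (x / l) (t - tau) * G tau).
  rewrite /= in_itv/= => /andP[tau0 taut].
  rewrite /boundary_integrand (boundary_kernelE nu_gt0 nu_lt l_gt0 x0 taut) gG ?tau0 ?(lt_le_trans taut)//.
  by rewrite mulrAC mulrC.
split.
  have := integrableZ_EFin pi^-1 (measurable_itv _) i2.
  by apply: eq_integrable_EFin => // tau /bE ->.
rewrite (signal_causal nu_gt0 nu_lt G ltr01 y0) ?(ltW t0)//.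
rewrite -RintegralZl//; apply: eq_Rintegral => tau /set_mem; exact: bE.
Qed.

Lemma candidate_rays x t : 0 < x -> 0 < t <= S -> candidate (2 * nu) l f g x t =
  (2 * pi)^-1 * heat nu (m x) (1 - nu) t + pi^-1 * V 0 (x / l) t.
Proof.
move=> x0 tS; have /andP[t0 _] := tS.
have [_ E1] := initial_integrand_rayL nu_gt0 nu_lt l_gt0 hc hM fh h_even x0 t0.
have [_ E2] := boundary_integrand_signal x0 tS.
by rewrite /candidate E1 E2.
Qed.

Definition rate x tau := (2 * pi)^-1 * heat nu (m x) (- nu) tau + pi^-1 * V (-1) (x / l) tau.

Lemma is_derive_candidate_t x t : 0 < x -> 0 < t < S ->
  is_derive t 1 (candidate (2 * nu) l f g x) (rate x t).
Proof.
move=> x0 tS; have /andP[t0 _] := tS; have y0 : 0 < x / l by rewrite divr_gt0.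
have d1 := is_derive_heat_N nu_gt0 nu_lt (mm x) (mM x) t0.
have d2 := is_derive_signal_t nu_gt0 nu_lt S mG GN t ltr01 y0.
rewrite sub0r in d2.
have d : is_derive t 1 (fun t => (2 * pi)^-1 * heat nu (m x) (1 - nu) t + pi^-1 * V 0 (x / l) t) (rate x t).
  by apply: is_derive_eq; rewrite ?scale_realE.
apply: near_eq_is_derive d; near=> t'.
have : t' \in `]0, S[ by near: t'; apply: near_in_itvoo; rewrite in_itv.
by rewrite in_itv/= => /andP[t'0 t'S]; rewrite candidate_rays// t'0 ltW.
Unshelve. all: by end_near. Qed.

Lemma caputo_integrandE x t tau : 0 < x -> t < S -> 0 < tau < t ->
  caputo_integrand (2 * nu) (candidate (2 * nu) l f g x) t tau =
  (2 * pi)^-1 * ((t - tau) `^ (- (2 * nu)) * heat nu (m x) (- nu) tau) +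
  pi^-1 * ((t - tau) `^ (- (2 * nu)) * V (-1) (x / l) tau).
Proof.
move=> x0 tS /andP[tau0 taut]; have tauS : 0 < tau < S by rewrite tau0 (lt_trans taut).
have d := is_derive_candidate_t x0 tauS.
by rewrite /caputo_integrand derive1E derive_val /rate; ring.
Qed.

(** The initial term contributes the limit of [truncated_heat_cvg], whose last
    term matches the kink of the kernel by [rayL_zero_time]; the boundary term
    contributes [frac_signal]. *)
Lemma caputo_candidate x t : 0 < x -> 0 < t < S ->
  caputo_exists (2 * nu) (candidate (2 * nu) l f g x) t /\
  caputo (2 * nu) (candidate (2 * nu) l f g x) t =
  (2 * pi)^-1 * (heat nu (m x) (1 - 3 * nu) t - 2 * rayL nu (1 - 2 * nu) 0 t * h x) +
  pi^-1 * V (- (2 * nu)) (x / l) t.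
Proof.
move=> x0 /andP[t0 tS]; have n0 := nu_gt0; have n1 := nu_lt.
have y0 : 0 < x / l by rewrite divr_gt0.
set c := candidate _ _ _ _ x.
pose A tau := (t - tau) `^ (- (2 * nu)) * heat nu (m x) (- nu) tau.
pose B tau := (t - tau) `^ (- (2 * nu)) * V (-1) (x / l) tau.
have cE e tau : 0 < e -> `]e, t[%classic tau ->
    caputo_integrand (2 * nu) c t tau = (2 * pi)^-1 * A tau + pi^-1 * B tau.
  move=> e0; rewrite /= in_itv/= => /andP[etau taut].
  by apply: caputo_integrandE => //; rewrite taut andbT (lt_trans e0).
have iB : mu.-integrable `]0, t[ (EFin \o B) := frac_signal_integrable nu_gt0 nu_lt S mG GN y0 t0.
have iBe e : 0 < e < t -> mu.-integrable `]e, t[ (EFin \o B).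
  move=> /andP[e0 et]; apply: integrableS iB => //; apply: subset_itvr; rewrite bnd_simp.
  exact: ltW.
have iA e : 0 < e < t -> mu.-integrable `]e, t[ (EFin \o A).
  exact: truncated_heat_integrable.
have iAZ e et := integrableZ_EFin (2 * pi)^-1 (measurable_itv _) (iA e et).
have iBZ e et := integrableZ_EFin pi^-1 (measurable_itv _) (iBe e et).
have iAB e et := integrableD_EFin (measurable_itv _) (iAZ e et) (iBZ e et).
have iC e : 0 < e < t -> mu.-integrable `]e, t[ (EFin \o caputo_integrand (2 * nu) c t).
  move=> et; have /andP[e0 _] := et; apply: eq_integrable_EFin (iAB e et) => // tau Htau.
  by rewrite (cE e).
have tE e : 0 < e < t -> caputo_truncated (2 * nu) c t e = (Gamma (1 - 2 * nu))^-1 *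
    ((2 * pi)^-1 * (\int[mu]_(tau in `]e, t[) A tau)%R + pi^-1 * (\int[mu]_(tau in `]e, t[) B tau)%R).
  move=> et; have /andP[e0 _] := et; rewrite /caputo_truncated; congr (_ * _).
  transitivity (\int[mu]_(tau in `]e, t[) ((2 * pi)^-1 * A tau + pi^-1 * B tau))%R.
    by apply: eq_Rintegral => tau /set_mem; exact: cE.
  transitivity ((\int[mu]_(tau in `]e, t[) ((2 * pi)^-1 * A tau))%R + (\int[mu]_(tau in `]e, t[) (pi^-1 * B tau))%R).
    by apply: RintegralD => //; [exact: iAZ|exact: iBZ].
  by congr (_ + _); apply: RintegralZl => //; [exact: iA|exact: iBe].
have cA := truncated_heat_cvg nu_gt0 nu_lt (mm x) (mM x) t0 (odd_mean_cvg0 hc l_gt0 x0).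
have cB := Rintegral_truncated_cvg t0 iB.
rewrite (frac_signal nu_gt0 nu_lt S mG GN y0 t0) in cB.
have Gamma_gt0E : Gamma (1 - 2 * nu) = euler_gamma (1 - 2 * nu) :> R.
  by rewrite /Gamma ifT//; lra.
have a0 : 0 < 2 * nu by lra.
have G0 : Gamma (1 - 2 * nu) != 0 :> R.
  have g01 : 0 < 1 - 2 * nu < 1 by apply/andP; split; lra.
  rewrite Gamma_gt0E; apply/eqP => E0; have := euler_reflection g01.
  by rewrite E0 mul0r => /eqP; rewrite eq_sym gt_eqF// pi_gt0.
have lim_t : caputo_truncated (2 * nu) c t e @[e --> (0:R)^'+] -->
  (2 * pi)^-1 * (heat nu (m x) (1 - 3 * nu) t - 2 * rayL nu (1 - 2 * nu) 0 t * h x) +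
  pi^-1 * V (- (2 * nu)) (x / l) t.
  have H : (Gamma (1 - 2 * nu))^-1 *
    ((2 * pi)^-1 * (\int[mu]_(tau in `]e, t[) A tau)%R + pi^-1 * (\int[mu]_(tau in `]e, t[) B tau)%R)
    @[e --> (0:R)^'+] --> (Gamma (1 - 2 * nu))^-1 * ((2 * pi)^-1 *
      (euler_gamma (1 - 2 * nu) * heat nu (m x) (1 - 3 * nu) t - t `^ (- (2 * nu)) * (pi * (2 * h x)))
      + pi^-1 * (euler_gamma (1 - 2 * nu) * V (- (2 * nu)) (x / l) t)).
    apply: cvgM; first exact: cvg_cst.
    by apply: cvgD; apply: cvgM => //; exact: cvg_cst.
  have -> : (2 * pi)^-1 * (heat nu (m x) (1 - 3 * nu) t - 2 * rayL nu (1 - 2 * nu) 0 t * h x) +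
      pi^-1 * V (- (2 * nu)) (x / l) t = (Gamma (1 - 2 * nu))^-1 * ((2 * pi)^-1 *
      (euler_gamma (1 - 2 * nu) * heat nu (m x) (1 - 3 * nu) t - t `^ (- (2 * nu)) * (pi * (2 * h x)))
      + pi^-1 * (euler_gamma (1 - 2 * nu) * V (- (2 * nu)) (x / l) t)).
    rewrite -Gamma_gt0E (rayL_zero_time nu_gt0 nu_lt t0).
    have pn0 : (pi : R) != 0 by rewrite gt_eqF// pi_gt0.
    move: (heat _ _ _ _) (V _ _ _) (Gamma _) G0 => X Y Z Z0.
    move: (pi : R) pn0 => p p0; field.
    by rewrite ?p0 ?Z0.
  apply: cvg_trans H; apply: near_eq_cvg; near=> e; rewrite tE//.
  by apply/andP; split; near: e; [exact: nbhs_right_gt|exact: nbhs_right_lt].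
split; last exact: cvg_lim lim_t.
split.
- move=> tau /andP[tau0 taut]; have tauS : 0 < tau < S by rewrite tau0 (lt_trans taut).
  exact: (@ex_derive _ _ _ _ _ _ _ (is_derive_candidate_t x0 tauS)).
- exact: iC.
- by apply/cvg_ex; eexists; exact: lim_t.
Unshelve. all: by end_near. Qed.

Definition flux t x := (2 * pi)^-1 * (l^-1 * heat_flux nu l h t x)
  - pi^-1 * (l^-1 * V (- nu) (x / l) t).

Lemma is_derive_div x : is_derive x (1:R) (fun x : R => x / l) l^-1.
Proof. by apply: is_derive_eq; rewrite ?scale_realE; ring. Qed.

Lemma is_derive_candidate_x t x : 0 < t <= S -> 0 < x ->
  is_derive x 1 (candidate (2 * nu) l f g ^~ t) (flux t x).
Proof.
move=> tS x0; have /andP[t0 _] := tS; have y0 : 0 < x / l by rewrite divr_gt0.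
have d1 := is_derive_heat_x nu_gt0 nu_lt l_gt0 hc hM t0 x0.
have d2 := @is_derive1_comp _ (fun y => V 0 y t) (fun x => x / l) _ _ _
  (is_derive_signal_y nu_gt0 nu_lt S mG GN t ltr01 y0) (is_derive_div x).
rewrite sub0r in d2.
have d : is_derive x 1 (fun x => (2 * pi)^-1 * heat nu (m x) (1 - nu) t + pi^-1 * V 0 (x / l) t) (flux t x).
  by apply: is_derive_eq; rewrite ?scale_realE /flux /=; ring.
apply: near_eq_is_derive d; near=> x'.
have x'0 : 0 < x' by near: x'; exact: lt_nbhsr.
by rewrite candidate_rays.
Unshelve. all: by end_near. Qed.

Lemma is_derive_flux t x : 0 < t <= S -> 0 < x ->
  is_derive x 1 (flux t) (l ^- 2 * ((2 * pi)^-1 *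
    (heat nu (m x) (1 - 3 * nu) t - 2 * rayL nu (1 - 2 * nu) 0 t * h x) +
    pi^-1 * V (- (2 * nu)) (x / l) t)).
Proof.
move=> tS x0; have /andP[t0 _] := tS; have y0 : 0 < x / l by rewrite divr_gt0.
have nN : - nu < 1 by have n0 := nu_gt0; lra.
have d1 := is_derive_heat_flux nu_gt0 nu_lt l_gt0 hc hM t0 x0.
have d2 := @is_derive1_comp _ (fun y => V (- nu) y t) (fun x => x / l) _ _ _
  (is_derive_signal_y nu_gt0 nu_lt S mG GN t nN y0) (is_derive_div x).
have E : - nu - nu = - (2 * nu) by ring.
rewrite E in d2.
by apply: is_derive_eq; rewrite ?scale_realE /= -exprVn; ring.
Qed.

(** Both sides are the same combination of ray integrals of index 1 - 3 nu and
    - 2 nu: two derivatives in space and one Caputo derivative in time each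
    lower the index by 2 nu. *)
Lemma candidate_equation x t : 0 < x -> 0 < t < S ->
  [/\ caputo_exists (2 * nu) (candidate (2 * nu) l f g x) t,
      derivable (candidate (2 * nu) l f g ^~ t) x 1,
      derivable (((candidate (2 * nu) l f g ^~ t)^`())%classic) x 1 &
      caputo (2 * nu) (candidate (2 * nu) l f g x) t =
      l ^+ 2 * ((candidate (2 * nu) l f g ^~ t)^`(2))%classic x].
Proof.
move=> x0 tS; have /andP[t0 tS'] := tS.
have tS2 : 0 < t <= S by rewrite t0 ltW.
have [ce cE] := caputo_candidate x0 tS.
have d1 x' (x'0 : 0 < x') := is_derive_candidate_x tS2 x'0.
have fE : \near x, flux t x = ((candidate (2 * nu) l f g ^~ t)^`())%classic x.
  near=> x'; have x'0 : 0 < x' by near: x'; exact: lt_nbhsr.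
  by rewrite derive1E; have d := d1 _ x'0; rewrite derive_val.
have d2 := near_eq_is_derive fE (is_derive_flux tS2 x0).
split => //.
- exact: (@ex_derive _ _ _ _ _ _ _ (d1 _ x0)).
- rewrite cE [derive1n _ _]/= /derive1n/= derive1E derive_val.
  by rewrite mulrA -exprVn -exprMn divff ?expr1n ?mul1r// gt_eqF.
Unshelve. all: by end_near. Qed.

Lemma candidate_initial x : 0 < x ->
  candidate (2 * nu) l f g x t @[t --> (0:R)^'+] --> f x.
Proof.
move=> x0; have y0 : 0 < x / l by rewrite divr_gt0.
have pn0 : (pi : R) != 0 by rewrite gt_eqF// pi_gt0.
have H : (2 * pi)^-1 * heat nu (m x) (1 - nu) t + pi^-1 * V 0 (x / l) t @[t --> (0:R)^'+]
    --> (2 * pi)^-1 * (pi * (2 * h x)) + pi^-1 * 0.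
  apply: cvgD; apply: cvgM; try exact: cvg_cst.
    exact: (heat_cvg0 nu_gt0 nu_lt (mm x) (mM x) (odd_mean_cvg0 hc l_gt0 x0)).
  exact: (signal_cvg0 nu_gt0 nu_lt mG GN S_gt0 y0).
have E : (2 * pi)^-1 * (pi * (2 * h x)) + pi^-1 * 0 = f x.
  by rewrite fh//; move: (pi : R) pn0 {H} => p p0; field; exact: p0.
rewrite E in H; apply: cvg_trans H; apply: near_eq_cvg; near=> t.
rewrite candidate_rays//; apply/andP; split; near: t; first exact: nbhs_right_gt.
exact: nbhs_right_le.
Unshelve. all: by end_near. Qed.

Lemma candidate_boundary t : 0 < t < S -> {for t, continuous g} ->
  candidate (2 * nu) l f g x t @[x --> (0:R)^'+] --> g t.
Proof.
move=> tS gt; have /andP[t0 tS'] := tS; have tS2 : 0 < t <= S by rewrite t0 ltW.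
have pn0 : (pi : R) != 0 by rewrite gt_eqF// pi_gt0.
have Gt : G s @[s --> t^'-] --> G t.
  rewrite -gG//; have := cvg_at_left_filter gt; apply: cvg_trans; apply: near_eq_cvg.
  near=> s; have st : s < t by near: s; exact: nbhs_left_lt.
  rewrite gG// (lt_trans st tS') andbT; near: s; exact: nbhs_left_gt.
have HV := signal_boundary nu_gt0 nu_lt mG GN tS2 Gt.
have Hy : V 0 (x / l) t @[x --> (0:R)^'+] --> pi * G t.
  apply/cvg_at_rightP => u [u0 ucv].
  have := (cvg_at_rightP _ _ _).1 HV (fun n => u n / l); apply; split.
    by move=> n; rewrite divr_gt0.
  by rewrite -(mul0r l^-1); apply: cvgM => //; exact: cvg_cst.
have H : (2 * pi)^-1 * heat nu (m x) (1 - nu) t + pi^-1 * V 0 (x / l) t @[x --> (0:R)^'+]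
    --> (2 * pi)^-1 * 0 + pi^-1 * (pi * G t).
  apply: cvgD; apply: cvgM => //; try exact: cvg_cst.
  exact: heat_boundary.
rewrite mulr0 add0r mulrA mulVf// mul1r -gG// in H.
apply: cvg_trans H; apply: near_eq_cvg; near=> x.
by rewrite candidate_rays//; near: x; exact: nbhs_right_gt.
Unshelve. all: by end_near. Qed.

End BoundaryData.
End Solution.

(** * Continuity of the data and conclusion *)

Section Data.
Context {R : realType}.

Lemma continuous_even_extension (f : R -> R) :
  {within `[0, +oo[, continuous f} -> continuous (fun z : R => f `|z|).
Proof.
move=> /continuous_within_itvcyP[cf f0] z; have [->|z0] := eqVneq z 0; last first.
  apply: continuous_comp; first exact: norm_continuous.
  by apply: cf; rewrite in_itv/= andbT normr_gt0.
rewrite /continuous_at normr0; apply/cvgrPdist_lt => e e0.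
have /cvgrPdist_lt/(_ _ e0) := f0.
rewrite near_withinE => H.
have n0 : `|y| @[y --> (0:R)] --> (0:R).
  by have := @norm_continuous R R 0; rewrite /continuous_at normr0.
have H' : \forall y \near (0:R), 0 < `|y| -> `|f 0 - f `|y| | < e := n0 _ H.
apply: filterS H' => y /=.
by have [->|y0] := eqVneq y 0; [rewrite normr0 subrr normr0|apply; rewrite normr_gt0].
Qed.

(** Near T the function may be unbounded, but a solution up to time [t] sees
    it on a compact interval only. *)
Lemma bounded_restriction (g : R -> R) (S T : R) : 0 < S < T ->
  {within `[0, T[, continuous g} ->
  {in `]0, S[, continuous g} /\ exists (G : R -> R) N, [/\ measurable_fun setT G,
    forall w : R, `|G w| <= N & forall tau, 0 < tau < S -> g tau = G tau].
Proof.
move=> /andP[S0 ST] cg.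
have cS : {within `[0, S], continuous g}.
  by apply: continuous_subspaceW cg; apply: subset_itvl; rewrite bnd_simp.
have cgS : {in `]0, S[, continuous g}.
  by have /(continuous_within_itvP _ S0)[] := cS.
split => //; exists (g \_ `]0, S[).
have [c1 _ H1] := EVT_max (ltW S0) cS; have [c2 _ H2] := EVT_min (ltW S0) cS.
(* g lies between its minimum at c2 and its maximum at c1. *)
exists (`|g c1| + `|g c2|); split.
- apply/(measurable_restrictT _ _).1 => //.
  by apply: open_continuous_measurable_fun => // x /set_mem; exact: cgS.
- move=> w; rewrite patchE; case: ifPn => [|_]; last by rewrite normr0 addr_ge0.
  move=> /set_mem/subset_itv_oo_cc wS; rewrite ler_norml.
  have h1 := H1 _ wS; have h2 := H2 _ wS.
  have n1 := ler_norm (g c1); have n2 := ler_norm (- g c2); rewrite normrN in n2.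
  have p1 := normr_ge0 (g c1); have p2 := normr_ge0 (g c2).
  by apply/andP; split; lra.
- by move=> tau tS; rewrite patchE mem_set//= in_itv.
Qed.

End Data.

Unset Implicit Arguments.

Theorem theorem2 (R : realType) (alpha lambda T : R) (f g : R -> R) :
  0 < alpha < 1 -> 0 < lambda -> 0 < T ->
  {within `[0, +oo[, continuous f} ->
  (exists B : R, forall x : R, 0 <= x -> `|f x| <= B) ->
  {within `[0, T[, continuous g} ->
  (forall x t : R, 0 < x -> 0 < t < T ->
     (@lebesgue_measure R).-integrable `]0, +oo[
       (EFin \o initial_integrand alpha lambda f x t) /\
     (@lebesgue_measure R).-integrable `]0, t[
       (EFin \o boundary_integrand alpha lambda g x t)) /\
  is_solution alpha lambda T f g (candidate alpha lambda f g).
Proof.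
move=> /andP[a0 a1] l0 T0 cf [B fB] cg.
pose nu := alpha / 2; have aE : alpha = 2 * nu by rewrite /nu; field.
have nu0 : 0 < nu by rewrite /nu; lra.
have nu1 : nu < 2^-1 by rewrite /nu; lra.
rewrite aE; pose h (z : R) := f `|z|.
have hc : continuous h by exact: continuous_even_extension.
have hM w : `|h w| <= B by exact: fB.
have fh xi : 0 < xi -> f xi = h xi by move=> xi0; rewrite /h gtr0_norm.
have he z : h (- z) = h z by rewrite /h normrN.
have data t : 0 < t < T -> exists S (G : R -> R) N, [/\ 0 < t < S,
    {for t, continuous g}, measurable_fun setT G,
    forall w : R, `|G w| <= N & forall tau, 0 < tau < S -> g tau = G tau].
  move=> /andP[t0 tT]; pose S := (t + T) / 2.
  have S0 : 0 < S < T by rewrite /S; apply/andP; split; lra.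
  have tS : 0 < t < S by rewrite /S; apply/andP; split; lra.
  have /andP[S0' _] := S0.
  have [cgS [G [N [mG GN gG]]]] := bounded_restriction S0 cg.
  exists S, G, N; split => //; apply: cgS; by rewrite in_itv.
split=> [x t x0 tT|].
  have [S [G [N [tS cgt mG GN gG]]]] := data _ tT.
  have /andP[t0 tS'] := tS; have tS2 : 0 < t <= S by rewrite t0 ltW.
  split; first by have [] := initial_integrand_rayL nu0 nu1 l0 hc hM fh he x0 t0.
  by have [] := boundary_integrand_signal nu0 nu1 l0 mG GN gG x0 tS2.
split=> [x t x0 tT|x x0|t tT].
- have [S [G [N [tS cgt mG GN gG]]]] := data _ tT.
  exact: (candidate_equation nu0 nu1 l0 hc hM fh he mG GN gG x0 tS).
- have T2 : 0 < T / 2 < T by apply/andP; split; lra.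
  have [S [G [N [/andP[t0 tS] cgt mG GN gG]]]] := data _ T2.
  have S0 := lt_trans t0 tS.
  exact: (candidate_initial nu0 nu1 l0 hc hM fh he mG GN S0 gG x0).
- have [S [G [N [tS cgt mG GN gG]]]] := data _ tT.
  exact: (candidate_boundary nu0 nu1 l0 hc hM fh he mG GN gG tS cgt).
Qed.
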